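(* Let $\beta>1$ be a Salem number of degree $m$, $f\in\mathbb{Z}[u^{\pm1}]$ its minimal polynomial, and let $\alpha=\alpha_{R_1/(f)}$ be the ergodic and nonexpansive automorphism of $X=X_{R_1/(f)}\cong\mathbb{T}^m$. Suppose that $\nu$ is a weakly $\mathsf{d}$-bounded $\bar\sigma$-invariant probability measure on the two-sided beta-shift $V_\beta$, let $\mathsf{b}:\ell^\infty(\mathbb{Z},\mathbb{Z})\to W_f^{(0)}$ be a Borel map with $\mathsf{d}(1,v)=\mathsf{b}(\bar\sigma v)-\bar\sigma\mathsf{b}(v)$ for $\nu$-a.e. $v$, and let $\xi^*_{\mathsf{b}}:V_\beta\to X$ be the $\nu$-a.e. equivariant Borel map $\xi^*_{\mathsf{b}}(v)=\xi^*(v)+\rho(\mathsf{b}(v))$. Then $\xi^*_{\mathsf{b}}$ is countable-to-one $\nu$-a.e., and the $\alpha$-invariant probability measure $\mu=(\xi^*_{\mathsf{b}})_*\nu$ on $X$ is singular with respect to Haar measure and satisfies $h_\nu(\bar\sigma)=h_\mu(\alpha)$.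
   Context: A Salem number is an algebraic unit $\beta>1$ whose other conjugates all have absolute value $\le1$, with at least one conjugate of absolute value $1$. Let $f=f_0+\dots+f_mu^m\in R_1=\mathbb{Z}[u^{\pm1}]$ be its minimal polynomial ($f_m=1$). Let $\Omega_f\subset\mathbb{C}$ be the set of roots of $f$, and $\Omega_f^-$, $\Omega_f^{(0)}$, $\Omega_f^+$ the sets of roots of absolute value $<1$, $=1$, $>1$, respectively. $\mathbb{T}=\mathbb{R}/\mathbb{Z}$, $X=X_{R_1/(f)}=\{x\in\mathbb{T}^{\mathbb{Z}}:\sum_{j=0}^m f_jx_{k+j}=0 \text{ for every } k\in\mathbb{Z}\}$, and $\alpha=\alpha_{R_1/(f)}$ is the restriction to $X$ of the shift $\tau(x)_n=x_{n+1}$. Beta-shift: let $T_\beta x=\beta x \pmod 1$, and for $x\in[0,1)$ let $e_\beta(x)=(e_\beta(x)_n)_{n\ge1}$ with $e_\beta(x)_n=\beta T_\beta^{n-1}x-T_\beta^nx$. Let $V_\beta^+$ be the closure of $\{e_\beta(x):x\in[0,1)\}$ (product topology), and $V_\beta=\{v\in\ell^\infty(\mathbb{Z},\mathbb{Z}):(v_{n+1},v_{n+2},\dots)\in V_\beta^+\text{ for every }n\in\mathbb{Z}\}$. $\ell^\infty(\mathbb{Z},\mathbb{R})$ is the space of bounded real sequences, with the topology of coordinatewise convergence; $\ell^\infty(\mathbb{Z},\mathbb{Z})$ is the subgroup of integer-valued sequences. The shift is $(\bar\sigma w)_n=w_{n+1}$, and $f(\bar\sigma)=\sum_{j=0}^m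 f_j\bar\sigma^j$. Put $W_f^{(0)}=\{w\in\ell^\infty(\mathbb{Z},\mathbb{R}): f(\bar\sigma)w=0\}$, a finite-dimensional real vector space. Let $\rho$ be coordinatewise reduction mod $1$ of real sequences. Write $\frac1{f(u)}=\frac1{f_m}\sum_{\omega\in\Omega_f}\frac{b_\omega}{u-\omega}$ with $b_\omega\in\mathbb{C}$ and define $w^{\Delta_+},w^{\Delta_-}\in\ell^\infty(\mathbb{Z},\mathbb{R})$ by $w^{\Delta_+}_n=\frac1{f_m}\sum_{\omega\in\Omega_f^-}b_\omega\omega^{n-1}$ if $n\ge1$, $w^{\Delta_+}_n=-\frac1{f_m}\sum_{\omega\in\Omega_f^{(0)}\cup\Omega_f^+}b_\omega\omega^{n-1}$ if $n\le0$; $w^{\Delta_-}_n=\frac1{f_m}\sum_{\omega\in\Omega_f^-\cup\Omega_f^{(0)}}b_\omega\omega^{n-1}$ if $n\ge1$, $w^{\Delta_-}_n=-\frac1{f_m}\sum_{\omega\in\Omega_f^+}b_\omega\omega^{n-1}$ if $n\le0$. For $v\in\ell^\infty(\mathbb{Z},\mathbb{Z})$ put $\bar\xi^*(v)=\sum_{n\ge0}v_n\bar\sigma^{-n}w^{\Delta_-}+\sum_{n<0}v_n\bar\sigma^{-n}w^{\Delta_+}$ (coordinatewise convergent; a real sequence of at most linear growth, to which $\bar\sigma$ is extended by the same formula), and $\xi^*=\rho\circ\bar\xi^*:\ell^\infty(\mathbb{Z},\mathbb{Z})\to X$. For $n\in\mathbb{Z}$ put $\mathsf{d}(n,v)=\bar\sigma^n\bar\xi^*(v)-\bar\xi^*(\bar\sigma^nv)\in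 W_f^{(0)}$. A $\bar\sigma$-invariant probability measure $\nu$ on $\ell^\infty(\mathbb{Z},\mathbb{Z})$ is weakly $\mathsf{d}$-bounded if it satisfies the following equivalent conditions: (i) for every $\varepsilon>0$ there is a compact $C_\varepsilon\subset W_f^{(0)}$ with $\nu(\{v:\mathsf{d}(k,v)\in C_\varepsilon\})>1-\varepsilon$ for every $k\in\mathbb{Z}$; (ii) there is a Borel map $\mathsf{b}:\ell^\infty(\mathbb{Z},\mathbb{Z})\to W_f^{(0)}$ with $\mathsf{d}(1,v)=\mathsf{b}(\bar\sigma v)-\bar\sigma\mathsf{b}(v)$ for $\nu$-a.e. $v$. A probability measure on $V_\beta$ is regarded as a measure on $\ell^\infty(\mathbb{Z},\mathbb{Z})$ giving $V_\beta$ full measure. A Borel map $g:Z_1\to Z_2$ of standard Borel spaces is countable-to-one $\nu$-a.e. (for a probability measure $\nu$ on $Z_1$) if there are Borel sets $Z_1'\subset Z_1$, $Z_2'\subset Z_2$ with $\nu(Z_1')=g_*\nu(Z_2')=1$ such that $g^{-1}(z)\cap Z_1'$ is countable for every $z\in Z_2'$. $h_\nu(\bar\sigma)$, $h_\mu(\alpha)$ denote measure-theoretic entropies. *)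

(* Defs.v *)
From HB Require Import structures.
From mathcomp Require Import all_boot all_order all_algebra.
From mathcomp Require Import ring_quotient.
From mathcomp Require Import all_classical all_reals all_analysis.
From mathcomp Require Import complex.

Set Implicit Arguments.
Unset Strict Implicit.
Unset Printing Implicit Defensive.

Import Order.TTheory GRing.Theory Num.Theory.
Import numFieldNormedType.Exports.

Local Open Scope classical_set_scope.
Local Open Scope ring_scope.
Local Open Scope complex_scope.

Notation borel T := (g_sigma_algebraType (@open T)).

(* The n-th power of the shift, (zshift n w)_k = w_{k+n}, for n in Z. *)
Definition zshift (T : Type) (n : int) (w : int -> T) : int -> T :=
  fun k => w (k + n).

Section BoundedIntegerSequences.

(* l^oo(Z,Z) carries the topology of coordinatewise convergence: it is a
   subtype of a product of discrete spaces. *)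
Definition linfZ_set : set {ptws int -> discrete_topology int} :=
  [set v : int -> int | exists M : int, forall n, `|v n| <= M].

Definition linfZ : Type := linfZ_set.

HB.instance Definition _ := Topological.on linfZ.

Definition linfZ_seq (v : linfZ) : int -> int := set_val v.

Fact linfZ_zero_subproof : (fun=> 0 : int) \in linfZ_set.
Proof. by apply/mem_set; exists 0 => n; rewrite normr0. Qed.

HB.instance Definition _ := isPointed.Build linfZ (SigSub linfZ_zero_subproof).

Fact linfZ_shift_subproof (n : int) (v : linfZ) :
  zshift n (linfZ_seq v) \in linfZ_set.
Proof.
apply/mem_set; case: (set_valP v) => M HM; exists M => k.
exact: (HM (k + n)).
Qed.

Definition linfZ_shift (n : int) (v : linfZ) : linfZ :=
  SigSub (linfZ_shift_subproof n v).

End BoundedIntegerSequences.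

Coercion linfZ_seq : linfZ >-> Funclass.

Section Circle.
Local Open Scope quotient_scope.
Variable R : realType.

(* Num.int_num_subdef is the predicate behind the qualifier Num.int. *)
Definition integers : zmodClosed R :=
  GRing.ZmodClosed.clone R Num.int_num_subdef _.

Definition RmodZ : Type := Quotient.quot integers.

HB.instance Definition _ := GRing.Zmodule.on RmodZ.
HB.instance Definition _ := Quotient.on RmodZ.

(* T = R/Z: quotient group with the quotient topology. *)
Definition circle : Type := @quotient_topology R RmodZ.

HB.instance Definition _ := Topological.on circle.
HB.instance Definition _ := Pointed.on circle.
HB.instance Definition _ := GRing.Zmodule.copy circle RmodZ.

Definition mod1 (t : R) : circle := \pi_RmodZ t.

Definition rho (w : int -> R) : {ptws int -> circle} := fun n => mod1 (w n).

End Circle.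

Section Entropy.
Context {d : measure_display} {T : measurableType d} {R : realType}.
Implicit Types (mu : set T -> \bar R) (phi : T -> T).

Definition is_partition (I : finType) (P : I -> set T) : Prop :=
  [/\ forall i, measurable (P i), trivIset setT P & \bigcup_i P i = setT].

Definition partition_entropy mu (I : finType) (P : I -> set T) : R :=
  - \sum_(i : I) fine (mu (P i)) * ln (fine (mu (P i))).

(* The cells of the join of P, phi^-1 P, ..., phi^-(n-1) P (possibly empty). *)
Definition join_partition phi (I : finType) (P : I -> set T) (n : nat)
    (s : {ffun 'I_n -> I}) : set T :=
  \bigcap_(j in [set: 'I_n]) (iter j phi @^-1` P (s j)).

Definition entropy_wrt mu phi (I : finType) (P : I -> set T) : R :=
  limn (fun n => partition_entropy mu (join_partition phi P (n := n)) / n%:R).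

Definition entropy mu phi : \bar R :=
  ereal_sup [set h : \bar R | exists (k : nat) (P : 'I_k -> set T),
    is_partition P /\ h = (entropy_wrt mu phi P)%:E].

Definition invariant_measure mu phi : Prop :=
  forall A : set T, measurable A -> mu (phi @^-1` A) = mu A.

Definition mutually_singular mu (lambda : set T -> \bar R) : Prop :=
  exists N : set T, [/\ measurable N, mu N = 0%E & lambda (~` N) = 0%E].

End Entropy.

(* Z1 and Z2 are Borel subsets of the ambient spaces T1 and T2; nu is carried
   by Z1 and g sends Z1 to Z2. *)
Definition countable_to_one_ae d1 d2 (T1 : measurableType d1)
    (T2 : measurableType d2) (R : realType) (nu : set T1 -> \bar R)
    (Z1 : set T1) (Z2 : set T2) (g : T1 -> T2) : Prop :=
  exists (Z1' : set T1) (Z2' : set T2),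
    [/\ measurable Z1' /\ Z1' `<=` Z1, measurable Z2' /\ Z2' `<=` Z2,
        nu Z1' = 1%E, pushforward nu g Z2' = 1%E &
        forall z, Z2' z -> countable (g @^-1` [set z] `&` Z1')].

Section Salem.
Variable R : realType.
Implicit Types (beta : R) (f : {poly int}).

(* f in Z[u] is the minimal polynomial of beta over Q. *)
Definition is_minimal_polynomial f beta : Prop :=
  [/\ f \is monic, root (map_poly intr f) beta &
      forall q : {poly rat}, q != 0 -> root (map_poly ratr q) beta ->
        (size f <= size q)%N].

Definition polyC_of f : {poly R[i]} := map_poly intr f.

Definition Omega f : set R[i] := [set z | root (polyC_of f) z].
Definition Omega_minus f : set R[i] := [set z | Omega f z /\ `|z| < 1].
Definition Omega_zero f : set R[i] := [set z | Omega f z /\ `|z| = 1].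
Definition Omega_plus f : set R[i] := [set z | Omega f z /\ 1 < `|z|].

Definition algebraic_unit beta : Prop :=
  integralOver (intr : int -> R) beta /\ integralOver (intr : int -> R) beta^-1.

Definition is_salem beta f : Prop :=
  [/\ 1 < beta, algebraic_unit beta, is_minimal_polynomial f beta,
      forall z, Omega f z -> z != beta%:C -> `|z| <= 1 &
      exists z, Omega_zero f z].

(* X_{R_1/(f)} as a subset of T^Z. *)
Definition Xset f : set {ptws int -> circle R} :=
  [set x | forall k : int, \sum_(j < size f) x (k + j%:Z) *~ f`_j = 0].

(* Normalised Haar measure of X, as a measure on T^Z carried by X. *)
Definition is_haar_measure f (lambda : probability (borel {ptws int -> circle R}) R)
    : Prop :=
  lambda (Xset f) = 1%E /\
  forall x, Xset f x -> forall A : set (borel {ptws int -> circle R}),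
    measurable A -> lambda [set y | A (fun n => x n + y n)] = lambda A.

Definition T_beta beta (x : R) : R := beta * x - (Num.floor (beta * x))%:~R.

(* Indexed from 0: e_beta beta x k is the digit e_beta(x)_{k+1}. *)
Definition e_beta beta (x : R) : {ptws nat -> R} :=
  fun k => beta * iter k (T_beta beta) x - iter k.+1 (T_beta beta) x.

Definition V_beta_plus beta : set {ptws nat -> R} :=
  closure [set e_beta beta x | x in `[0, 1[].

Definition V_beta beta : set linfZ :=
  [set v | forall n : int, V_beta_plus beta (fun k => (v (n + k.+1%:Z))%:~R)].

Definition f_shift f (w : int -> R) : int -> R :=
  fun k => \sum_(j < size f) (f`_j)%:~R * zshift j%:Z w k.

Definition Wf0 f : set {ptws int -> R} :=
  [set w | (exists M : R, forall n, `|w n| <= M) /\ forall k, f_shift f w k = 0].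

(* b_omega, for omega in Omega_f; the values of b elsewhere are irrelevant. *)
Definition partial_fraction f (b : R[i] -> R[i]) : Prop :=
  forall u : R[i], ~ Omega f u ->
    (polyC_of f).[u]^-1 =
    (lead_coef f)%:~R^-1 * \sum_(omega \in Omega f) b omega / (u - omega).

Section Homoclinic.
Variables (f : {poly int}) (b : R[i] -> R[i]).

Definition exp_sum (A : set R[i]) (n : int) : R[i] :=
  (lead_coef f)%:~R^-1 * \sum_(omega \in A) b omega * omega ^ (n - 1).

(* The complex sums are real because Omega_f^-, Omega_f^{(0)}, Omega_f^+ are
   stable under conjugation, so complex.Re only changes their type. *)
Definition w_Delta_plus (n : int) : R :=
  complex.Re (if 1 <= n then exp_sum (Omega_minus f) n
              else - exp_sum (Omega_zero f `|` Omega_plus f) n).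

Definition w_Delta_minus (n : int) : R :=
  complex.Re (if 1 <= n then exp_sum (Omega_minus f `|` Omega_zero f) n
              else - exp_sum (Omega_plus f) n).

Definition xi_bar (v : linfZ) : {ptws int -> R} := fun k =>
  limn (fun N => \sum_(0 <= n < N)
    (v n%:Z)%:~R * zshift (- n%:Z) w_Delta_minus k) +
  limn (fun N => \sum_(1 <= n < N)
    (v (- n%:Z))%:~R * zshift n%:Z w_Delta_plus k).

Definition xi_star (v : linfZ) : {ptws int -> circle R} := rho (xi_bar v).

Definition cocycle_d (n : int) (v : linfZ) : {ptws int -> R} :=
  fun k => zshift n (xi_bar v) k - xi_bar (linfZ_shift n v) k.

Definition weakly_d_bounded (nu : probability (borel linfZ) R) : Prop :=
  forall eps : R, 0 < eps -> exists C : set {ptws int -> R},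
    [/\ C `<=` Wf0 f, compact C &
        forall k : int, ((1 - eps)%:E < nu [set v | C (cocycle_d k v)])%E].

Definition xi_star_b (bb : linfZ -> {ptws int -> R}) (v : linfZ) :
    {ptws int -> circle R} :=
  fun n => xi_star v n + rho (bb v) n.

End Homoclinic.
End Salem.

(* Main.v *)
Require Import Defs.
From HB Require Import structures.
From mathcomp Require Import all_boot all_order all_algebra.
From mathcomp Require Import all_classical all_reals all_analysis.
From mathcomp Require Import measurable_realfun.
From mathcomp Require Import complex.
From mathcomp Require Import zify ring lra.

Set Implicit Arguments.
Unset Strict Implicit.
Unset Printing Implicit Defensive.

Import Order.TTheory GRing.Theory Num.Theory.
Import numFieldNormedType.Exports.

Local Open Scope classical_set_scope.
Local Open Scope ring_scope.

(** Let [y v = xi_bar v + b v] be the real lift of the coded point.  Clearing the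
    denominators of the partial fractions gives [f(sigma) (y v) = v], and the
    cocycle equation says that [y (sigma v) = sigma (y v)] almost everywhere.
    For a root [om] of [f], write [f = q * ('X - om)]; the coordinate
    [p_k = sum_i q_i y_(k+i)] then satisfies [p_(k+1) = om p_k + v_k].

    For [om = beta] the growth of [y] is too slow for a free solution of this
    recursion, so [- p_0] is the number [s(v)] whose beta-expansion has the
    nonnegative coordinates of [v] as digits ([expanding_approx]).  For a root
    [theta] of absolute value 1 the coordinate is
    [theta ^ n (p_0 + sum_(j < n) theta ^ (- j - 1) v_j)].  Since [y] is a
    stationary process, a maximal inequality shows that almost every orbit,
    forward or backward, spends two thirds of its time where a window of
    [y] is bounded by a constant ([eventually_rarely_visited]).

    - Multiplicity and entropy.  When the window of [y] is bounded, the point of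
      the torus leaves finitely many possibilities for its integer parts; these
      determine the expanding coordinate, and cylinders of beta-expansions are
      intervals, so at most two digit strings are compatible with one value
      ([expanding_separation]).  Infinitely many points of one fibre would share
      such a code at a common remote past time ([fibre_finite]).  Quantitatively,
      a fine partition of the torus, observed once, determines a long word of
      digits up to bounded ambiguity and a small exceptional set
      ([words_from_arcs]), so a word of length [n] has conditional entropy [o(n)]
      over the torus and both systems have the same entropy
      ([entropy_factor_eq]).

    - Singularity.  The neutral coordinate is bounded two thirds of the time, so
      the rotated digit sums of [s(v)] are too.  A zero-one argument at a
      Lebesgue density point shows that such numbers form a null set
      ([tight_null]).  Translation of the torus along the expanding eigenline
      moves the expanding coordinate at the nonzero speed given by [f'(beta)], so
      by Fubini the points of the torus whose expanding coordinate is, up to the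
      choice of integer parts, in a null set form a null set for Haar measure
      ([haar_null]). *)

(** * Shannon entropy of finite-valued random variables *)

Section FiniteEntropy.
Context {d : measure_display} {T : measurableType d} {R : realType}.
Variable nu : probability T R.

Definition fin_rv (I : finType) (X : T -> I) := forall i, measurable (X @^-1` [set i]).

Definition pr (I : finType) (X : T -> I) (i : I) : R := fine (nu (X @^-1` [set i])).

Definition Hent (I : finType) (X : T -> I) : R := - \sum_i pr X i * ln (pr X i).

Lemma fin_rv_preimage (I : finType) (X : T -> I) (A : set I) :
  fin_rv X -> measurable (X @^-1` A).
Proof.
move=> mX.
have -> : X @^-1` A = \bigcup_(i in [set i | A i]) X @^-1` [set i].
  by apply/seteqP; split=> [t At|t [i Ai Xi]]; [by exists (X t)|by rewrite /preimage/= Xi].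
by apply: fin_bigcup_measurable => //; exact: finite_finset.
Qed.

Lemma fin_rv_comp (I J : finType) (X : T -> I) (f : I -> J) :
  fin_rv X -> fin_rv (f \o X).
Proof. by move=> mX j; rewrite comp_preimage; exact: fin_rv_preimage. Qed.

Lemma fin_rv_pair (I J : finType) (X : T -> I) (Y : T -> J) :
  fin_rv X -> fin_rv Y -> fin_rv (fun t => (X t, Y t)).
Proof.
move=> mX mY [i j].
have -> : (fun t => (X t, Y t)) @^-1` [set (i, j)] =
    X @^-1` [set i] `&` Y @^-1` [set j].
  by apply/seteqP; split=> t /= => [[-> ->]//|[-> ->]].
exact: measurableI.
Qed.

Lemma pr_ge0 (I : finType) (X : T -> I) i : 0 <= pr X i.
Proof. by rewrite fine_ge0. Qed.

Lemma pr_preimage (I : finType) (X : T -> I) (P : pred I) : fin_rv X ->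
  fine (nu (X @^-1` [set i | P i])) = \sum_(i | P i) pr X i.
Proof.
move=> mX; rewrite /pr.
have -> : X @^-1` [set i | P i] =
    \bigcup_(i in [set` P]) X @^-1` [set i].
  by apply/seteqP; split=> [t /= Pt|t [i Pi Xi]]; [by exists (X t)|by rewrite /preimage/= Xi].
rewrite measure_fin_bigcup; [|exact: finite_finset| |by move=> i _; exact: mX]; last first.
  by move=> i j _ _ [t [/= <- <-]].
rewrite -(@bigfs _ _ _ _ (index_enum I))//; last 2 first.
- exact: index_enum_uniq.
- by move=> i _; rewrite mem_index_enum.
by rewrite sum_fine// => i _; exact: fin_num_measure.
Qed.

Lemma pr_comp (I J : finType) (X : T -> I) (f : I -> J) j : fin_rv X ->
  pr (f \o X) j = \sum_(i | f i == j) pr X i.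
Proof.
move=> mX; rewrite -pr_preimage//; congr (fine (nu _)).
by apply/seteqP; split=> t /= /eqP.
Qed.

Lemma sum_pr (I : finType) (X : T -> I) : fin_rv X -> \sum_i pr X i = 1.
Proof.
move=> mX; rewrite -(pr_preimage xpredT mX).
rewrite (_ : _ @^-1` _ = setT) ?probability_setT//.
by apply/seteqP; split.
Qed.

Lemma expect_comp (I J : finType) (X : T -> I) (f : I -> J) (phi : J -> R) :
  fin_rv X -> \sum_i pr X i * phi (f i) = \sum_j pr (f \o X) j * phi j.
Proof.
move=> mX; rewrite (partition_big f xpredT)//=.
apply: eq_bigr => j _; rewrite pr_comp// mulr_suml.
by apply: eq_bigr => i /eqP ->.
Qed.

Lemma Hent_comp (I J : finType) (X : T -> I) (f : I -> J) : fin_rv X ->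
  Hent (f \o X) = - \sum_i pr X i * ln (pr (f \o X) (f i)).
Proof. by move=> mX; rewrite (expect_comp f (fun j => ln (pr (f \o X) j))). Qed.

Lemma pr_le_comp (I J : finType) (X : T -> I) (f : I -> J) i : fin_rv X ->
  pr X i <= pr (f \o X) (f i).
Proof.
move=> mX; rewrite pr_comp// (bigD1 i)//= lerDl sumr_ge0// => k _.
exact: pr_ge0.
Qed.

Lemma Hent_comp_le (I J : finType) (X : T -> I) (f : I -> J) : fin_rv X ->
  Hent (f \o X) <= Hent X.
Proof.
move=> mX; rewrite Hent_comp// lerN2; apply: ler_sum => i _.
have [->|p0] := eqVneq (pr X i) 0; first by rewrite !mul0r.
have p_gt0 : 0 < pr X i by rewrite lt0r p0 pr_ge0.
rewrite ler_pM2l// ler_ln ?posrE ?pr_le_comp//.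
exact: lt_le_trans (pr_le_comp _ _ mX).
Qed.

(** Entropy depends only on the partition into fibres, hence is monotone for
    the relation of being a function of. *)
Lemma Hent_le (I J : finType) (X : T -> I) (Y : T -> J) : fin_rv X ->
  (forall t t', X t = X t' -> Y t = Y t') -> Hent Y <= Hent X.
Proof.
move=> mX XY.
pose f i := if pselect (exists t, X t = i) is left e then Y (projT1 (cid e)) else Y point.
have -> : Y = f \o X.
  apply/funext => t /=; rewrite /f; case: pselect => [e|]; last by case; exists t.
  by apply: XY; rewrite (projT2 (cid e)).
exact: Hent_comp_le.
Qed.

(** Gibbs' inequality: [p * ln r <= p * ln p + (r - p)] termwise, because
    [ln (r / p) <= r / p - 1]. *)
Lemma gibbs (K : finType) (p r : K -> R) :
  (forall k, 0 <= p k) -> (forall k, 0 <= r k) ->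
  (forall k, p k != 0 -> 0 < r k) -> \sum_k r k <= \sum_k p k ->
  \sum_k p k * ln (r k) <= \sum_k p k * ln (p k).
Proof.
move=> p0 r0 pr0 srp; rewrite -subr_le0 -sumrB.
apply: (@le_trans _ _ (\sum_k (r k - p k))); last by rewrite sumrB subr_le0.
apply: ler_sum => k _.
have [->|pk] := eqVneq (p k) 0; first by rewrite !mul0r !subr0.
have pk0 : 0 < p k by rewrite lt0r pk p0.
have rk0 := pr0 _ pk.
rewrite -mulrBr -ln_div ?posrE//.
have ln_le : ln (r k / p k) <= r k / p k - 1.
  rewrite -[X in ln X](subrK 1) addrC le_ln1Dx// ltrBrDl subrr.
  exact: divr_gt0.
rewrite (le_trans (ler_wpM2l (ltW pk0) ln_le))// mulrBr mulr1 mulrCA.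
by rewrite divff// mulr1.
Qed.

(** Strong subadditivity, [H(X | Y, Z) <= H(X | Z)]: Gibbs' inequality against
    the law making X and Y conditionally independent given Z. *)
Lemma Hent_strong_subadd (I J L : finType) (X : T -> I) (Y : T -> J) (Z : T -> L) :
  fin_rv X -> fin_rv Y -> fin_rv Z ->
  Hent (fun t => (X t, Y t, Z t)) + Hent Z <=
  Hent (fun t => (X t, Z t)) + Hent (fun t => (Y t, Z t)).
Proof.
move=> mX mY mZ; set W := fun t => (X t, Y t, Z t).
have mW : fin_rv W by apply: fin_rv_pair => //; exact: fin_rv_pair.
pose fXZ (w : I * J * L) := (w.1.1, w.2); pose fYZ (w : I * J * L) := (w.1.2, w.2).
have HXZ := Hent_comp fXZ mW; have HYZ := Hent_comp fYZ mW.
have HZ := Hent_comp snd mW.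
have EXZ : fXZ \o W = fun t => (X t, Z t) by [].
have EYZ : fYZ \o W = fun t => (Y t, Z t) by [].
have EZ : snd \o W = Z by [].
rewrite EXZ in HXZ; rewrite EYZ in HYZ; rewrite EZ in HZ.
rewrite HXZ HYZ HZ /Hent -!opprD lerN2 -!big_split/=.
set pxz := pr (fun t => (X t, Z t)); set pyz := pr (fun t => (Y t, Z t)).
set pz := pr Z.
pose r (w : I * J * L) := pxz (fXZ w) * pyz (fYZ w) / pz w.2.
have pxz_le w : pr W w <= pxz (fXZ w) by exact: pr_le_comp.
have pyz_le w : pr W w <= pyz (fYZ w) by exact: pr_le_comp.
have pz_le w : pr W w <= pz w.2 by exact: pr_le_comp.
have pos w : pr W w != 0 -> 0 < pr W w by move=> w0; rewrite lt0r w0 pr_ge0.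
have mXZ := fin_rv_pair mX mZ; have mYZ := fin_rv_pair mY mZ.
have G : \sum_w pr W w * ln (r w) <= \sum_w pr W w * ln (pr W w).
  apply: gibbs.
  - by move=> w; exact: pr_ge0.
  - by move=> w; rewrite /r !mulr_ge0 ?invr_ge0// pr_ge0.
  - move=> w /pos w0; rewrite /r divr_gt0 ?mulr_gt0//.
    + exact: lt_le_trans (pxz_le w).
    + exact: lt_le_trans (pyz_le w).
    + exact: lt_le_trans (pz_le w).
  - rewrite sum_pr// -(sum_pr mZ) -(pair_bigA _ (fun (ij : I * J) l => r (ij, l)))/=.
    rewrite exchange_big/=; apply: ler_sum => l _.
    rewrite -(pair_bigA _ (fun i j => r (i, j, l)))/=.
    have -> : \sum_i \sum_j r (i, j, l) =
        (\sum_i pxz (i, l)) * ((\sum_j pyz (j, l)) / pz l).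
      rewrite mulr_suml; apply: eq_bigr => i _; rewrite mulr_suml mulr_sumr.
      by apply: eq_bigr => j _; rewrite /r mulrA.
    have -> : \sum_i pxz (i, l) = pz l.
      rewrite /pz (_ : Z = snd \o (fun t => (X t, Z t)))// pr_comp//.
      rewrite (reindex_onto (fun i => (i, l)) fst)/=; last by move=> [i k] /= /eqP ->.
      by apply: eq_bigl => i; rewrite !eqxx.
    have -> : \sum_j pyz (j, l) = pz l.
      rewrite /pz (_ : Z = snd \o (fun t => (Y t, Z t)))// pr_comp//.
      rewrite (reindex_onto (fun i => (i, l)) fst)/=; last by move=> [i k] /= /eqP ->.
      by apply: eq_bigl => i; rewrite !eqxx.
    have [->|z0] := eqVneq (pz l) 0; first by rewrite mul0r pr_ge0.
    by rewrite divff// mulr1.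
rewrite [leRHS]big_split/= -/W.
apply: (le_trans _ (lerD G (lexx _))).
  rewrite -big_split/= le_eqVlt; apply/orP; left; apply/eqP.
  apply: eq_bigr => w _; rewrite -!mulrDr.
  have [->|/pos w0] := eqVneq (pr W w) 0; first by rewrite !mul0r.
  have a0 : 0 < pxz (fXZ w) by exact: lt_le_trans (pxz_le w).
  have b0 : 0 < pyz (fYZ w) by exact: lt_le_trans (pyz_le w).
  have c0 : 0 < pz w.2 by exact: lt_le_trans (pz_le w).
  by congr (_ * _); rewrite ln_div ?posrE ?mulr_gt0// lnM ?posrE// subrK.
Qed.

(** [X] is almost determined by [Y]: on [Gam] each value of [Y] leaves at most
    [N] possible values of [X].  The reference law of Gibbs' inequality spends
    half of its mass uniformly on these values and half uniformly on all of
    [I]. *)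
Lemma Hent_count (I J : finType) (X : T -> I) (Y : T -> J) (Gam : set T) (N : nat) :
  fin_rv X -> fin_rv Y -> measurable Gam -> (0 < N)%N ->
  (forall j, (#|[pred i | `[< exists t, [/\ Gam t, X t = i & Y t = j] >]]| <= N)%N) ->
  Hent (fun t => (X t, Y t)) <=
  Hent Y + ln 2 + ln N%:R + fine (nu (~` Gam)) * ln #|I|%:R.
Proof.
move=> mX mY mG N0 HN; set W := fun t => (X t, Y t).
have mW : fin_rv W by exact: fin_rv_pair.
pose ach (w : I * J) := `[< exists t, [/\ Gam t, X t = w.1 & Y t = w.2] >].
have I0 : (0 < #|I|)%N by apply/card_gt0P; exists (X point).
have NR : 0 < N%:R :> R by rewrite ltr0n.
have IR : 0 < #|I|%:R :> R by rewrite ltr0n.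
pose rho (w : I * J) : R := (ach w)%:R / (2 * N%:R) + (2 * #|I|%:R)^-1.
have rho_gt w : (2 * #|I|%:R)^-1 <= rho w.
  by rewrite /rho lerDr divr_ge0// ltW// mulr_gt0.
have rho_pos w : 0 < rho w.
  by apply: lt_le_trans (rho_gt w); rewrite invr_gt0 mulr_gt0.
pose py := pr Y.
have py_le w : pr W w <= py w.2 by exact: pr_le_comp.
have pos w : pr W w != 0 -> 0 < pr W w by move=> w0; rewrite lt0r w0 pr_ge0.
have G : \sum_w pr W w * ln (py w.2 * rho w) <= \sum_w pr W w * ln (pr W w).
  apply: gibbs.
  - by move=> w; exact: pr_ge0.
  - by move=> w; rewrite mulr_ge0 ?pr_ge0// ltW.
  - by move=> w /pos w0; rewrite mulr_gt0// (lt_le_trans w0).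
  - rewrite sum_pr// -(sum_pr mY) -(pair_bigA _ (fun i j => py j * rho (i, j)))/=.
    rewrite exchange_big/=; apply: ler_sum => j _.
    rewrite -mulr_sumr -[leRHS]mulr1 ler_wpM2l ?pr_ge0//.
    rewrite /rho big_split/= sumr_const -mulr_suml.
    have -> : \sum_i (ach (i, j))%:R = #|[pred i | ach (i, j)]|%:R :> R.
      rewrite -sum1_card natr_sum [RHS]big_mkcond/=; apply: eq_bigr => i _.
      by rewrite inE; case: (ach _).
    apply: (@le_trans _ _ (N%:R / (2 * N%:R) + (2 * #|I|%:R)^-1 *+ #|I|)).
      by rewrite lerD2r ler_wpM2r ?invr_ge0 ?mulr_ge0 ?ler_nat ?ler0n//; exact: HN.
    rewrite le_eqVlt -mulr_natl; apply/orP; left; apply/eqP; field.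
    by rewrite !gt_eqF.
have HY := Hent_comp snd mW.
rewrite (_ : snd \o W = Y)// in HY; rewrite HY /Hent.
have B : - \sum_w pr W w * ln (rho w) <= ln 2 + ln N%:R + fine (nu (~` Gam)) * ln #|I|%:R.
  have ln2 : 0 <= ln (2 : R) by rewrite ln_ge0// ler1n.
  have lnN : 0 <= ln (N%:R : R) by rewrite ln_ge0// ler1n.
  have lnI : 0 <= ln (#|I|%:R : R) by rewrite ln_ge0// ler1n.
  have bnd w : - ln (rho w) <= ln 2 + ln N%:R + (~~ ach w)%:R * ln #|I|%:R.
    have [aw|aw] /= := boolP (ach w).
      have : 0 <= ln (rho w * (2 * N%:R)).
        rewrite ln_ge0// -ler_pdivrMr ?mulr_gt0// /rho aw lerDl invr_ge0.
        by rewrite mulr_ge0 ?ler0n.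
      by rewrite !lnM ?posrE ?mulr_gt0//; lra.
    have : 0 <= ln (rho w * (2 * #|I|%:R)).
      by rewrite ln_ge0// -ler_pdivrMr ?mulr_gt0// mul1r; exact: rho_gt.
    by rewrite !lnM ?posrE ?mulr_gt0//; lra.
  apply: (@le_trans _ _ (\sum_w pr W w * (ln 2 + ln N%:R + (~~ ach w)%:R * ln #|I|%:R))).
    rewrite -sumrN; apply: ler_sum => w _.
    by rewrite -mulrN ler_wpM2l ?pr_ge0.
  under eq_bigr do rewrite mulrDr mulrA.
  rewrite big_split/= -!mulr_suml sum_pr// mul1r lerD2l ler_wpM2r//.
  under eq_bigr do rewrite mulrC mulr_natl mulrb.
  rewrite -big_mkcond -(pr_preimage (fun w => ~~ ach w))//= fine_le ?fin_num_measure//.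
  - exact: fin_rv_preimage.
  - exact: measurableC.
  - apply: le_measure; rewrite ?inE//.
    + exact: fin_rv_preimage.
    + exact: measurableC.
    + by move=> t /= /asboolPn nt Gt; apply: nt; exists t.
have E : \sum_w pr W w * ln (py w.2 * rho w) =
    \sum_w pr W w * ln (py w.2) + \sum_w pr W w * ln (rho w).
  rewrite -big_split/=; apply: eq_bigr => w _.
  have [->|/pos w0] := eqVneq (pr W w) 0; first by rewrite !mul0r addr0.
  have c0 : 0 < py w.2 by exact: lt_le_trans (py_le w).
  by rewrite lnM ?posrE// mulrDr.
move: G B; rewrite E /py.
set p1 := \sum_w _; set p2 := \sum_w _; set p3 := \sum_w _; set q := fine _ * _.
lra.
Qed.

End FiniteEntropy.

(** * Entropy rates of stationary finite-valued processes *)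

Section EntropyRate.
Context {d : measure_display} {T : measurableType d} {R : realType}.
Variable nu : probability T R.
Local Notation H := (Hent nu).

Definition word_of (I : finType) (X : T -> I) (phi : T -> T) (n : nat) (t : T) :
  {ffun 'I_n -> I} := [ffun j : 'I_n => X (iter j phi t)].

Lemma fin_rv_word (I : finType) (X : T -> I) (phi : T -> T) n :
  measurable_fun setT phi -> fin_rv X -> fin_rv (word_of X phi n).
Proof.
move=> mphi mX s.
have -> : word_of X phi n @^-1` [set s] =
    \bigcap_(j in [set: 'I_n]) (iter j phi @^-1` (X @^-1` [set s j])).
  apply/seteqP; split=> [t /= <- j _ /=|t st]; first by rewrite ffunE.
  by apply/ffunP => j; rewrite ffunE; exact: st.
apply: fin_bigcap_measurable => // j _; rewrite -[X in measurable X]setTI.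
have mj : measurable_fun setT (iter j phi).
  by elim: (nat_of_ord j) => [|m IH]; [exact: measurable_id|exact: measurableT_comp].
exact: mj.
Qed.

Lemma Hent_invariant (I : finType) (X : T -> I) (phi : T -> T) : fin_rv X ->
  invariant_measure nu phi -> H (X \o phi) = H X.
Proof.
move=> mX inv; rewrite /Hent; congr (- _); apply: eq_bigr => i _.
have -> : pr nu (X \o phi) i = pr nu X i by rewrite /pr comp_preimage inv.
by [].
Qed.

Lemma measurable_iter (phi : T -> T) n :
  measurable_fun setT phi -> measurable_fun setT (iter n phi).
Proof.
by move=> mphi; elim: n => [|m IH]; [exact: measurable_id|exact: measurableT_comp].
Qed.

Lemma invariant_iter (phi : T -> T) n : measurable_fun setT phi ->
  invariant_measure nu phi -> invariant_measure nu (iter n phi).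
Proof.
move=> mphi inv A mA; elim: n => //= n IH.
rewrite (_ : _ @^-1` _ = phi @^-1` (iter n phi @^-1` A)).
  rewrite inv// -[X in measurable X]setTI; exact: (measurable_iter n mphi).
by apply/seteqP; split => t /=; rewrite -iterS iterSr.
Qed.

Lemma fin_rv_iter (I : finType) (X : T -> I) (phi : T -> T) n :
  measurable_fun setT phi -> fin_rv X -> fin_rv (X \o iter n phi).
Proof.
move=> mphi mX i; rewrite comp_preimage -[X in measurable X]setTI.
exact: (measurable_iter n mphi).
Qed.

Lemma word_inj (I : finType) (X : T -> I) (phi : T -> T) n t t' j :
  (j < n)%N -> word_of X phi n t = word_of X phi n t' ->
  X (iter j phi t) = X (iter j phi t').
Proof. by move=> jn /ffunP/(_ (Ordinal jn)); rewrite !ffunE. Qed.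

(** The increments of the block entropies decrease, by strong subadditivity
    and stationarity; the averages converge by Cesaro's theorem. *)
Lemma Hent_word_cvg (I : finType) (X : T -> I) (phi : T -> T) :
  measurable_fun setT phi -> invariant_measure nu phi -> fin_rv X ->
  cvgn (fun n => H (word_of X phi n) / n%:R).
Proof.
move=> mphi inv mX; pose h n := H (word_of X phi n).
have mw n : fin_rv (word_of X phi n) by exact: fin_rv_word.
pose c n := h n.+1 - h n.
have c0 n : 0 <= c n.
  rewrite subr_ge0; apply: Hent_le => // t t' e; apply/ffunP => j.
  by rewrite !ffunE; apply: (word_inj _ e); rewrite ltnS ltnW.
have cdec n : c n.+1 <= c n.
  pose Z := word_of X phi n \o phi; pose Xn := X \o iter n.+1 phi.
  have mZ : fin_rv Z by exact: (fin_rv_iter 1 mphi (mw n)).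
  have mXn : fin_rv Xn by exact: fin_rv_iter.
  have := Hent_strong_subadd nu mXn mX mZ.
  have -> : H Z = h n by rewrite /Z Hent_invariant.
  have E1 : H (fun t => (Xn t, Z t)) <= h n.+1.
    rewrite /h -(Hent_invariant (mw n.+1) inv).
    apply: Hent_le; first exact: (fin_rv_iter 1 mphi (mw n.+1)).
    move=> t t' e; congr (_, _).
      by rewrite /Xn /= -!/(iter n.+1 _ _) !iterSr; exact: (word_inj _ e).
    by apply/ffunP => j; rewrite !ffunE; apply: (word_inj _ e); rewrite ltnS ltnW.
  have E2 : H (fun t => (X t, Z t)) <= h n.+1.
    apply: Hent_le => // t t' e; congr (_, _).
      exact: (word_inj (j := 0) _ e).
    apply/ffunP => j; rewrite !ffunE -!iterSr; apply: (word_inj _ e).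
    by rewrite ltnS.
  have E3 : h n.+2 <= H (fun t => (Xn t, X t, Z t)).
    apply: Hent_le; first by apply: fin_rv_pair => //; exact: fin_rv_pair.
    move=> t t' [eX e0 eZ]; apply/ffunP => -[j jn]; rewrite !ffunE/=.
    case: j jn => [//|j] jn.
    have [->//|jn'] := eqVneq j n.
    rewrite !iterSr; apply: (word_inj _ eZ).
    by rewrite ltn_neqAle jn' /= -ltnS.
  by rewrite /c; lra.
have ccvg : cvgn c.
  apply: nonincreasing_is_cvgn; last by exists 0 => _ [n _ <-].
  by apply/nonincreasing_seqP.
have hE n : h n = h 0%N + series c n.
  by rewrite /series/= telescope_sumr// addrC subrK.
have /cvg_ex[l cl] := ccvg.
apply/cvg_ex; exists l.
rewrite -(cvg_shiftS _).
have -> : (fun n => H (word_of X phi n.+1) / n.+1%:R) =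
   (fun n => h 0%N * n.+1%:R^-1 + arithmetic_mean c n).
  by apply/funext => n; rewrite -/(h n.+1) hE mulrDl /arithmetic_mean/= mulrC [X in _ + X]mulrC mulrC.
rewrite -[l]add0r -[X in X + _](mulr0 (h 0%N)).
apply: cvgD; last exact: cesaro.
by apply: cvgMr; exact: cvg_harmonic.
Qed.

(** By strong subadditivity each new value of [A] costs no more given both
    words than given the simultaneous value of [B] alone. *)
Lemma Hent_word_cond (I J : finType) (A : T -> I) (B : T -> J) (phi : T -> T)
    (c : R) (k : nat) :
  measurable_fun setT phi -> invariant_measure nu phi -> fin_rv A -> fin_rv B ->
  H (fun t => (A t, B t)) <= H B + c ->
  H (fun t => (word_of A phi k t, word_of B phi k t)) <=
    H (word_of B phi k) + k%:R * c.
Proof.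
move=> mphi inv mA mB Hc.
have mwA n : fin_rv (word_of A phi n) by exact: fin_rv_word.
have mwB n : fin_rv (word_of B phi n) by exact: fin_rv_word.
elim: k => [|k IH].
  rewrite mul0r addr0; apply: Hent_le => // t t' e; congr (_, _) => //.
  by apply/ffunP => -[].
pose Ak := word_of A phi k; pose Bk := word_of B phi k.
pose a := A \o iter k phi; pose b := B \o iter k phi.
have ma : fin_rv a by exact: fin_rv_iter.
have mb : fin_rv b by exact: fin_rv_iter.
have SS1 := Hent_strong_subadd nu (mwA k) mb (mwB k).
have SS2 := Hent_strong_subadd nu ma (fin_rv_pair (mwA k) (mwB k)) mb.
have iab : H (fun t => (a t, b t)) = H (fun t => (A t, B t)).
  have -> : (fun t => (a t, b t)) = (fun t => (A t, B t)) \o iter k phi by [].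
  rewrite Hent_invariant//; first exact: fin_rv_pair.
  exact: invariant_iter.
have ib : H b = H B by rewrite /b Hent_invariant//; exact: invariant_iter.
have E1 : H (fun t => (word_of A phi k.+1 t, word_of B phi k.+1 t)) <=
    H (fun t => (a t, (Ak t, Bk t), b t)).
  apply: Hent_le; first by do !apply: fin_rv_pair => //.
  move=> t t' [ea eA eB eb]; congr (_, _); apply/ffunP => -[j jn]; rewrite !ffunE/=.
    by have [->//|jk] := eqVneq j k; apply: (word_inj _ eA); rewrite ltn_neqAle jk -ltnS.
  by have [->//|jk] := eqVneq j k; apply: (word_inj _ eB); rewrite ltn_neqAle jk -ltnS.
have E2 : H (fun t => (Ak t, Bk t, b t)) <= H (fun t => (Ak t, b t, Bk t)).
  apply: Hent_le; first by do !apply: fin_rv_pair => //.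
  by move=> t t' [-> -> ->].
have E3 : H (fun t => (b t, Bk t)) <= H (word_of B phi k.+1).
  apply: Hent_le => // t t' e; congr (_, _).
    by rewrite /b/=; exact: (word_inj _ e).
  by apply/ffunP => j; rewrite !ffunE; apply: (word_inj _ e); rewrite ltnS ltnW.
have -> : k.+1%:R * c = k%:R * c + c by rewrite -natr1 mulrDl mul1r.
move: SS1 SS2; rewrite -/Ak -/Bk iab ib => SS1 SS2.
move: E1 E2 E3 SS1 SS2 IH Hc; rewrite -/Ak -/Bk.
set q := k%:R * c.
lra.
Qed.

(** Along [iter n phi], an [A]-word of length [n] costs at most [c] more than
    one value of [B]; [Hent_word_cond] adds up these costs over consecutive
    blocks. *)
Theorem entropy_rate_le (I J : finType) (A : T -> I) (B : T -> J) (phi : T -> T)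
    (c : R) (n : nat) :
  measurable_fun setT phi -> invariant_measure nu phi -> fin_rv A -> fin_rv B ->
  (0 < n)%N -> H (fun t => (word_of A phi n t, B t)) <= H B + c ->
  limn (fun k => H (word_of A phi k) / k%:R) <=
  limn (fun k => H (word_of B phi k) / k%:R) + c / n%:R.
Proof.
move=> mphi inv mA mB n0 Hc.
have /cvg_ex[/= la cla] := Hent_word_cvg mphi inv mA.
have /cvg_ex[/= lb clb] := Hent_word_cvg mphi inv mB.
rewrite (cvg_lim _ cla)// (cvg_lim _ clb)//.
pose s (k : nat) := (k.+1 * n)%N.
have sinf : s @ \oo --> \oo.
  apply/cvgnyPge => m; near=> k; rewrite /s.
  have km : (m <= k)%N by near: k; exact: nbhs_infty_ge.
  by rewrite (leq_trans km)// (leq_trans (leqnSn k))// leq_pmulr.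
have {}cla := cvg_comp _ _ sinf cla; have {}clb := cvg_comp _ _ sinf clb.
apply: (ler_cvg_to cla (cvgD clb (@cvg_cst _ (c / n%:R) _ _ _))).
apply: nearW => k /=; rewrite [leRHS](_ : _ = H (word_of B phi (s k)) / (s k)%:R + c / n%:R)//.
have s0 : 0 < (s k)%:R :> R by rewrite ltr0n muln_gt0.
rewrite -(ler_pM2r s0) mulrDl !divfK ?gt_eqF//.
have -> : c / n%:R * (s k)%:R = k.+1%:R * c.
  by rewrite /s natrM; field; rewrite pnatr_eq0 -lt0n.
have mwA : fin_rv (word_of A phi n) by exact: fin_rv_word.
have Hk := Hent_word_cond k.+1 (measurable_iter n mphi)
  (invariant_iter n mphi inv) mwA mB Hc.
have itn j t : iter j (iter n phi) t = iter (j * n) phi t.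
  by elim: j => // j IH; rewrite mulSn iterD -IH.
apply: (@le_trans _ _ (H (fun t => (word_of (word_of A phi n) (iter n phi) k.+1 t,
    word_of B (iter n phi) k.+1 t)))).
  apply: Hent_le; first by apply: fin_rv_pair; apply: fin_rv_word => //; exact: measurable_iter.
  move=> t t' [eA _]; apply/ffunP => -[j jn]; rewrite !ffunE/=.
  have jq : (j %/ n < k.+1)%N by rewrite ltn_divLR.
  have := word_inj jq eA; rewrite !itn => /(word_inj (ltn_pmod j n0)).
  by rewrite -!iterD addnC -divn_eq.
apply: (le_trans Hk); rewrite lerD2r; apply: Hent_le; first exact: fin_rv_word.
move=> t t' e; apply/ffunP => -[j jn]; rewrite !ffunE/= !itn.
by apply: (word_inj _ e); rewrite /s ltn_pmul2r.
Unshelve. all: by end_near. Qed.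

End EntropyRate.

(** * Entropy of a factor *)

Section EntropyFactor.
Context {d1 d2 : measure_display} {T1 : measurableType d1}
  {T2 : measurableType d2} {R : realType}.
Variables (nu : probability T1 R) (phi : T1 -> T1) (alpha : T2 -> T2)
  (xi : T1 -> T2) (V0 : set T1).
Hypotheses (mphi : measurable_fun setT phi) (inv : invariant_measure nu phi)
  (malpha : measurable_fun setT alpha) (mxi : measurable_fun setT xi)
  (mV0 : measurable V0) (nuV0 : nu V0 = 1%E).
Hypothesis equiv : forall v n, V0 v -> xi (iter n phi v) = iter n alpha (xi v).

Lemma measure_full_setI (A : set T1) : measurable A -> nu (A `&` V0) = nu A.
Proof.
move=> mA; rewrite -[in RHS](setIT A) -(setUv V0) setIUr measureU; first last.
- by rewrite setIACA setICr setI0.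
- by apply: measurableI => //; exact: measurableC.
- exact: measurableI.
have V0c : nu (~` V0) = 0%E by rewrite probability_setC// nuV0 subee.
rewrite [X in (_ + X)%E](_ : _ = 0%E) ?adde0//.
apply/eqP; rewrite -measure_le0 -V0c; apply: le_measure; rewrite ?inE//.
- by apply: measurableI => //; exact: measurableC.
- exact: measurableC.
Qed.

Lemma measure_eq_on_full (A B : set T1) : measurable A -> measurable B ->
  (forall v, V0 v -> A v <-> B v) -> nu A = nu B.
Proof.
move=> mA mB AB; rewrite -(measure_full_setI mA) -(measure_full_setI mB).
by congr (nu _); apply/seteqP; split=> v [? vV]; split=> //; exact/AB.
Qed.

Lemma measurable_preimage (d d' : measure_display) (S : measurableType d)
    (S' : measurableType d') (g : S -> S') (A : set S') :
  measurable_fun setT g -> measurable A -> measurable (g @^-1` A).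
Proof. by move=> mg mA; rewrite -[X in measurable X]setTI; exact: mg. Qed.

Lemma partition_label (d : measure_display) (S : measurableType d) k
    (P : 'I_k -> set S) : is_partition P ->
  exists2 q : S -> 'I_k, fin_rv q & P = (fun i => q @^-1` [set i]).
Proof.
move=> [mP tP cP].
have ex t : exists i, P i t.
  have : setT t by [].
  by rewrite -cP => -[i _ Pit]; exists i.
pose q t := projT1 (cid (ex t)).
have Pq t : P (q t) t by exact: projT2 (cid (ex t)).
have PE : P = (fun i => q @^-1` [set i]).
  apply/funext => i; apply/seteqP; split=> t /=; last by move=> <-.
  by move=> Pit; apply: (tP (q t) i) => //; exists t.
by exists q => // i; rewrite -[X in measurable X]/((fun i => q @^-1` [set i]) i) -PE.
Qed.

Lemma entropy_wrt_label k (q : T1 -> 'I_k) :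
  entropy_wrt nu phi (fun i => q @^-1` [set i]) =
  limn (fun n => Hent nu (word_of q phi n) / n%:R) :> R.
Proof.
congr (limn _); apply/funext => n; congr (_ / _); congr (- _).
apply: eq_bigr => s _; rewrite /pr.
have -> : join_partition phi (fun i => q @^-1` [set i]) (n := n) s =
    word_of q phi n @^-1` [set s].
  apply/seteqP; split=> [t st|t /= <- j _ /=]; last by rewrite ffunE.
  by apply/ffunP => j; rewrite ffunE; exact: st.
by [].
Qed.

Lemma entropy_wrt_factor k (X : T2 -> 'I_k) : fin_rv X ->
  entropy_wrt (pushforward nu xi) alpha (fun i => X @^-1` [set i]) =
  limn (fun n => Hent nu (word_of (X \o xi) phi n) / n%:R) :> R.
Proof.
move=> mX; congr (limn _); apply/funext => n; congr (_ / _); congr (- _).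
have mw2 : fin_rv (word_of X alpha n) by exact: fin_rv_word.
apply: eq_bigr => s _; rewrite /pr.
have -> : pushforward nu xi (join_partition alpha (fun i => X @^-1` [set i]) (n := n) s) =
    nu (word_of (X \o xi) phi n @^-1` [set s]).
  have -> : join_partition alpha (fun i => X @^-1` [set i]) (n := n) s =
      word_of X alpha n @^-1` [set s].
    apply/seteqP; split=> [t st|t /= <- j _ /=]; last by rewrite ffunE.
    by apply/ffunP => j; rewrite ffunE; exact: st.
  rewrite /pushforward; apply: measure_eq_on_full.
  - by apply: measurable_preimage => //; exact: mw2.
  - apply: fin_rv_word => // i.
    by rewrite comp_preimage; apply: measurable_preimage => //; exact: mX.
  - move=> v Vv /=; rewrite (_ : word_of X alpha n (xi v) = word_of (X \o xi) phi n v)//.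
    by apply/ffunP => j; rewrite !ffunE/= equiv.
by [].
Qed.

(** The entropy of a factor is never larger.  Conversely, if every finite
    partition of the source costs little more, over a long block, than one
    observation of the target, then [entropy_rate_le] bounds its entropy rate
    by that of a partition of the target. *)
Theorem entropy_factor_eq :
  (forall k (Q : T1 -> 'I_k), fin_rv Q -> forall eps : R, 0 < eps ->
    exists n (J : finType) (B : T2 -> J), [/\ (0 < n)%N, fin_rv B &
      Hent nu (fun t => (word_of Q phi n t, B (xi t))) <=
      Hent nu (B \o xi) + n%:R * eps]) ->
  entropy nu phi = entropy (pushforward nu xi) alpha :> \bar R.
Proof.
move=> Hfac; apply/eqP; rewrite eq_le; apply/andP; split.
  apply: ge_ereal_sup => _ [k [P [/partition_label[Q mQ ->] ->]]].
  apply/lee_addgt0Pr => eps eps0.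
  have [n [J [B [n0 mB HB]]]] := Hfac _ _ mQ _ eps0.
  pose X := enum_rank \o B.
  have mX : fin_rv X by exact: fin_rv_comp.
  have mBxi : fin_rv (B \o xi).
    by move=> i; rewrite comp_preimage; apply: measurable_preimage => //; exact: mB.
  have mXxi : fin_rv (X \o xi).
    by move=> i; rewrite comp_preimage; apply: measurable_preimage => //; exact: mX.
  have HX : Hent nu (fun t => (word_of Q phi n t, (X \o xi) t)) <=
      Hent nu (X \o xi) + n%:R * eps.
    apply: (@le_trans _ _ (Hent nu (fun t => (word_of Q phi n t, B (xi t))))).
      apply: Hent_le; first by apply: fin_rv_pair => //; exact: fin_rv_word.
      by move=> t t' [e1 e2]; rewrite e1 /X/= e2.
    apply: (le_trans HB); rewrite lerD2r; apply: Hent_le => //.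
    by move=> t t' /enum_rank_inj.
  have := entropy_rate_le mphi inv mQ mXxi n0 HX.
  rewrite -entropy_wrt_label -entropy_wrt_factor// mulrC mulKf ?pnatr_eq0 -?lt0n//.
  rewrite -lee_fin EFinD => /le_trans; apply; rewrite leeD2r//.
  apply: ereal_sup_ubound; exists _, (fun i => X @^-1` [set i]); split => //.
  split => //; first by move=> i j _ _ [t [/= <- <-]].
  by apply/seteqP; split=> // t _; exists (X t).
apply: ge_ereal_sup => _ [k [P [/partition_label[X mX ->] ->]]].
have mXxi : fin_rv (X \o xi).
  by move=> i; rewrite comp_preimage; apply: measurable_preimage => //; exact: mX.
apply: ereal_sup_ubound; exists k, (fun i => (X \o xi) @^-1` [set i]); split.
  split => //; first by move=> i j _ _ [t [/= <- <-]].
  by apply/seteqP; split=> // t _; exists (X (xi t)).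
by rewrite entropy_wrt_factor// entropy_wrt_label.
Qed.

End EntropyFactor.

(** * A maximal inequality *)

(** Greedy covering: every index of [e] starts an interval of length at most
    [L] at least a third of which lies in [a]; disjoint such intervals cover
    all of [e]. *)
Lemma greedy_cover (a e : nat -> bool) (L : nat) :
  (forall j, e j -> exists n, [/\ (0 < n)%N, (n <= L)%N &
     (n <= 3 * \sum_(j <= i < j + n) a i)%N]) ->
  forall h p, (\sum_(p <= j < p + h) e j <= 3 * \sum_(p <= i < p + h + L) a i)%N.
Proof.
move=> He h; elim: h {-2}h (leqnn h) => [|k IH] h hk p.
  by move: hk; rewrite leqn0 => /eqP ->; rewrite addn0 big_geq.
case: h hk => [_|h]; first by rewrite addn0 big_geq.
rewrite ltnS => hk.
have le1 (b : nat -> bool) m n : (\sum_(m <= j < n) b j <= n - m)%N.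
  apply: leq_trans (_ : \sum_(m <= j < n) 1 <= _)%N; last by rewrite sum_nat_const_nat muln1.
  by apply: leq_sum => i _; case: (b i).
have [ep|nep] := boolP (e p); last first.
  rewrite big_ltn ?addnS ?ltnS ?leq_addr// (negbTE nep) add0n -addSn.
  apply: leq_trans (IH h hk p.+1) _; rewrite leq_mul2l/= addSn addSn.
  by rewrite [leqRHS]big_ltn ?leq_addl// ltnS -addnA leq_addr.
have [n [n0 nL nA]] := He _ ep.
have [nh|hn] := leqP h.+1 n.
  apply: leq_trans (le1 _ _ _) _; rewrite addKn (leq_trans nh)// (leq_trans nA)//.
  rewrite leq_mul2l/= [leqRHS](@big_cat_nat _ _ _ (p + n))//= ?leq_addr//.
  by rewrite -addnA leq_add2l (leq_trans nL)// leq_addl.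
rewrite (@big_cat_nat _ _ _ (p + n))//= ?leq_addr// ?leq_add2l; last exact: ltnW.
rewrite [X in (_ <= 3 * X)%N](@big_cat_nat _ _ _ (p + n))//= ?leq_addr//; last first.
  by rewrite -addnA leq_add2l (leq_trans nL)// leq_addl.
rewrite mulnDr leq_add//.
  by apply: leq_trans (le1 _ _ _) _; rewrite addKn.
have -> : (p + h.+1 = p + n + (h.+1 - n))%N by rewrite -addnA subnKC// ltnW.
by apply: IH; lia.
Qed.

Lemma small_tail d (T : measurableType d) (R : realType) (nu : probability T R)
    (A : nat -> set T) (eps : R) :
  (forall M, measurable (A M)) -> (forall M N, (M <= N)%N -> A N `<=` A M) ->
  \bigcap_M A M = set0 -> 0 < eps -> exists M, (nu (A M) <= eps%:E)%E.
Proof.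
move=> mA dA A0 eps0.
have A0cvg : nu \o A @ \oo --> 0%E.
  rewrite -(measure0 nu) -A0; apply: nonincreasing_cvg_mu => //.
  - by rewrite (le_lt_trans (probability_le1 nu (mA 0%N)))// ltry.
  - exact: bigcapT_measurable.
  - by move=> m n mn; apply/subsetPset; exact: dA.
apply: contrapT => no; have : (eps%:E <= 0)%E.
  rewrite -(cvg_lim _ A0cvg)//; apply: lime_ge; first by apply/cvg_ex; exists 0%E.
  apply: nearW => M /=; rewrite leNgt; apply/negP => /ltW le; apply: no.
  by exists M.
by rewrite lee_fin leNgt eps0.
Qed.

Lemma measurable_count d (T : measurableType d) (a : nat -> T -> bool) n
    (P : nat -> Prop) : (forall k, measurable [set v | a k v]) ->
  measurable [set v | P (\sum_(0 <= k < n) a k v)%N].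
Proof.
move=> ma; elim: n P => [|n IH] P.
  have [P0|P0] := pselect (P 0%N).
    rewrite (_ : [set _ | _] = setT)//; apply/seteqP; split=> // v _ /=.
    by rewrite big_geq.
  rewrite (_ : [set _ | _] = set0)//; apply/seteqP; split=> // v /=.
  by rewrite big_geq.
rewrite (_ : [set _ | _] =
    ([set v | P (\sum_(0 <= k < n) a k v).+1] `&` [set v | a n v]) `|`
    ([set v | P (\sum_(0 <= k < n) a k v)%N] `&` ~` [set v | a n v])).
  apply: measurableU; apply: measurableI => //.
    exact: (IH (fun k => P k.+1)).
  exact: measurableC.
apply/seteqP; split=> v /=; rewrite big_nat_recr//=.
  by case: (boolP (a n v)) => an Pv; [left|right]; move: Pv; rewrite (addn1, addn0).
by move=> [[Pv ->]|[Pv /negP/negbTE ->]]; rewrite (addn1, addn0).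
Qed.

Section Maximal.
Context {d : measure_display} {T : measurableType d} {R : realType}.
Variables (nu : probability T R) (phi : T -> T).
Hypotheses (mphi : measurable_fun setT phi) (inv : invariant_measure nu phi).

Definition visits (A : set T) (n : nat) (v : T) : nat :=
  \sum_(0 <= j < n) (iter j phi v \in A).

Lemma measurable_visits (A : set T) n (P : nat -> Prop) : measurable A ->
  measurable [set v | P (visits A n v)].
Proof.
move=> mA; apply: (@measurable_count _ _ (fun j v => iter j phi v \in A)) => j.
rewrite (_ : [set _ | _] = iter j phi @^-1` A).
  by rewrite -[X in measurable X]setTI; exact: (measurable_iter j mphi).
by apply/seteqP; split=> v /=; rewrite inE.
Qed.

Definition often (A : set T) : set T :=
  [set v | exists n, (n < 3 * visits A n v)%N].

Let often_before (A : set T) L : set T :=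
  [set v | exists2 n, (n <= L)%N & (n < 3 * visits A n v)%N].

Let measurable_often_before (A : set T) L : measurable A ->
  measurable (often_before A L).
Proof.
move=> mA; have -> : often_before A L =
    \bigcup_(n in [set n | (n <= L)%N]) [set v | (n < 3 * visits A n v)%N].
  by apply/seteqP; split=> v [n nL nv]; exists n.
apply: bigcup_measurable => n _.
exact: (@measurable_visits _ _ (fun k => (n < 3 * k)%N)).
Qed.

Lemma measurable_often (A : set T) : measurable A -> measurable (often A).
Proof.
move=> mA; have -> : often A = \bigcup_n [set v | (n < 3 * visits A n v)%N].
  by apply/seteqP; split=> v [n]; [exists n|move=> _; exists n].
apply: bigcup_measurable => n _.
exact: (@measurable_visits _ _ (fun k => (n < 3 * k)%N)).
Qed.

Let integral_visits (A : set T) n : measurable A ->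
  (\int[nu]_v ((visits A n v)%:R)%:E = n%:R%:E * nu A)%E.
Proof.
move=> mA; have mAj j : measurable (iter j phi @^-1` A).
  by rewrite -[X in measurable X]setTI; exact: (measurable_iter j mphi).
transitivity (\int[nu]_v (\sum_(0 <= j < n) (\1_(iter j phi @^-1` A) v)%:E))%E.
  apply: eq_integral => v _; rewrite /visits natr_sum sumEFin.
  by congr (_%:E); apply: eq_bigr => j _; rewrite indicE; congr ((nat_of_bool _)%:R); apply/idP/idP => /set_mem /mem_set.
rewrite ge0_integral_sum//; last first.
  by move=> j; exact/measurable_EFinP/measurable_indic.
rewrite (eq_bigr (fun=> nu A)) => [|j _].
  by rewrite sumr_const_nat subn0 mule_natl.
by rewrite integral_indic// setIT; exact: (invariant_iter j mphi inv mA).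
Qed.

Let measurable_visits_EFin (A : set T) n : measurable A ->
  measurable_fun setT (fun v => ((visits A n v)%:R)%:E : \bar R).
Proof.
move=> mA; apply/measurable_EFinP; move=> _ Y mY; rewrite setTI.
exact: (@measurable_visits _ _ (fun k => Y k%:R)).
Qed.

Let often_before_le (A : set T) L : measurable A ->
  (nu (often_before A L) <= 3%:E * nu A)%E.
Proof.
move=> mA; set E := often_before A L.
have mE : measurable E by exact: measurable_often_before.
have H h : (h%:R%:E * nu E <= 3%:E * ((h + L)%:R%:E * nu A))%E.
  rewrite -!integral_visits// -ge0_integralZl//=.
  - apply: ge0_le_integral => //=.
    + exact: measurable_visits_EFin.
    + by apply: measurable_funeM; exact: measurable_visits_EFin.
    + move=> v _; rewrite -EFinM lee_fin -natrM ler_nat /visits.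
      have := @greedy_cover (fun j => iter j phi v \in A) (fun j => iter j phi v \in E) L.
      move=> /(_ _ h 0%N); rewrite !add0n; apply; move=> j /set_mem[n nL nv].
      have n0 : (0 < n)%N.
        by case: n nv {nL} => //; rewrite /visits big_geq.
      exists n; split=> //; apply: (leq_trans (ltnW nv)); rewrite leq_mul2l/=.
      have -> : (\sum_(j <= i < j + n) (iter i phi v \in A) =
          \sum_(0 <= i < n) (iter (i + j) phi v \in A))%N.
        by rewrite -{1}[j]add0n big_addn addKn.
      by apply: leq_sum => i _; rewrite iterD.
  - exact: measurable_visits_EFin.
have Enu : nu E \is a fin_num by exact: fin_num_measure.
have Anu : nu A \is a fin_num by exact: fin_num_measure.
rewrite -(fineK Enu) -(fineK Anu) -EFinM lee_fin.
have H' h : h%:R * fine (nu E) <= 3 * ((h + L)%:R * fine (nu A)).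
  by rewrite -lee_fin !EFinM !fineK//; exact: H.
apply/ler_addgt0Pr => eps eps0.
have [N LN] : exists N : nat, 3 * L%:R * fine (nu A) / eps < N.+1%:R.
  by exists (Num.truncn (3 * L%:R * fine (nu A) / eps)); exact: truncnS_gt.
have N0 : 0 < N.+1%:R :> R by [].
rewrite -(ler_pM2l N0); apply: (le_trans (H' _)).
by move: LN; rewrite natrD ltr_pdivrMr// => LN; nra.
Qed.

(** Integrating [greedy_cover] over orbit segments of length [h] gives
    [h * nu E <= 3 * (h + L) * nu A] for the set [E] of points whose excess
    occurs before time [L]; then [h], and after it [L], tends to infinity. *)
Theorem maximal_inequality (A : set T) : measurable A ->
  (nu (often A) <= 3%:E * nu A)%E.
Proof.
move=> mA.
have -> : often A = \bigcup_L often_before A L.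
  apply/seteqP; split=> v; first by move=> [n nv]; exists n => //; exists n.
  by move=> [L _ [n _ nv]]; exists n.
have := @nondecreasing_cvg_mu _ _ _ nu (often_before A).
move=> /(_ (fun L => measurable_often_before L mA)) /(_ _ _)/cvg_lim <-//.
- apply: lime_le.
    apply: ereal_nondecreasing_is_cvgn => m n mn; apply: le_measure; rewrite ?inE//.
    + exact: measurable_often_before.
    + exact: measurable_often_before.
    + by move=> v [k km kv]; exists k => //; exact: leq_trans mn.
  by apply: nearW => L; exact: often_before_le.
- by apply: bigcup_measurable => L _; exact: measurable_often_before.
- move=> m n mn; apply/subsetPset => v [k km kv]; exists k => //.
  exact: leq_trans mn.
Qed.

(** By the maximal inequality the exceptional set for [M] has measure at most
    [3 * nu (A M)], which tends to 0. *)
Corollary eventually_rarely_visited (A : nat -> set T) :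
  (forall M, measurable (A M)) -> (forall M N, (M <= N)%N -> A N `<=` A M) ->
  \bigcap_M A M = set0 -> nu (\bigcup_M ~` often (A M)) = 1%E.
Proof.
move=> mA dA A0.
have mO M : measurable (often (A M)) by exact: measurable_often.
have -> : \bigcup_M ~` often (A M) = ~` \bigcap_M often (A M).
  by rewrite setC_bigcap.
rewrite probability_setC; last exact: bigcap_measurable.
suff -> : nu (\bigcap_M often (A M)) = 0%E by rewrite sube0.
apply/eqP; rewrite -measure_le0.
apply/lee_addgt0Pr => eps eps0; rewrite add0e.
have [M HM] := small_tail nu mA dA A0 (divr_gt0 eps0 (ltr0n R 3)).
apply: (@le_trans _ _ (nu (often (A M)))).
  apply: le_measure; rewrite ?inE//; first exact: bigcapT_measurable.
  by move=> v /(_ M); exact.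
apply: le_trans (maximal_inequality (mA M)) _.
apply: le_trans (lee_wpmul2l _ HM) _ => //.
by rewrite -EFinM lee_fin mulrC divfK.
Qed.

End Maximal.

(** * The modulus of a complex number as a real number *)

Section ComplexModulus.
Context {R : realType}.
Implicit Types z w : R[i].
Local Open Scope complex_scope.

Definition cnorm z : R := Num.sqrt (complex.Re z ^+ 2 + complex.Im z ^+ 2).

Lemma cnormE z : `|z| = (cnorm z)%:C. Proof. exact: normc_def. Qed.

Lemma cnorm_eq z (r : R) : `|z| = r%:C -> cnorm z = r.
Proof. by rewrite cnormE => /complexI. Qed.

Lemma cnorm_ge0 z : 0 <= cnorm z. Proof. exact: sqrtr_ge0. Qed.

Lemma cnormD z w : cnorm (z + w) <= cnorm z + cnorm w.
Proof. by rewrite -lecR rmorphD/= -!cnormE ler_normD. Qed.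

Lemma cnormN z : cnorm (- z) = cnorm z.
Proof. by apply: cnorm_eq; rewrite normrN cnormE. Qed.

Lemma cnormB z w : cnorm (z - w) <= cnorm z + cnorm w.
Proof. by rewrite -(cnormN w) cnormD. Qed.

Lemma cnormM z w : cnorm (z * w) = cnorm z * cnorm w.
Proof. by apply: cnorm_eq; rewrite normrM !cnormE rmorphM. Qed.

Lemma cnorm0 : cnorm 0 = 0.
Proof. by apply: cnorm_eq; rewrite normr0. Qed.

Lemma cnorm1 : cnorm 1 = 1.
Proof. by apply: cnorm_eq; rewrite normr1. Qed.

Lemma cnormX z n : cnorm (z ^+ n) = cnorm z ^+ n.
Proof. by elim: n => [|n IH]; rewrite ?expr0 ?cnorm1// !exprS cnormM IH. Qed.

Lemma cnormV z : cnorm z^-1 = (cnorm z)^-1.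
Proof. by apply: cnorm_eq; rewrite normfV cnormE fmorphV. Qed.

Lemma cnorm_eq0 z : (cnorm z == 0) = (z == 0).
Proof. by rewrite -[RHS]normr_eq0 cnormE -(inj_eq (@complexI R)). Qed.

Lemma cnorm_sum (I : Type) (r : seq I) (P : pred I) (F : I -> R[i]) :
  cnorm (\sum_(i <- r | P i) F i) <= \sum_(i <- r | P i) cnorm (F i).
Proof.
elim/big_rec2: _ => [|i x y _ le]; first by rewrite cnorm0.
by apply: (le_trans (cnormD _ _)); rewrite lerD2l.
Qed.

Lemma cnorm_real (x : R) : cnorm x%:C = `|x|.
Proof. by rewrite /cnorm/= expr0n addr0 sqrtr_sqr. Qed.

Lemma Re_le_cnorm z : `|complex.Re z| <= cnorm z.
Proof. by rewrite -lecR -cnormE normc_ge_Re. Qed.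

Lemma cnorm_sqr z : cnorm z ^+ 2 = complex.Re z ^+ 2 + complex.Im z ^+ 2.
Proof. by rewrite sqr_sqrtr// addr_ge0 ?sqr_ge0. Qed.

(** Averaging over the rotations [theta^-L], whose sums stay bounded: some
    rotate of [z] does not point away from 1. *)
Lemma rotation_growth (theta z : R[i]) (L0 : nat) : cnorm theta = 1 -> theta != 1 ->
  exists2 L, (L0 <= L)%N &
    cnorm z ^+ 2 + 2^-1 <= cnorm (1 + theta ^- L * z) ^+ 2.
Proof.
move=> th1 thN1; apply: contrapT => no.
have th0 : theta != 0 by rewrite -cnorm_eq0 th1 oner_eq0.
pose t := theta^-1.
have t1 : cnorm t = 1 by rewrite cnormV th1 invr1.
have tN1 : 1 - t != 0 by rewrite subr_eq0 eq_sym invr_eq1.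
have Hre L : (L0 <= L)%N -> complex.Re (t ^+ L * z) < - 4^-1.
  (* [|1 + x|^2 = |x|^2 + 1 + 2 Re x], so failure means [Re x < - 1 / 4] *)
  move=> L0L; rewrite ltNge; apply/negP => ge; apply: no; exists L => //.
  have -> : cnorm z ^+ 2 = cnorm (t ^+ L * z) ^+ 2 by rewrite cnormM cnormX t1 expr1n mul1r.
  rewrite -exprVn -/t; set x := t ^+ L * z in ge *.
  rewrite !cnorm_sqr; case: x ge => a b /=; nra.
pose S N := \sum_(i < N) t ^+ (L0 + i) * z.
have SN N : cnorm (S N) <= 2 * cnorm z / cnorm (1 - t).
  have -> : S N = (1 - t ^+ N) / (1 - t) * (t ^+ L0 * z).
    have G : (1 - t) * (\sum_(i < N) t ^+ i) = 1 - t ^+ N.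
      by rewrite -opprB mulNr -subrX1 opprB.
    rewrite -G [(1 - t) * _]mulrC mulfK// mulr_suml.
    by apply: eq_bigr => i _; rewrite exprD mulrA [t ^+ i * _]mulrC.
  rewrite !cnormM cnormV cnormX t1 expr1n mul1r mulrAC.
  rewrite ler_wpM2r ?invr_ge0 ?cnorm_ge0// ler_wpM2r ?cnorm_ge0//.
  by rewrite (le_trans (cnormB _ _))// cnorm1 cnormX t1 expr1n.
have RS N : complex.Re (S N) <= - (N%:R / 4).
  elim: N => [|N IH]; first by rewrite /S big_ord0 mul0r oppr0.
  rewrite /S big_ord_recr/= raddfD/= -natr1.
  have := Hre (L0 + N)%N (leq_addr _ _); move: IH; rewrite /S; lra.
pose K := 2 * cnorm z / cnorm (1 - t).
have := truncnS_gt (4 * K); set N := (Num.truncn _).+1 => KN.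
have := SN N; have := RS N; have := Re_le_cnorm (S N); rewrite -/K.
have := ler_norm (- complex.Re (S N)); rewrite normrN; lra.
Qed.

End ComplexModulus.

(** * Beta-expansions *)

Section BetaExpansion.
Context {R : realType}.
Variable beta : R.
Hypothesis beta1 : 1 < beta.
Local Notation T := (T_beta beta).

Let beta0 : 0 < beta. Proof. exact: lt_trans beta1. Qed.
Let betaNZ : beta != 0. Proof. by rewrite gt_eqF. Qed.

Definition digit (s : R) (k : nat) : int := Num.floor (beta * iter k T s).

(** The value of the finite expansion [0.w_0 ... w_(n-1)] in base beta. *)
Definition expval (w : nat -> int) (n : nat) : R :=
  \sum_(j < n) (w j)%:~R * beta ^- j.+1.

Definition unit_real (s : R) := 0 <= s < 1.

Lemma e_betaE s k : e_beta beta s k = (digit s k)%:~R.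
Proof. by rewrite /e_beta iterS /T_beta /digit subKr. Qed.

Lemma T_unit s : unit_real (T s).
Proof.
have /andP[] := floor_itv (beta * s); rewrite intrD => h1 h2.
by rewrite /unit_real /T_beta subr_ge0 h1 ltrBlDl.
Qed.

Lemma iterT_unit s k : unit_real s -> unit_real (iter k T s).
Proof. by case: k => // k _; exact: T_unit. Qed.

Lemma T_split s k : beta * iter k T s = (digit s k)%:~R + iter k.+1 T s.
Proof. by rewrite iterS /T_beta addrC subrK. Qed.

Lemma digit_shift s n k : digit (iter n T s) k = digit s (n + k)%N.
Proof. by rewrite /digit -iterD addnC. Qed.

Lemma expvalS w n : expval w n.+1 = expval w n + (w n)%:~R * beta ^- n.+1.
Proof. by rewrite /expval big_ord_recr. Qed.

Lemma expval0 w : expval w 0 = 0.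
Proof. by rewrite /expval big_ord0. Qed.

Lemma eq_expval w w' n : (forall j, (j < n)%N -> w j = w' j) -> expval w n = expval w' n.
Proof. by move=> e; apply: eq_bigr => j _; rewrite e. Qed.

Lemma expansion s n : s = expval (digit s) n + beta ^- n * iter n T s.
Proof.
elim: n => [|n IH]; first by rewrite expval0 expr0 invr1 mul1r add0r.
rewrite {1}IH expvalS -addrA; congr (_ + _).
have -> : beta ^- n * iter n T s = beta ^- n.+1 * (beta * iter n T s).
  by rewrite exprSr invfM -mulrA mulKf.
by rewrite T_split mulrDr [X in X + _]mulrC.
Qed.

Let pow_ge0 n : 0 <= beta ^- n. Proof. by rewrite invr_ge0 exprn_ge0// ltW. Qed.

(** Admissibility is monotone: after the first [n] digits of [s] every tail [t]
    not exceeding the tail of [s] may follow.  So a cylinder is an interval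
    starting at [expval (digit s) n]. *)
Lemma prefix s t n : unit_real s -> 0 <= t <= iter n T s ->
  let u := expval (digit s) n + beta ^- n * t in
  [/\ 0 <= u <= s, iter n T u = t & forall i, (i < n)%N -> digit u i = digit s i].
Proof.
move=> s01; elim: n t => [|n IH] t /andP[t0 tT] u.
  by rewrite /u expval0 expr0 invr1 mul1r add0r t0 tT.
pose t'' := ((digit s n)%:~R + t) / beta.
have dn0 : 0 <= (digit s n)%:~R :> R.
  rewrite ler0z floor_ge0 mulr_ge0//; first exact: ltW.
  by case/andP: (iterT_unit n s01).
have t''E : beta * t'' = (digit s n)%:~R + t by rewrite /t'' mulrC divfK.
have t''01 : 0 <= t'' <= iter n T s.
  rewrite divr_ge0 ?addr_ge0 ?(ltW beta0)//=.
  by rewrite ler_pdivrMr// mulrC T_split lerD2l.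
have uE : u = expval (digit s) n + beta ^- n * t''.
  rewrite /u expvalS -addrA; congr (_ + _).
  by rewrite /t'' exprSr invfM; ring.
have [u0s Tu du] := IH _ t''01; rewrite -uE in u0s Tu du.
have t1 : t < 1 by apply: le_lt_trans tT _; case/andP: (iterT_unit n.+1 s01).
have dun : digit u n = digit s n.
  rewrite {1}/digit Tu t''E; apply: floor_def.
  by rewrite lerDl t0/= intrD ltrD2l.
split => //.
  by have := T_split u n; rewrite Tu t''E dun => /addrI.
move=> i; rewrite ltnS leq_eqVlt => /orP[/eqP ->//|]; exact: du.
Qed.

Lemma digit_ge0 s k : unit_real s -> 0 <= digit s k.
Proof.
move=> s01; rewrite floor_ge0 mulr_ge0//; first exact: ltW.
by case/andP: (iterT_unit k s01).
Qed.

Lemma digit_le s k : unit_real s -> digit s k <= Num.floor beta.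
Proof.
move=> s01; apply: le_floor; rewrite -[leRHS]mulr1 ler_wpM2l//; first exact: ltW.
by case/andP: (iterT_unit k s01) => _ /ltW.
Qed.

(** A point between the left endpoint of the cylinder of [x'] and [x'] itself
    lies in that cylinder, by [prefix]. *)
Lemma lt_left_endpoint x x' N : unit_real x -> unit_real x' -> x < x' ->
  (exists2 j, (j < N)%N & digit x j <> digit x' j) -> x < expval (digit x') N.
Proof.
move=> x01 x'01 xx' [j jN dj]; rewrite ltNge; apply/negP => ax.
apply: dj; pose t := beta ^+ N * (x - expval (digit x') N).
have xE : x = expval (digit x') N + beta ^- N * t.
  by rewrite /t mulKf ?expf_neq0// addrC subrK.
have t01 : 0 <= t <= iter N T x'.
  rewrite mulr_ge0 ?exprn_ge0 ?(ltW beta0) ?subr_ge0//=.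
  rewrite -ler_pdivlMl ?exprn_gt0// lerBlDl -expansion; exact: ltW.
by have [_ _ /(_ _ jN)] := prefix x'01 t01; rewrite -xE.
Qed.

Lemma left_endpoint_le x N : unit_real x -> expval (digit x) N <= x.
Proof.
move=> x01; rewrite [leRHS](expansion x N) lerDl mulr_ge0//.
by case/andP: (iterT_unit N x01).
Qed.

(** Only finitely many left endpoints of rank N exist, so they are uniformly
    separated; three points in different cylinders enclose two of them. *)
Lemma cylinder_separation N : exists2 delta : R, 0 < delta &
  forall x1 x2 x3, unit_real x1 -> unit_real x2 -> unit_real x3 ->
    x1 < x2 -> x2 < x3 ->
    (exists2 j, (j < N)%N & digit x1 j <> digit x2 j) ->
    (exists2 j, (j < N)%N & digit x2 j <> digit x3 j) -> delta <= x3 - x1.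
Proof.
pose D := `|Num.floor beta|%N.
pose val (w : {ffun 'I_N -> 'I_D.+1}) := \sum_(j < N) (w j)%:R * beta ^- j.+1.
pose delta := \big[Num.min/1]_(p : {ffun 'I_N -> 'I_D.+1} * {ffun 'I_N -> 'I_D.+1} | val p.1 != val p.2)
  `|val p.1 - val p.2|.
exists delta.
  rewrite /delta; elim/big_ind: _ => [//|x y x0 y0|p].
    by rewrite lt_min x0.
  by rewrite normr_gt0 subr_eq0.
move=> x1 x2 x3 u1 u2 u3 x12 x23 d12 d23.
have W x : unit_real x -> exists w : {ffun 'I_N -> 'I_D.+1}, val w = expval (digit x) N.
  move=> x01; exists [ffun j : 'I_N => inord `|digit x j|%N].
  apply: eq_bigr => j _; rewrite ffunE inordK.
    by rewrite natr_absz ger0_norm// digit_ge0.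
  rewrite ltnS /D -lez_nat !gez0_abs ?digit_le ?digit_ge0//.
  by rewrite floor_ge0 ltW.
have [w2 w2E] := W _ u2; have [w3 w3E] := W _ u3.
have lt1 := lt_left_endpoint u1 u2 x12 d12.
have lt2 := lt_left_endpoint u2 u3 x23 d23.
have le2 := left_endpoint_le N u2; have le3 := left_endpoint_le N u3.
have ne : val w3 != val w2 by rewrite w2E w3E gt_eqF// (le_lt_trans le2).
apply: (@le_trans _ _ `|val w3 - val w2|).
  exact: (@bigmin_le_cond _ _ _ _ (w3, w2)).
rewrite w2E w3E ger0_norm; last by rewrite subr_ge0 (le_trans le2)// ltW.
lra.
Qed.

Lemma div_beta s : unit_real s ->
  [/\ unit_real (s / beta), T (s / beta) = s & digit (s / beta) 0 = 0].
Proof.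
move=> /andP[s0 s1].
have fl : Num.floor (beta * (s / beta)) = 0.
  by rewrite mulrC divfK//; apply: floor_def; rewrite add0r s0 s1.
split; last by rewrite /digit/=.
  rewrite /unit_real divr_ge0 ?(ltW beta0)//= ltr_pdivrMr// mul1r.
  exact: lt_trans beta1.
by rewrite /T_beta fl mulrC divfK// subr0.
Qed.

Lemma zero_prefix s j : unit_real s ->
  [/\ unit_real (beta ^- j * s), iter j T (beta ^- j * s) = s &
      forall i, (i < j)%N -> digit (beta ^- j * s) i = 0].
Proof.
move=> s01; elim: j => [|j [u0 Tu du]]; first by rewrite expr0 invr1 mul1r.
have [u1 Tu1 du1] := div_beta u0.
have E : beta ^- j.+1 * s = (beta ^- j * s) / beta by rewrite exprS invfM; ring.
rewrite E; split => //; first by rewrite iterSr Tu1.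
case=> [//|i] ij; rewrite -[i.+1]add1n -digit_shift/= Tu1; exact: du.
Qed.

(** [u] is [s] with the word [1 0^L] prepended to its expansion. *)
Lemma one_prefix s L : unit_real s -> beta^-1 + beta ^- L.+1 < 1 ->
  let u := beta^-1 + beta ^- L.+1 * s in
  [/\ unit_real u, iter L.+1 T u = s, digit u 0 = 1 &
      forall i, (i < L)%N -> digit u i.+1 = 0].
Proof.
move=> s01 HL u; have [z01 Tz dz] := zero_prefix L s01.
have uE : beta * u = 1 + beta ^- L * s.
  by rewrite /u mulrDr divff// exprS invfM !mulrA divff// mul1r.
have fl : Num.floor (beta * u) = 1.
  apply: floor_def; rewrite uE lerDl; case/andP: z01 => -> z1 /=.
  by rewrite intrD ltrD2l.
have Tu : T u = beta ^- L * s by rewrite /T_beta fl uE addrC addKr.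
split; [|by rewrite iterSr Tu|by rewrite /digit|]; last first.
  by move=> i iL; rewrite -[i.+1]add1n -digit_shift/= Tu; exact: dz.
case/andP: s01 => s0 s1; rewrite /unit_real /u addr_ge0 ?invr_ge0 ?(ltW beta0) ?mulr_ge0//=.
apply: le_lt_trans HL; rewrite lerD2l -[leRHS]mulr1 ler_wpM2l//; exact: ltW.
Qed.

End BetaExpansion.

(** * Rotated digit sums of beta-expansions are almost nowhere tight *)

Section AffineLebesgue.
Context {R : realType}.
Local Notation mu := (@lebesgue_measure R).

Lemma measurable_affine (a c : R) :
  measurable_fun setT ((fun x => a + c * x) : measurableTypeR R -> measurableTypeR R).
Proof. by apply: measurable_funD => //; exact: measurable_funM. Qed.

Lemma lebesgue_affine (a c : R) (A : set R) : 0 < c -> measurable A ->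
  (c%:E * mu ((fun x => a + c * x)%R @^-1` A) = mu A)%E.
Proof.
move=> c0 mA; pose f := (fun x : measurableTypeR R => (a + c * x : measurableTypeR R)).
have mf : measurable_fun setT f := measurable_affine a c.
pose m0 := mscale (NngNum (ltW c0)) (pushforward mu f); pose m := m0 mf.
have -> : (c%:E * mu ((fun x => a + c * x)%R @^-1` A))%E = m A by [].
apply/esym/lebesgue_measure_unique => // _ [[x y]] /= xy <-.
rewrite /m /m0 /mscale/= /pushforward.
have -> : f @^-1` `]x, y] = `](x - a) / c, (y - a) / c]%classic.
  apply/seteqP; split => z /=; rewrite !in_itv/= /f ltr_pdivrMr// ler_pdivlMr//.
    by rewrite ltrBlDl lerBrDl [z * c]mulrC.
  by rewrite ltrBlDl lerBrDl [z * c]mulrC.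
rewrite !lebesgue_measure_itv/= !lte_fin ltr_pM2r ?invr_gt0// ltrD2r.
case: ifP => _; last by rewrite mule0.
rewrite /= -EFinM; congr EFin; field; rewrite gt_eqF//.
Qed.

Lemma lebesgue_affine0 (a c : R) (A : set R) : 0 < c -> measurable A -> mu A = 0%E ->
  mu ((fun x => a + c * x) @^-1` A) = 0%E.
Proof.
move=> c0 mA A0; have := lebesgue_affine a c0 mA; rewrite A0 => /eqP.
by rewrite mule_eq0 eqe gt_eqF//= => /eqP.
Qed.

(** By the Lebesgue density theorem almost every point of [A] is a density
    point; the countable set [C] is null. *)
Lemma density_point (A C : set R) : measurable A -> mu A != 0%E -> countable C ->
  exists s, [/\ A s, ~ C s & forall eps : R, 0 < eps -> exists2 r0 : R, 0 < r0 &
    forall r, 0 < r -> r < r0 -> (mu (ball s r `\` A) <= (eps * r)%:E)%E].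
Proof.
move=> mA A0 cC; apply: contrapT => no.
have [N [mN N0 HN]] := lebesgue_density mA.
have mC : measurable C by apply: countable_measurable.
move/eqP: A0; apply; apply/eqP; rewrite -measure_le0.
have NC0 : mu (N `|` C) = 0%E.
  apply/eqP; rewrite -measure_le0; apply: le_trans (measureU2 _ _ _) _ => //.
  rewrite -[leRHS]adde0; apply: leeD; rewrite le_eqVlt; apply/orP; left; apply/eqP.
    exact: N0.
  exact: countable_lebesgue_measure0.
rewrite -NC0; apply: le_measure; rewrite ?inE//; first exact: measurableU.
move=> s As; apply: contrapT => sNC; apply: no; exists s; split => //.
  by move=> Cs; apply: sNC; right.
have {}HN : (mu (A `&` ball s r) / mu (ball s r))%E @[r --> 0^'+] --> (\1_A s)%:E.
  by apply: contrapT => ns; apply: sNC; left; exact: HN.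
move=> eps eps0; move: HN; rewrite indicE mem_set//= => /fine_cvgP[_].
move/cvgrPdist_lt => /(_ (eps / 2)); rewrite divr_gt0// => /(_ isT).
move=> [/= r0 r00 Hr0]; exists r0 => // r rp rr0.
have := Hr0 r; rewrite /= sub0r normrN gtr0_norm// => /(_ rr0 rp).
have mB : measurable (ball s r) by exact: measurable_ball.
have mAB : measurable (A `&` ball s r) by exact: measurableI.
have muB : mu (ball s r) = (r *+ 2)%:E by rewrite lebesgue_measure_ball// ltW.
have finAB : mu (A `&` ball s r) \is a fin_num.
  rewrite ge0_fin_numE//; apply: (@le_lt_trans _ _ (mu (ball s r))).
    by apply: le_measure; rewrite ?inE.
  by rewrite muB ltry.
rewrite muB -(fineK finAB); set a := fine (mu (A `&` ball s r)).
have r2 : r *+ 2 != 0 by rewrite mulrn_eq0/= gt_eqF.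
rewrite inver (negbTE r2) -EFinM/= => Ha.
have Ea : mu (ball s r `\` A) = (r *+ 2 - a)%:E.
  have finB : (mu (ball s r) < +oo)%E by rewrite muB ltry.
  rewrite measureD//.
  by rewrite setIC EFinB; congr (_ - _)%E; [exact: muB|rewrite /a fineK].
rewrite Ea lee_fin; move: Ha => /(le_lt_trans (ler_norm _)).
rewrite ltrBlDr -ltrBlDl ltr_pdivlMr; last by rewrite mulrn_wgt0.
by rewrite ![r *+ 2]mulr2n => Ha; lra.
Qed.

End AffineLebesgue.

Lemma sum_nat_split (F : nat -> nat) n K :
  (\sum_(0 <= k < n + K) F k = \sum_(0 <= k < n) F k + \sum_(0 <= k < K) F (n + k))%N.
Proof.
rewrite (@big_cat_nat _ _ _ n)//= ?leq_addr//; congr (_ + _)%N.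
rewrite -{1}[n]add0n big_addn addKn.
by apply: eq_bigr => i _; rewrite addnC.
Qed.

Section RotatedDigitSums.
Context {R : realType}.
Variables (beta : R) (theta : R[i]).
Hypotheses (beta1 : 1 < beta) (theta1 : cnorm theta = 1) (thetaN1 : theta != 1).
Local Notation T := (T_beta beta).
Local Notation mu := (@lebesgue_measure R).
Local Notation dig := (digit beta).

Let beta0 : 0 < beta. Proof. exact: lt_trans beta1. Qed.
Let betaV_gt0 n : 0 < beta ^- n. Proof. by rewrite invr_gt0 exprn_gt0. Qed.

(** The displacement of the recursion [z_(k+1) = theta * z_k + w_k] in the frame
    rotating with [theta]: [z_n = theta ^+ n * (z_0 + rsum w n)]. *)
Definition rsum (w : nat -> int) (n : nat) : R[i] :=
  \sum_(j < n) (w j)%:~R * theta ^- j.+1.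

Lemma eq_rsum w w' n : (forall j, (j < n)%N -> w j = w' j) -> rsum w n = rsum w' n.
Proof. by move=> e; apply: eq_bigr => j _; rewrite e. Qed.

Lemma rsumS w n : rsum w n.+1 = rsum w n + (w n)%:~R * theta ^- n.+1.
Proof. by rewrite /rsum big_ord_recr. Qed.

Lemma rsum_zero w n : (forall j, (j < n)%N -> w j = 0) -> rsum w n = 0.
Proof. by move=> e; rewrite /rsum big1// => j _; rewrite e// mul0r. Qed.

Lemma rsum_shift s n k :
  rsum (dig s) (n + k) = rsum (dig s) n + theta ^- n * rsum (dig (iter n T s)) k.
Proof.
elim: k => [|k IH]; first by rewrite addn0 /rsum big_ord0 mulr0 addr0.
rewrite addnS !rsumS IH mulrDr addrA digit_shift; congr (_ + _).
by rewrite mulrCA -invfM -exprD addnS.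
Qed.

Let thetaVn n : cnorm (theta ^- n) = 1.
Proof. by rewrite cnormV cnormX theta1 expr1n invr1. Qed.

Definition excess (M s : R) (n : nat) : nat :=
  \sum_(0 <= k < n) (M < cnorm (rsum (dig s) k))%R.

(** The points whose rotated digit sums exceed [M] with upper frequency at most
    a third; the additive constant makes the condition depend on the tail of
    the expansion only, up to the size of the discarded sum. *)
Definition tight (M : R) : set R :=
  [set s | unit_real s /\ exists C : nat, forall n, (3 * excess M s n <= n + C)%N].

(** By [rsum_shift] the sums of the shifted point are, up to a rotation, those
    of [s] minus the discarded sum. *)
Lemma tight_shift M M' s n : tight M s -> cnorm (rsum (dig s) n) <= M' ->
  tight (M + M') (iter n T s).
Proof.
move=> [s01 [C HC]] sM'; split; first exact: iterT_unit.
exists (n + C)%N => k; rewrite addnA [(k + n)%N]addnC; apply: leq_trans (HC _).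
rewrite leq_mul2l/= /excess sum_nat_split; apply: leq_trans (leq_addl _ _).
apply: leq_sum => i _; rewrite rsum_shift.
case: (ltP (M + M')) => //= lt1; rewrite lt0b.
move: lt1; rewrite -[X in _ < X]mul1r -(thetaVn n) -cnormM => lt1.
have := cnormB (rsum (dig s) n + theta ^- n * rsum (dig (iter n T s)) i) (rsum (dig s) n).
rewrite addrAC subrr add0r => h.
by move: lt1 => /lt_le_trans/(_ h); lra.
Qed.

Lemma tight_visits M s (n0 : nat) : tight M s ->
  exists2 n, (n0 <= n)%N & cnorm (rsum (dig s) n) <= M.
Proof.
move=> [_ [C HC]]; apply: contrapT => no.
have all n : (n0 <= n)%N -> M < cnorm (rsum (dig s) n).
  by move=> n0n; rewrite ltNge; apply/negP => le; apply: no; exists n.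
have ex k : (k <= excess M s (n0 + k))%N.
  rewrite /excess sum_nat_split; apply: leq_trans (leq_addl _ _).
  rewrite -[leqLHS]subn0 -[X in (X <= _)%N]muln1 -sum_nat_const_nat.
  by apply: leq_sum => i _; rewrite all// leq_addr.
have := HC (n0 + (n0 + C).+1)%N; have := ex (n0 + C).+1; clear; lia.
Qed.

(** Two sets of times of upper frequency at most a third do not exhaust all
    times, even when one of them is shifted by [n]. *)
Lemma tight_common M s t n : tight M s -> tight M t ->
  exists k, cnorm (rsum (dig s) k) <= M /\ cnorm (rsum (dig t) (n + k)) <= M.
Proof.
move=> [_ [C HC]] [_ [C' HC']]; apply: contrapT => no.
pose K := (n + C + C').+1.
have : (K <= excess M s K + excess M t (n + K))%N.
  rewrite /excess [X in (_ <= _ + X)%N]sum_nat_split addnCA.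
  apply: leq_trans (leq_addl _ _).
  rewrite -big_split/= -[leqLHS]subn0 -[X in (X <= _)%N]muln1 -sum_nat_const_nat.
  apply: leq_sum => k _; rewrite addn_gt0 !lt0b.
  apply/negPn; rewrite negb_or -!leNgt; apply/negP => /andP[h1 h2].
  by apply: no; exists k.
have := HC K; have := HC' (n + K)%N; rewrite /K; clear; lia.
Qed.

(** Words [1 0^L] with [L] chosen by the rotation argument make the rotated
    digit sums arbitrarily large. *)
Lemma large_rsum (M : R) : exists s n,
  [/\ unit_real s, s <= beta^-1, 0 < iter n T s & M < cnorm (rsum (dig s) n)].
Proof.
have [L0 HL0] : exists L0, forall L, (L0 <= L)%N -> beta^-1 + beta ^- L.+1 < 1.
  have b1 : `|beta^-1| < 1 by rewrite gtr0_norm ?invr_gt0// invf_lt1.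
  have /cvgrPdist_lt := cvg_expr b1.
  move=> /(_ (1 - beta^-1)); rewrite subr_gt0 invf_lt1// => /(_ beta1)[L0 _ HL0].
  exists L0 => L L0L; have := HL0 L.+1 (leq_trans L0L (leqnSn L)).
  rewrite /= sub0r normrN ger0_norm ?exprn_ge0 ?invr_ge0 ?(ltW beta0)// exprVn.
  by rewrite ltrBrDl.
have grow i : exists s n, [/\ unit_real s, 0 < iter n T s &
    i%:R / 2 <= cnorm (rsum (dig s) n) ^+ 2].
  elim: i => [|i [s [n [s01 Tn Hn]]]].
    exists 2^-1, 0%N; split; rewrite ?mul0r ?sqr_ge0//=.
    by rewrite /unit_real invr_ge0 invf_lt1// ltr1n ler0n.
  have [L L0L HL] := rotation_growth (rsum (dig s) n) L0 theta1 thetaN1.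
  have [u01 Tu du0 du] := one_prefix beta1 s01 (HL0 _ L0L).
  set u := beta^-1 + _ in u01 Tu du0 du.
  exists u, (L.+1 + n)%N; split => //.
    by rewrite addnC iterD Tu.
  rewrite rsum_shift Tu.
  have -> : rsum (dig u) L.+1 = theta^-1.
    rewrite /rsum big_ord_recl/= du0 expr1 mul1r big1 ?addr0// => j _.
    by rewrite /bump/= add1n du// mul0r.
  have -> : theta^-1 + theta ^- L.+1 * rsum (dig s) n =
      theta^-1 * (1 + theta ^- L * rsum (dig s) n).
    by rewrite mulrDr mulr1 exprS invfM mulrA.
  rewrite cnormM -[theta^-1]expr1 exprVn thetaVn mul1r; apply: le_trans HL.
  by rewrite -natr1 mulrDl mul1r lerD2r.
pose i := (Num.truncn (2 * M ^+ 2)).+1.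
have [s [n [s01 Tn Hn]]] := grow i.
(* prepending a digit 0 brings the point below [beta^-1] *)
have [u01 Tu du] := div_beta beta1 s01.
exists (s / beta), n.+1; split => //.
- by rewrite ler_pdivrMr// mulVf ?gt_eqF//; case/andP: s01 => _ /ltW.
- by rewrite iterSr Tu.
rewrite -addn1 addnC rsum_shift/= Tu rsumS {1}/rsum big_ord0 du mul0r !add0r.
rewrite cnormM thetaVn mul1r ltNge; apply/negP => le.
have := truncnS_gt (2 * M ^+ 2); rewrite -/i => iM.
have : cnorm (rsum (dig s) n) ^+ 2 <= M ^+ 2 by rewrite ler_sqr ?nnegrE ?cnorm_ge0// (le_trans (cnorm_ge0 _) le).
lra.
Qed.

End RotatedDigitSums.

Section RotatedDigitSumsNull.
Context {R : realType}.
Variables (beta : R) (theta : R[i]).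
Hypotheses (beta1 : 1 < beta) (theta1 : cnorm theta = 1) (thetaN1 : theta != 1).
Local Notation T := (T_beta beta).
Local Notation mu := (@lebesgue_measure R).
Local Notation dig := (digit beta).
Local Notation RR := (measurableTypeR R).

Let beta0 : 0 < beta. Proof. exact: lt_trans beta1. Qed.
Let betaV_gt0 n : 0 < beta ^- n. Proof. by rewrite invr_gt0 exprn_gt0. Qed.

Lemma measurable_intr_floor :
  measurable_fun setT ((fun x => (Num.floor x)%:~R) : RR -> RR).
Proof.
by apply: nondecreasing_measurable => // x y xy; rewrite ler_int le_floor.
Qed.

Lemma measurable_T_beta : measurable_fun setT (T : RR -> RR).
Proof.
have mb : measurable_fun setT ((fun x => beta * x) : RR -> RR) by exact: measurable_funM.
apply: measurable_funB => //.
exact: (measurableT_comp measurable_intr_floor mb).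
Qed.

Lemma measurable_digit k :
  measurable_fun setT ((fun s => (dig s k)%:~R) : RR -> RR).
Proof.
have mk : measurable_fun setT ((fun s => beta * iter k T s) : RR -> RR).
  by apply: measurable_funM => //; exact: (measurable_iter k measurable_T_beta).
exact: (measurableT_comp measurable_intr_floor mk).
Qed.

Lemma measurable_cnorm_rsum k :
  measurable_fun setT ((fun s => cnorm (rsum theta (dig s) k)) : RR -> RR).
Proof.
have E (f : R[i] -> R) (fD : {morph f : x y / x + y}) (f0 : f 0 = 0)
    (fZ : forall (m : int) z, f (m%:~R * z) = m%:~R * f z) :
    measurable_fun setT ((fun s => f (rsum theta (dig s) k)) : RR -> RR).
  have -> : (fun s => f (rsum theta (dig s) k)) =
      (fun s => \sum_(j < k) (dig s j)%:~R * f (theta ^- j.+1)).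
    apply/funext => s; rewrite (big_morph f fD f0).
    by apply: eq_bigr => j _; rewrite fZ.
  apply: measurable_sum => j; apply: measurable_funM => //; exact: measurable_digit.
have sc (m : int) (z : R[i]) : m%:~R * z = (complex.Complex (m%:~R * complex.Re z) (m%:~R * complex.Im z)).
  by rewrite -(rmorph_int (real_complex R)); case: z => a b; apply/eqP; rewrite eq_complex/= !mul0r subr0 addr0 !eqxx.
have mRe := E (@complex.Re R) (raddfD _) (raddf0 _) (fun m z => congr1 (@complex.Re R) (sc m z)).
have mIm := E (@complex.Im R) (raddfD _) (raddf0 _) (fun m z => congr1 (@complex.Im R) (sc m z)).
have msq : measurable_fun setT (Num.sqrt : RR -> RR).
  by apply: nondecreasing_measurable => // x y; exact: ler_wsqrtr.
by apply: (measurableT_comp msq); apply: measurable_funD; exact: measurable_funX.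
Qed.

Lemma measurable_unit_real : measurable [set s : RR | unit_real s].
Proof.
rewrite (_ : [set s : RR | unit_real s] = `[0, 1[%classic); first exact: measurable_itv.
by apply/seteqP; split=> s /=; rewrite in_itv.
Qed.

Lemma measurable_tight M : measurable (tight beta theta M : set RR).
Proof.
have -> : tight beta theta M = [set s | unit_real s] `&`
    \bigcup_C \bigcap_n [set s | (3 * excess beta theta M s n <= n + C)%N].
  apply/seteqP; split=> s [s01]; first by move=> [C HC]; split => //; exists C => // n _; exact: HC.
  by move=> [C _ HC]; split => //; exists C => n; exact: HC.
apply: measurableI; first exact: measurable_unit_real.
apply: bigcup_measurable => C _; apply: bigcapT_measurable => n.
apply: (@measurable_count _ RR (fun k s => M < cnorm (rsum theta (dig s) k)) n
  (fun c => (3 * c <= n + C)%N)) => k.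
rewrite (_ : [set _ | _] =
    (fun s => cnorm (rsum theta (dig s) k)) @^-1` `]M, +oo[%classic); last first.
  by apply/seteqP; split=> s /=; rewrite in_itv/= andbT.
by rewrite -[X in measurable X]setTI; apply: measurable_cnorm_rsum.
Qed.

Definition finite_expansion : set R := [set s | exists N, iter N T s = 0].

(** Such a point is the value of a finite integer word. *)
Lemma countable_finite_expansion : countable finite_expansion.
Proof.
pose sval (l : seq int) := \sum_(j < size l) (nth 0 l j)%:~R * beta ^- j.+1.
apply: (@sub_countable _ _ _ (range sval)); last first.
  exact: card_le_trans (card_image_le _ _) (countableP _).
apply: subset_card_le => s [N sN]; exists (mkseq (dig s) N) => //.
rewrite {2}(expansion beta1 s N) sN mulr0 addr0 /sval /expval size_mkseq.
by apply: eq_bigr => j _; rewrite nth_mkseq.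
Qed.

(** A zero-one argument.  The expansion map blows small intervals to the left
    of a density point of [tight M] up to [[0, beta^-1]], and at times when the
    digit sum is small maps [tight M] into [tight (M + M)]; hence the latter
    has full measure.  Prepending a word with a huge digit sum is then
    impossible. *)
Theorem tight_null M : mu (tight beta theta M) = 0%E.
Proof.
apply: contrapT => /eqP A0; have mA := measurable_tight M.
have [s [[s01 sT] sC dens]] := density_point mA A0 countable_finite_expansion.
have sM : tight beta theta M s by [].
have betaV1 : beta^-1 < 1 by rewrite invf_lt1.
pose B := `[0, beta^-1]%classic `\` tight beta theta (M + M).
have mB : measurable B.
  by apply: measurableD; [exact: measurable_itv|exact: measurable_tight].
have B0 : mu B = 0%E.
  apply/eqP; rewrite -measure_le0; apply/lee_addgt0Pr => eps eps0; rewrite add0e.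
  have [r0 r00 Hr0] := dens (eps / 2) (divr_gt0 eps0 (ltr0n _ 2)).
  have [n0 Hn0] : exists n0, forall n, (n0 <= n)%N -> 2 * beta ^- n < r0.
    have b1 : `|beta^-1| < 1 by rewrite gtr0_norm ?invr_gt0.
    have /cvgrPdist_lt := cvg_expr b1.
    move=> /(_ (r0 / 2)); rewrite divr_gt0// => /(_ isT)[n0 _ H].
    exists n0 => n /H /=.
    rewrite sub0r normrN ger0_norm ?exprn_ge0 ?invr_ge0 ?(ltW beta0)// exprVn.
    by rewrite ltr_pdivlMr// mulrC.
  have [n n0n Sn] := tight_visits n0 sM.
  pose c := iter n T s.
  have /andP[c0 c1] : unit_real c by exact: iterT_unit.
  have cp : 0 < c by rewrite lt0r c0 andbT; apply/eqP => c00; apply: sC; exists n.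
  have [j cj1 cj2] : exists2 j, beta ^+ j * c < 1 & beta^-1 <= beta ^+ j * c.
    have ex : exists k, 1 <= beta ^+ k * c.
      have : `|beta^-1| < 1 by rewrite gtr0_norm ?invr_gt0.
      move=> /cvg_expr/cvgrPdist_lt/(_ c cp)[k _ /(_ k (leqnn k))]/=.
      rewrite sub0r normrN ger0_norm ?exprn_ge0 ?invr_ge0 ?(ltW beta0)// exprVn.
      move=> H; exists k; rewrite -ler_pdivrMl ?exprn_gt0// mulr1; exact: ltW.
    have [k Hk kmin] := ex_minnP ex; case: k Hk kmin => [|k] Hk kmin.
      by move: Hk; rewrite expr0 mul1r leNgt c1.
    exists k.
      rewrite ltNge; apply/negP => /kmin; by rewrite ltnn.
    by rewrite -[beta^-1]mulr1 ler_pdivrMl// mulrA -exprS.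
  (* [x => a + q * x] prepends to [x] the first [n] digits of [s] and [j] zeros,
     with [j] the least number that makes all of [[0, beta^-1]] fit below the
     tail [c] of [s] *)
  pose q := beta ^- n * beta ^- j.
  have q0 : 0 < q by rewrite mulr_gt0.
  pose r := 2 * (beta ^- n * c).
  have r_gt0 : 0 < r by rewrite !mulr_gt0.
  have rr0 : r < r0.
    apply: le_lt_trans (Hn0 _ n0n); rewrite /r mulrA -[leRHS]mulr1 ler_wpM2l//.
      by rewrite mulr_ge0// ltW.
    exact: ltW.
  pose a := expval beta (dig s) n.
  have sub : B `<=` (fun x => a + q * x) @^-1` (ball s r `\` tight beta theta M).
    move=> x [/=]; rewrite in_itv/= => /andP[x0 xb] xB.
    have xc : 0 <= beta ^- j * x <= c.
      rewrite mulr_ge0 ?(ltW (betaV_gt0 _))//= -[leRHS](mulKf (_ : beta ^+ j != 0)).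
        by rewrite ler_wpM2l ?(ltW (betaV_gt0 _))// (le_trans xb).
      by rewrite expf_neq0// gt_eqF.
    have x01 : unit_real x by rewrite /unit_real x0 (le_lt_trans xb).
    have [] := prefix beta1 s01 xc.
    rewrite mulrA -/q -/a => /andP[u0 us] Tu du; split.
      rewrite /ball/= ger0_norm ?subr_ge0//.
      have : s - a = beta ^- n * c by rewrite {1}(expansion beta1 s n) addrC addKr.
      have : 0 <= q * x by rewrite mulr_ge0// ltW.
      by rewrite /r; move: r_gt0; rewrite /r; lra.
    move=> tu; apply: xB.
    have := tight_shift theta1 tu (_ : cnorm (rsum theta (dig (a + q * x)) n) <= M).
    rewrite Tu (eq_rsum _ du) => /(_ Sn) tx.
    have [z01 Tz dz] := zero_prefix beta1 j x01.
    have := tight_shift (n := j) (M' := 0) theta1 tx _.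
    by rewrite Tz addr0; apply; rewrite rsum_zero// cnorm0.
  apply: (@le_trans _ _ (mu ((fun x => a + q * x) @^-1` (ball s r `\` tight beta theta M)))).
    apply: le_measure; rewrite ?inE//.
    rewrite -[X in measurable X]setTI; apply: measurable_affine => //.
    by apply: measurableD => //; exact: measurable_ball.
  have mD : measurable (ball s r `\` tight beta theta M).
    by apply: measurableD => //; exact: measurable_ball.
  have := lebesgue_affine a q0 mD; have := Hr0 r r_gt0 rr0 => /[swap] <-.
  rewrite -lee_pdivlMl// => /le_trans; apply; rewrite -EFinM lee_fin.
  have -> : q^-1 * (eps / 2 * r) = (beta ^+ j * c) * eps.
    by rewrite /q /r; field; rewrite !expf_neq0 ?gt_eqF.
  by rewrite -[leRHS]mul1r ler_wpM2r// ltW.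
(* for almost every small [x], both [x] and [x] preceded by the prefix of [u]
   are tight, although their sums at times [k] and [n + k] differ by more than
   both bounds allow *)
have [u [n [u01 ub Tn large]]] := large_rsum beta1 theta1 thetaN1 (M + M + (M + M)).
pose a := expval beta (dig u) n; pose f := fun x => a + beta ^- n * x.
pose c := Num.min (iter n T u) beta^-1.
have c0 : 0 < c by rewrite lt_min Tn invr_gt0.
have fB0 : mu (f @^-1` B) = 0%E by exact: lebesgue_affine0.
have mfB : measurable (f @^-1` B).
  by rewrite -[X in measurable X]setTI; apply: measurable_affine.
have BfB0 : mu (B `|` f @^-1` B) = 0%E.
  apply/eqP; rewrite -measure_le0; apply: le_trans (measureU2 _ _ _) _ => //.
  rewrite -[leRHS]adde0; apply: leeD; rewrite le_eqVlt; apply/orP; left; apply/eqP.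
    exact: B0.
  exact: fB0.
have [x [xc xB]] : exists x, 0 <= x <= c /\ ~ (B `|` f @^-1` B) x.
  apply: contrapT => no; have : (mu `[0%R, c]%classic <= mu (B `|` f @^-1` B))%E.
    apply: le_measure; rewrite ?inE//; first exact: measurableU.
    move=> x /=; rewrite in_itv/= => xc; apply: contrapT => xB; apply: no.
    by exists x.
  rewrite BfB0 lebesgue_measure_itv/= lte_fin c0 oppr0 adde0 lee_fin.
  by rewrite leNgt c0.
move: xc => /andP[x0]; rewrite le_min => /andP[xT xb].
have [/andP[fx0 fxu] Tf df] := prefix beta1 u01 (introT andP (conj x0 xT)).
have tight_of y : 0 <= y <= beta^-1 -> ~ B y -> tight beta theta (M + M) y.
  move=> yb yB; apply: contrapT => ty; apply: yB.
  by split => //; rewrite /= in_itv.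
have tx : tight beta theta (M + M) x.
  by apply: tight_of; [rewrite x0|move=> Bx; apply: xB; left].
have tf : tight beta theta (M + M) (f x).
  apply: tight_of; first by rewrite fx0 (le_trans fxu).
  by move=> Bx; apply: xB; right.
have [k [xk fk]] := tight_common n tx tf.
move: fk; rewrite rsum_shift Tf (eq_rsum _ df) => fk.
have := cnormB (rsum theta (dig u) n + theta ^- n * rsum theta (dig x) k)
  (theta ^- n * rsum theta (dig x) k).
rewrite addrK [X in _ + X]cnormM cnormV cnormX theta1 expr1n invr1 mul1r => h.
by move: large; rewrite ltNge => /negP; apply; apply: (le_trans h); exact: lerD.
Qed.

End RotatedDigitSumsNull.

(** * Coordinates and Borel sets of sequence spaces *)

Section ProductTopology.
Context {I : Type} {V : topologicalType}.

Lemma ptws_cvg (F : set_system (I -> V)) (w : {ptws I -> V}) : Filter F ->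
  (forall i, (fun g => g i) @ F --> w i) -> F --> w.
Proof.
move=> FF Fw; apply/cvg_sup => i U; rewrite nbhsE => -[B [[C oC <-] Cw] sub].
by apply: filterS sub _; apply: (Fw i); exact: open_nbhs_nbhs.
Qed.

Lemma continuous_into_ptws (S : topologicalType) (f : S -> {ptws I -> V}) :
  (forall i, continuous (fun x => f x i)) -> continuous f.
Proof.
by move=> cf x; apply: ptws_cvg => i; exact: cf.
Qed.

End ProductTopology.

Lemma measurable_proj (V : ptopologicalType) (k : int) :
  measurable_fun [set: borel {ptws int -> V}]
    ((fun x => x k) : borel {ptws int -> V} -> borel V).
Proof.
apply: (@measurability _ _ (borel {ptws int -> V}) (borel V) setT _ (@open V)) => //.
move=> _ [B oB <-]; rewrite setTI; apply: sub_sigma_algebra.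
apply: open_comp => // x _; exact: (@proj_continuous int (fun=> V) k).
Qed.

(** The bridge between the sigma-algebras generated by the open sets and by the
    half-open intervals. *)
Lemma measurable_borel_real (R : realType) :
  measurable_fun [set: borel R] (idfun : borel R -> measurableTypeR R).
Proof.
apply: (measurability _ (RGenInftyO.measurableE R)) => _ [_ [x ->] <-].
rewrite setTI; apply: sub_sigma_algebra; rewrite preimage_id.
exact: interval_open.
Qed.

Section Windows.
Context {V : Type}.

Definition agree (L : nat) (w w' : int -> V) :=
  forall k : int, (`|k| < L)%N -> w k = w' k.

Lemma agreeW L L' (w w' : int -> V) : (L <= L')%N -> agree L' w w' -> agree L w w'.
Proof. by move=> LL ww k kL; apply: ww; exact: leq_trans LL. Qed.

Lemma agree_sym L (w w' : int -> V) : agree L w w' -> agree L w' w.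
Proof. by move=> ww k kL; rewrite ww. Qed.

End Windows.

(** The clopen sets determined by the coordinates in a window around 0; the
    open sets are their increasing unions. *)
Definition window_set (L : nat) (A : set linfZ) :=
  forall v v' : linfZ, agree L v v' -> A v -> A v'.

Lemma window_setC L A : window_set L A -> window_set L (~` A).
Proof. by move=> wA v v' vv' Av Av'; apply: Av; exact: (wA _ _ (agree_sym vv')). Qed.

Lemma window_setW L L' A : (L <= L')%N -> window_set L A -> window_set L' A.
Proof. by move=> LL wA v v' /(agreeW LL); exact: wA. Qed.

Lemma coord_open (k m : int) : open [set v : linfZ | v k = m].
Proof.
have -> : [set v : linfZ | v k = m] =
   (set_val : initial_topology (set_val : linfZ_set -> _) -> _) @^-1`
    (@proj int (fun=> discrete_topology int) k @^-1` [set m]) by [].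
apply: open_comp; first by move=> v _; exact: initial_continuous.
apply: open_comp; first by move=> v _; exact: proj_continuous.
exact: discrete_open.
Qed.

Lemma agree_open L (v : linfZ) : open [set v' : linfZ | agree L v v'].
Proof.
elim: L => [|L IH].
  have -> : [set v' : linfZ | agree 0 v v'] = setT by apply/seteqP; split.
  exact: openT.
have -> : [set v' : linfZ | agree L.+1 v v'] = [set v' : linfZ | agree L v v'] `&`
    ([set v' : linfZ | v' L%:Z = v L%:Z] `&` [set v' : linfZ | v' (- L%:Z) = v (- L%:Z)]).
  apply/seteqP; split=> v' /=.
    move=> ag; split; first exact: agreeW ag.
    by split; rewrite ag// ?abszN absz_nat.
  move=> [ag [e1 e2]] k; rewrite ltnS leq_eqVlt => /orP[/eqP kL|]; last exact: ag.
  by have [->|->] : k = L%:Z \/ k = - L%:Z by lia.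
by apply: openI => //; apply: openI; exact: coord_open.
Qed.

Lemma window_open L A : window_set L A -> open A.
Proof.
move=> wA; have -> : A = \bigcup_(v in A) [set v' : linfZ | agree L v v'].
  by apply/seteqP; split=> [v Av|v' [v Av vv']]; [exists v|exact: wA Av].
by apply: bigcup_open => v _; exact: agree_open.
Qed.

Lemma open_window (U : set linfZ) (v : linfZ) : open U -> U v ->
  exists L, forall v' : linfZ, agree L v v' -> U v'.
Proof.
move=> [U' oU' <-] Uv.
pose F : set_system (int -> discrete_topology int) :=
  filter_from setT (fun L => [set w | agree L v w]).
have FF : Filter F.
  apply: filter_from_filter; first by exists 0%N.
  move=> L L' _ _; exists (maxn L L') => // w ag; split.
    exact: agreeW (leq_maxl _ _) ag.
  exact: agreeW (leq_maxr _ _) ag.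
have FU : F U'.
  apply: (@ptws_cvg _ _ F (set_val v) FF) => [k B Bk|]; last exact: open_nbhs_nbhs.
  exists `|k|.+1 => // w /(_ _ (ltnSn _)) /= <-.
  exact: nbhs_singleton Bk.
by case: FU => L _ LU; exists L => v' vv'; exact: LU.
Qed.

Lemma measurable_window L (A : set (borel linfZ)) : window_set L A -> measurable A.
Proof. by move=> wA; apply: sub_sigma_algebra; exact: window_open wA. Qed.

Lemma measurable_coord (R : realType) (k : int) (g : int -> R) :
  measurable_fun [set: borel linfZ] ((fun v : linfZ => g (v k)) : borel linfZ -> measurableTypeR R).
Proof.
move=> _ Y mY; rewrite setTI; apply: (@measurable_window `|k|.+1) => v v' vv' /=.
by rewrite (vv' k).
Qed.

Lemma open_bigcup_window (U : set linfZ) : open U ->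
  exists B : nat -> set linfZ, [/\ forall L, window_set L (B L),
    forall L, B L `<=` B L.+1 & U = \bigcup_L B L].
Proof.
move=> oU.
exists (fun L => [set v : linfZ | forall v' : linfZ, agree L v v' -> U v']); split.
- move=> L v v' vv' Bv v'' v'v''; apply: Bv => k kL; rewrite vv'//; exact: v'v''.
- by move=> L v Bv v' vv'; apply: Bv; exact: agreeW vv'.
apply/seteqP; split=> v.
  by move=> Uv; have [L HL] := open_window oU Uv; exists L.
by move=> [L _ Bv]; exact: Bv.
Qed.

(** Borel sets of bounded integer sequences are, up to small measure, window
    sets: opens are increasing unions of window sets, and the property passes
    to complements and countable unions. *)
Section WindowApproximation.
Context {R : realType}.
Variable nu : probability (borel linfZ) R.

Definition window_approximable (A : set (borel linfZ)) := measurable A /\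
  forall eps : R, 0 < eps -> exists L (C D : set (borel linfZ)),
    [/\ window_set L C, measurable D, (nu D <= eps%:E)%E &
        forall v, ~ D v -> (A v <-> C v)].

Lemma window_approximable_window L A : window_set L A -> window_approximable A.
Proof.
move=> wA; split; first exact: measurable_window wA.
by move=> eps eps0; exists L, A, set0; split => //; rewrite measure0 lee_fin ltW.
Qed.

Lemma window_approximableC A : window_approximable A -> window_approximable (~` A).
Proof.
move=> [mA aA]; split; first exact: measurableC.
move=> eps /aA[L [C [D [wC mD nD AC]]]]; exists L, (~` C), D; split => //.
  exact: window_setC.
by move=> v /AC[h1 h2]; split=> h /=; [move=> /h2|move=> /h1].
Qed.

Lemma window_approximableU A B :
  window_approximable A -> window_approximable B -> window_approximable (A `|` B).
Proof.
move=> [mA aA] [mB aB]; split; first exact: measurableU.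
move=> eps eps0; have e2 : 0 < eps / 2 by rewrite divr_gt0.
have [L [C [D [wC mD nD AC]]]] := aA _ e2.
have [L' [C' [D' [wC' mD' nD' AC']]]] := aB _ e2.
exists (maxn L L'), (C `|` C'), (D `|` D'); split.
- move=> v v' vv' [Cv|Cv]; [left|right].
    exact: (window_setW (leq_maxl _ _) wC vv').
  exact: (window_setW (leq_maxr _ _) wC' vv').
- exact: measurableU.
- apply: le_trans (measureU2 _ _ _) _ => //.
  by rewrite [eps]splitr EFinD leeD.
- move=> v /not_orP[/AC h /AC' h']; split=> -[/h|/h']; by [left|right].
Qed.

Lemma window_approximable_limit (F : nat -> set (borel linfZ)) :
  (forall i, window_approximable (F i)) -> (forall i, F i `<=` F i.+1) ->
  window_approximable (\bigcup_i F i).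
Proof.
move=> aF ndF; have mF i : measurable (F i) by case: (aF i).
have mU : measurable (\bigcup_i F i) by exact: bigcupT_measurable.
split => // eps eps0; have e2 : 0 < eps / 2 by rewrite divr_gt0.
pose G i := \bigcup_i F i `\` F i.
have mG i : measurable (G i) by exact: measurableD.
have ndF' m n : (m <= n)%N -> F m `<=` F n.
  by move=> /subnK <-; elim: (n - m)%N => // k IH; apply: subset_trans IH _; exact: ndF.
have capG : \bigcap_i G i = set0.
  by apply/seteqP; split=> // v GV; case: (GV 0%N I) => -[i _ Fi] _; case: (GV i I).
have [N HN] : exists N, (nu (G N) <= (eps / 2)%:E)%E.
  by apply: small_tail => // m n mn v [Uv nF]; split => // /(ndF' _ _ mn).
have [_ /(_ _ e2)[L [C [D [wC mD nD AC]]]]] := aF N.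
exists L, C, (G N `|` D); split => //; first exact: measurableU.
  apply: le_trans (measureU2 _ _ _) _ => //.
  by rewrite [eps]splitr EFinD leeD.
move=> v /not_orP[GN /AC <-]; split => [Uv|Fv]; last by exists N.
by apply: contrapT => nF; apply: GN.
Qed.

Lemma window_approximation (A : set (borel linfZ)) : measurable A ->
  forall eps : R, 0 < eps -> exists L (C D : set (borel linfZ)),
    [/\ window_set L C, measurable D, (nu D <= eps%:E)%E &
        forall v, ~ D v -> (A v <-> C v)].
Proof.
move=> mA; suff [] : window_approximable A by [].
move: A mA; apply: smallest_sub.
  split.
  - by apply: (@window_approximable_window 0).
  - by move=> A aA; rewrite setTD; exact: window_approximableC.
  - move=> F aF; pose B n := \bigcup_(i < n) F i.
    have aB n : window_approximable (B n).
      elim: n => [|n IH].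
        rewrite /B (_ : \bigcup_(i < 0) F i = set0).
          exact: (@window_approximable_window 0).
        by apply/seteqP; split=> // v [].
      rewrite (_ : B n.+1 = B n `|` F n); first exact: window_approximableU.
      apply/seteqP; split=> v.
        move=> [i /=]; rewrite ltnS leq_eqVlt => /orP[/eqP ->|]; first by right.
        by move=> iN Fv; left; exists i.
      by move=> [[i /= iN Fv]|Fv]; [exists i => //=; exact: ltnW|exists n => /=].
    have -> : \bigcup_k F k = \bigcup_n B n.
      apply/seteqP; split=> v [i _]; last by move=> [k _ Fv]; exists k.
      by move=> Fv; exists i.+1 => //; exists i => /=.
    apply: window_approximable_limit => // n v [i /= iN Fv]; exists i => //=.
    exact: ltnW.
move=> U oU.
have [B [wB ndB ->]] := open_bigcup_window oU.
apply: window_approximable_limit => // L; exact: window_approximable_window (wB L).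
Qed.

(** The cells are approximated one by one, within [eps / #|I|] each. *)
Lemma window_approximation_rv (I : finType) (X : borel linfZ -> I) (eps : R) :
  fin_rv X -> 0 < eps -> exists L (D : set (borel linfZ)),
    [/\ measurable D, (nu D <= eps%:E)%E &
        forall v v' : linfZ, ~ D v -> ~ D v' -> agree L v v' -> X v = X v'].
Proof.
move=> mX eps0; have I0 : (0 < #|I|)%N by apply/card_gt0P; exists (X point).
pose e := eps / #|I|%:R; have e0 : 0 < e by rewrite divr_gt0// ltr0n.
suff [L [D [mD nD XD]]] : exists L (D : set (borel linfZ)), [/\ measurable D,
    (nu D <= ((size (enum I))%:R * e)%:E)%E & forall v v' : linfZ, ~ D v -> ~ D v' ->
      agree L v v' -> forall i, i \in enum I -> X v = i -> X v' = i].
  exists L, D; split => //; last first.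
    by move=> v v' Dv Dv' vv'; rewrite (XD v v' Dv Dv' vv' (X v))// mem_enum.
  by rewrite (le_trans nD)// lee_fin -cardT /e mulrC divfK// pnatr_eq0 -lt0n.
elim: (enum I) => [|i s [L [D [mD nD XD]]]].
  by exists 0%N, set0; split => //; rewrite measure0 mul0r.
have [L' [C' [D' [wC' mD' nD' XC']]]] := window_approximation (mX i) e0.
exists (maxn L L'), (D `|` D'); split; first exact: measurableU.
  apply: le_trans (measureU2 _ _ _) _ => //.
  by rewrite /= -natr1 mulrDl mul1r EFinD leeD.
move=> v v' /not_orP[Dv Dv'] /not_orP[D1v D1v'] ag j; rewrite inE => /orP[/eqP ->|js].
  move=> Xv; apply/(XC' v' D1v'); apply: (wC' v); last exact/(XC' v Dv').
  exact: agreeW (leq_maxr _ _) ag.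
by apply: XD => //; exact: agreeW (leq_maxl _ _) ag.
Qed.

End WindowApproximation.

(** * Fractional parts on the circle *)

Section CircleLift.
Context {R : realType}.
Local Open Scope quotient_scope.

Lemma mod1_eq (s t : R) : mod1 s = mod1 t <-> s - t \is a Num.int.
Proof.
have E := Quotient.idealrBE (@integers R) s t.
split=> [st|st].
  have : s - t \in @integers R by rewrite E; apply/eqP.
  by [].
have : s - t \in @integers R by [].
by rewrite E => /eqP.
Qed.

Lemma mod1D (s t : R) : mod1 (s + t) = mod1 s + mod1 t.
Proof. exact: (raddfD (\pi_(Quotient.quot (@integers R))%qT)). Qed.

Lemma mod1_eq0 (s : R) : mod1 s = 0 <-> s \is a Num.int.
Proof.
have <- : mod1 (0 : R) = 0 by exact: (raddf0 (\pi_(Quotient.quot (@integers R))%qT)).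
by rewrite mod1_eq subr0.
Qed.

Lemma mod1_sumz (I : Type) (r : seq I) (F : I -> R) (m : I -> int) :
  \sum_(i <- r) mod1 (F i) *~ m i = mod1 (\sum_(i <- r) (m i)%:~R * F i).
Proof.
elim: r => [|i r IH]; first by rewrite !big_nil; apply/esym/mod1_eq0; exact: int_num0.
rewrite !big_cons mod1D IH; congr (_ + _).
rewrite mulrzl.
exact/esym/(raddfMz (\pi_(Quotient.quot (@integers R))%qT)).
Qed.

(** The representative in [[0, 1)]. *)
Definition frac (c : circle R) : R := repr c - (Num.floor (repr c))%:~R.

Lemma frac_ge0 c : 0 <= frac c.
Proof. by rewrite subr_ge0 floor_le. Qed.

Lemma frac_lt1 c : frac c < 1.
Proof.
have /andP[_] := floor_itv (repr c); rewrite intrD => h.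
by rewrite ltrBlDl.
Qed.

Lemma mod1_frac c : mod1 (frac c) = c.
Proof.
rewrite -[RHS](reprK c); apply/mod1_eq.
by rewrite /frac addrAC subrr add0r rpredN intr_int.
Qed.

Lemma frac_mod1_int (t : R) : t - frac (mod1 t) \is a Num.int.
Proof. by apply/mod1_eq; rewrite mod1_frac. Qed.

Lemma frac_mod1 (t : R) : frac (mod1 t) = t - (Num.floor t)%:~R.
Proof.
have /intrP[m tm] := frac_mod1_int t.
have fm : frac (mod1 t) = t - m%:~R by rewrite -tm subKr.
rewrite fm; congr (_ - _%:~R); apply/esym/floor_def.
have := frac_ge0 (mod1 t); have := frac_lt1 (mod1 t); rewrite fm intrD.
by rewrite subr_ge0 ltrBlDl => -> ->.
Qed.

Lemma mod1_continuous : continuous (@mod1 R).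
Proof. exact: pi_continuous. Qed.

Lemma open_circle (U : set (circle R)) : open (@mod1 R @^-1` U) -> open U.
Proof. by []. Qed.

Let open_frac_itv (a : R) : open [set c | 0 < frac c < a].
Proof.
apply: open_circle.
have -> : @mod1 R @^-1` [set c | 0 < frac c < a] =
    \bigcup_(m in [set: int]) `]m%:~R, m%:~R + Num.min a 1[%classic.
  apply/seteqP; split=> t /=.
    rewrite frac_mod1 => /andP[t0 ta]; exists (Num.floor t) => //=.
    rewrite in_itv/= -[_ < t]subr_gt0 t0 /= -[_ < _ + _]ltrBlDl lt_min ta /=.
    by have := frac_lt1 (mod1 t); rewrite frac_mod1.
  move=> [m _ /=]; rewrite in_itv/= -[_ < t]subr_gt0 => /andP[t0 tm].
  have : t - m%:~R < Num.min a 1 by rewrite ltrBlDl.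
  rewrite lt_min => /andP[ta t1].
  have -> : frac (mod1 t) = t - m%:~R.
    rewrite frac_mod1; congr (_ - _%:~R); apply: floor_def.
    by rewrite -subr_ge0 ltW//= intrD -ltrBlDl.
  by rewrite t0.
by apply: bigcup_open => m _; exact: itv_open.
Qed.

Lemma measurable_frac :
  measurable_fun [set: borel (circle R)] (frac : borel (circle R) -> measurableTypeR R).
Proof.
have mI (a : R) : measurable ([set c | 0 < frac c < a] : set (borel (circle R))).
  by apply: sub_sigma_algebra; exact: open_frac_itv.
apply: (measurability _ (RGenInftyO.measurableE R)) => _ [_ [x ->] <-].
rewrite setTI; have [x0|x0] := leP x 0.
  rewrite (_ : _ @^-1` _ = set0)//; apply/seteqP; split=> // c /=.
  by rewrite in_itv/= => /lt_le_trans/(_ x0); rewrite ltNge frac_ge0.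
rewrite (_ : _ @^-1` _ = (~` [set c | 0 < frac c < 1]) `|` [set c | 0 < frac c < x]).
  by apply: measurableU => //; exact: measurableC.
apply/seteqP; split=> c /=; rewrite in_itv/=.
  move=> cx; have := frac_ge0 c; rewrite le_eqVlt => /orP[/eqP <-|->]; last by right.
  by left; rewrite ltxx.
move=> [/negP|/andP[]//]; rewrite frac_lt1 andbT -leNgt => c0.
exact: le_lt_trans x0.
Qed.

Lemma measurable_frac_coord (k : int) :
  measurable_fun [set: borel {ptws int -> circle R}]
    ((fun x => frac (x k)) : borel {ptws int -> circle R} -> measurableTypeR R).
Proof.
exact: (measurableT_comp measurable_frac (@measurable_proj (circle R) k)).
Qed.

End CircleLift.

(** * Borel maps into the product of circles *)

Section MeasurableSequences.
Context {R : realType}.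

(** A countable base of the product topology. *)
Let box (p : nat * nat * seq rat) : set (int -> R) :=
  [set w | forall j : 'I_(p.1.1.*2.+1),
     `|w (j%:Z - p.1.1%:Z) - ratr (nth 0 p.2 j)| < p.1.2.+1%:R^-1].

Let open_box (U : set {ptws int -> R}) (w : {ptws int -> R}) : open U -> U w ->
  exists2 p, box p w & box p `<=` U.
Proof.
move=> oU Uw.
pose F : set_system (int -> R) := filter_from setT (fun L : nat =>
  [set w' : int -> R | forall k : int, (`|k| <= L)%N -> `|w' k - w k| < 2 * L.+1%:R^-1]).
have FF : Filter F.
  apply: filter_from_filter; first by exists 0%N.
  move=> L L' _ _; exists (maxn L L') => // w' ag; split => k kL; apply: lt_le_trans (ag k _) _.
  - exact: leq_trans (leq_maxl _ _).
  - by rewrite ler_wpM2l// lef_pV2 ?posrE// ler_nat ltnS leq_maxl.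
  - exact: leq_trans (leq_maxr _ _).
  - by rewrite ler_wpM2l// lef_pV2 ?posrE// ler_nat ltnS leq_maxr.
have [L _ LU] : F U.
  apply: (@ptws_cvg _ _ F w FF) => [k B Bk|]; last exact: open_nbhs_nbhs.
  move/nbhs_ballP : Bk => [e /= e0 eB].
  exists (maxn `|k| (Num.truncn (2 / e)))%N => // w' ag; apply: eB.
  rewrite /ball/= distrC; apply: lt_le_trans (ag k (leq_maxl _ _)) _.
  rewrite ler_pdivrMr// -ler_pdivrMl// mulrC; apply: le_trans (ltW (truncnS_gt _)) _.
  by rewrite ler_nat ltnS leq_maxr.
have ch (k : int) : exists q : rat, `|w k - ratr q| < L.+1%:R^-1.
  have [|q] := @rat_in_itvoo _ (w k - L.+1%:R^-1) (w k + L.+1%:R^-1).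
    by rewrite ltrD2l gtrN.
  rewrite in_itv/= => /andP[q1 q2]; exists q.
  rewrite ltr_norml; move: q1 q2; set e := _^-1 => q1 q2.
  by apply/andP; split; lra.
pose c k := projT1 (cid (ch k)).
have Hc k : `|w k - ratr (c k)| < L.+1%:R^-1 := projT2 (cid (ch k)).
exists (L, L, mkseq (fun j => c (j%:Z - L%:Z)) L.*2.+1) => /=.
  by move=> j /=; rewrite nth_mkseq.
move=> w' Hw'; apply: LU => k kL.
have jL : (`|(k + L%:Z)%R|%N < L.*2.+1)%N by lia.
have := Hw' (Ordinal jL); rewrite /= nth_mkseq//.
have -> : Posz `|(k + L%:Z)%R|%N - L%:Z = k by lia.
have := Hc k => h1 h2.
have -> : w' k - w k = (w' k - ratr (c k)) - (w k - ratr (c k)) by ring.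
by apply: le_lt_trans (ler_normB _ _) _; rewrite mulr_natl mulr2n ltrD.
Qed.

Context {d : measure_display} {T : measurableType d}.

Let measurable_into_box (y : T -> int -> R) (p : nat * nat * seq rat) :
  (forall k, measurable_fun setT ((fun t => y t k) : T -> measurableTypeR R)) ->
  measurable (y @^-1` box p).
Proof.
move=> my; rewrite (_ : y @^-1` box p = \bigcap_(j in [set: 'I_(p.1.1.*2.+1)])
  (fun t => `|y t (j%:Z - p.1.1%:Z) - ratr (nth 0 p.2 j)|) @^-1` `]-oo, p.1.2.+1%:R^-1[%classic).
  apply: fin_bigcap_measurable => // j _; rewrite -[X in measurable X]setTI.
  suff mj : measurable_fun setT ((fun t => `|y t (j%:Z - p.1.1%:Z) - ratr (nth 0 p.2 j)|) : T -> measurableTypeR R) by exact: mj.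
  exact: (measurableT_comp (@normr_measurable R setT) (measurable_funB (my _) (measurable_cst _))).
apply/seteqP; split=> t /=.
  by move=> Ht j _; rewrite /= in_itv/=; exact: Ht.
by move=> Ht j; have := Ht j I; rewrite /= in_itv.
Qed.

(** Because the product topology has a countable base, a sequence of
    measurable coordinates is a Borel map, also after reduction mod 1. *)
Lemma measurable_rho (y : T -> int -> R) :
  (forall k, measurable_fun setT ((fun t => y t k) : T -> measurableTypeR R)) ->
  measurable_fun setT ((fun t => rho (y t)) : T -> borel {ptws int -> circle R}).
Proof.
move=> my.
apply: (@measurability _ _ T (borel {ptws int -> circle R}) setT _
  (@open {ptws int -> circle R})) => // _ [U oU <-]; rewrite setTI.
pose V : set {ptws int -> R} := (@rho R : {ptws int -> R} -> {ptws int -> circle R}) @^-1` U.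
have oV : open V.
  apply: open_comp => // w _; apply: continuous_into_ptws => k {}w.
  apply: (@continuous_comp _ _ _ (fun w : {ptws int -> R} => w k) (@mod1 R)).
    exact: (@proj_continuous int (fun=> R) k).
  exact: mod1_continuous.
have -> : (fun t => rho (y t)) @^-1` U =
    \bigcup_(p in [set p | box p `<=` V]) (y @^-1` box p).
  apply/seteqP; split=> t /=.
    by move=> Vy; have [p yp pV] := open_box oV Vy; exists p.
  by move=> [p pV yp]; exact: (pV _ yp).
rewrite bigcup_mkcond; apply: countable_bigcupT_measurable => // p.
by case: ifP => _ //; exact: measurable_into_box.
Qed.

End MeasurableSequences.

(** * The equation [f(sigma) w = delta] *)

Section Factor.
Context {K : comNzRingType}.
Implicit Types (p q : {poly K}) (om : K).

Definition pshift (n : nat) (p : {poly K}) (y : int -> K) (k : int) : K :=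
  \sum_(j < n) p`_j * y (k + j%:Z).

(** Evaluating at the shift turns the factorization [p = q * ('X - om)] into
    a composition of difference operators. *)
Lemma pshift_factor n p q om y k : (size q < n)%N -> p = q * ('X - om%:P) ->
  pshift n p y k = pshift n q y (k + 1) - om * pshift n q y k.
Proof.
case: n => // n; rewrite ltnS => qn ->; rewrite /pshift.
have cE j : (q * ('X - om%:P))`_j = (if j == 0%N then 0 else q`_j.-1) - om * q`_j.
  by rewrite mulrBr coefB coefMX coefMC [_ * om]mulrC.
rewrite (eq_bigr (fun j : 'I_n.+1 => (if j == 0%N :> nat then 0 else q`_j.-1) * y (k + j%:Z)
   - om * (q`_j * y (k + j%:Z)))); last by move=> j _; rewrite cE mulrBl mulrA.
rewrite sumrB -mulr_sumr; congr (_ - _).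
rewrite big_ord_recl/= mul0r add0r [RHS]big_ord_recr/= nth_default// mul0r addr0.
by apply: eq_bigr => j _; rewrite /bump/= add1n -addrA -PoszD add1n.
Qed.

End Factor.

Section Roots.
Context {R : realType}.
Variable f : {poly int}.
Hypothesis fmonic : f \is monic.
Local Notation fC := (@polyC_of R f).

Lemma size_polyC_of : size fC = size f.
Proof.
by rewrite /polyC_of size_map_poly_id0// (monicP fmonic) oner_eq0.
Qed.

Lemma coef_polyC_of j : fC`_j = (f`_j)%:~R.
Proof. by rewrite coef_map_id0. Qed.

Lemma lead_coef_f : ((lead_coef f)%:~R : R[i]) = 1.
Proof. by rewrite (monicP fmonic). Qed.

Definition Omega_seq : seq R[i] := undup (projT1 (closed_field_poly_normal fC)).

Lemma Omega_seqP z : reflect (Omega f z) (z \in Omega_seq).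
Proof.
rewrite mem_undup; case: closed_field_poly_normal => r /= E.
have -> : (z \in r) = root fC z.
  rewrite E rootZ ?root_prod_XsubC// lead_coef_eq0 -size_poly_eq0 size_polyC_of.
  by rewrite size_poly_eq0 monic_neq0.
exact: idP.
Qed.

Lemma fsum_Omega (A : set R[i]) (F : R[i] -> R[i]) : A `<=` Omega f ->
  \sum_(om \in A) F om = \sum_(om <- Omega_seq | om \in A) F om.
Proof.
move=> AO; rewrite (@bigfs _ _ _ _ Omega_seq (fun om => om \in A)) ?undup_uniq//.
  rewrite (_ : [set` _] = A)//; apply/seteqP; split=> om /=; first by move/set_mem.
  by move/mem_set.
by move=> om /set_mem/AO/Omega_seqP ->.
Qed.

Definition cofactor_poly (om : R[i]) : {poly R[i]} := fC %/ ('X - om%:P).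

Lemma cofactorE om : om \in Omega_seq -> fC = cofactor_poly om * ('X - om%:P).
Proof. by move=> /Omega_seqP omf; rewrite divpK// dvdp_XsubCl. Qed.

Lemma size_f_gt0 : (0 < size f)%N.
Proof. by rewrite lt0n size_poly_eq0 monic_neq0. Qed.

Lemma size_cofactor om : (size (cofactor_poly om) < size f)%N.
Proof.
rewrite /cofactor_poly size_divp ?polyXsubC_eq0// size_XsubC size_polyC_of/=.
by rewrite subn1 prednK ?size_f_gt0.
Qed.

Variable b : R[i] -> R[i].
Hypothesis hb : partial_fraction f b.

(** The partial fraction expansion cleared of denominators. *)
Lemma sum_cofactor : \sum_(om <- Omega_seq) b om *: cofactor_poly om = 1.
Proof.
apply/eqP; rewrite -subr_eq0; set P := _ - _; apply: contrapT => /negP P0.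
pose Q := P * fC; have fC0 : fC != 0.
  by rewrite -size_poly_eq0 size_polyC_of size_poly_eq0 monic_neq0.
have Q0 : Q != 0 by rewrite mulf_neq0.
have rQ (u : R[i]) : root Q u.
  rewrite rootM orbC; have [//|nu] := boolP (root fC u); apply/rootP.
  have nO : ~ Omega f u by move=> Ou; case/negP: nu.
  have fu0 : fC.[u] != 0 by [].
  have := hb nO; rewrite lead_coef_f invr1 mul1r (fsum_Omega _ (@subset_refl _ _)).
  have -> : \sum_(om <- Omega_seq | om \in Omega f) b om / (u - om) =
     (\sum_(om <- Omega_seq) b om * (cofactor_poly om).[u]) / fC.[u].
    rewrite mulr_suml big_seq_cond [RHS]big_seq_cond; apply: eq_big => om.
      rewrite andbT; case: (boolP (om \in Omega_seq)) => //= omO.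
      by rewrite mem_set//; exact/Omega_seqP.
    move=> /andP[omO _]; rewrite {1}(cofactorE omO) hornerM !hornerE.
    have uom : u - om != 0.
      by rewrite subr_eq0; apply/eqP => uE; apply: nO; rewrite uE; exact/Omega_seqP.
    have cu : (cofactor_poly om).[u] != 0.
      by move: fu0; rewrite (cofactorE omO) hornerM mulf_eq0 negb_or => /andP[].
    by field; rewrite uom cu.
  rewrite -[LHS]mul1r => /(mulIf (invr_neq0 fu0)) E.
  rewrite /P hornerD hornerN hornerC horner_sum E.
  by apply/eqP; rewrite subr_eq0; apply/eqP; apply: eq_bigr => om _; rewrite hornerZ.
(* a nonzero polynomial does not vanish at [size Q] distinct integers *)
have /(max_poly_roots Q0) : all (root Q) (mkseq (fun n => n%:R) (size Q)).
  by apply/allP => u _; exact: rQ.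
rewrite size_mkseq ltnn => H; apply: notF; apply: H; apply: mkseq_uniq => m n /eqP.
by rewrite eqr_nat => /eqP.
Qed.

(** The solution of [f(sigma) w = delta] whose [S]-modes live on the positive
    side and whose other modes live on the nonpositive side. *)
Definition fundamental (S : set R[i]) (n : int) : R[i] :=
  if 1 <= n then \sum_(om <- Omega_seq | om \in S) b om * om ^ (n - 1)
  else - \sum_(om <- Omega_seq | om \notin S) b om * om ^ (n - 1).

Let mode (S : set R[i]) (om : R[i]) (n : int) : R[i] :=
  if om \in S then (if 1 <= n then om ^ (n - 1) else 0)
  else (if 1 <= n then 0 else - om ^ (n - 1)).

Let fundamentalE S n : fundamental S n = \sum_(om <- Omega_seq) b om * mode S om n.
Proof.
rewrite /fundamental /mode; case: ifP => n1.
  rewrite big_mkcond/=; apply: eq_bigr => om _.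
  by case: ifP; rewrite ?mulr0.
rewrite -sumrN big_mkcond/=; apply: eq_bigr => om _.
by case: (om \in S); rewrite ?mulr0 ?mulrN.
Qed.

Let mode_step S om n : (om \notin S -> om != 0) ->
  mode S om (n + 1) - om * mode S om n = (n == 0)%:R.
Proof.
move=> om0; rewrite /mode addrK; case: ifPn => omS.
  have [n0|n0|->] := ltgtP n 0.
  - have -> : (1 <= n + 1) = false by lia.
    have -> : (1 <= n) = false by lia.
    by rewrite mulr0 subrr.
  - have [m ->] : exists m : nat, n = m.+1%:Z by exists `|n|.-1%N; lia.
    have -> : (1 <= m.+1%:Z + 1) by lia.
    have -> : m.+1%:Z - 1 = m by lia.
    by rewrite /= -exprnP -exprnP exprS subrr.
  - by rewrite add0r lexx /= mulr0 subr0 expr0z.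
have {}om0 := om0 omS.
have step : om * om ^ (n - 1) = om ^ n.
  by rewrite -[X in X * _]expr1z -expfzDr// addrC subrK.
have [n0|n0|n0] := ltgtP n 0.
- have -> : (1 <= n + 1) = false by lia.
  have -> : (1 <= n) = false by lia.
  by rewrite mulrN opprK step addNr.
- have -> : (1 <= n + 1) by lia.
  have -> : (1 <= n) by lia.
  by rewrite mulr0 subrr.
- have -> : (1 <= n + 1) by lia.
  have -> : (1 <= n) = false by lia.
  by rewrite mulrN opprK step n0 add0r expr0z.
Qed.

(** A mode is a geometric progression cut off at 0, which [sigma - om] maps to a
    delta; what remains of [f] is the cofactor of [om], and the weighted
    cofactors sum to 1. *)
Lemma pshift_fundamental S k : (forall om, om \in Omega_seq -> om \notin S -> om != 0) ->
  pshift (size f) fC (fundamental S) k = (k == 0)%:R.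
Proof.
move=> HS.
have -> : pshift (size f) fC (fundamental S) k =
    \sum_(om <- Omega_seq) b om * pshift (size f) fC (mode S om) k.
  rewrite /pshift; under eq_bigr do rewrite fundamentalE mulr_sumr.
  rewrite exchange_big/=; apply: eq_bigr => om _; rewrite mulr_sumr.
  by apply: eq_bigr => j _; rewrite mulrCA.
have -> : \sum_(om <- Omega_seq) b om * pshift (size f) fC (mode S om) k =
    \sum_(om <- Omega_seq) \sum_(i < size f)
      (b om *: cofactor_poly om)`_i * (k + i%:Z == 0)%:R.
  rewrite big_seq [RHS]big_seq; apply: eq_bigr => om omO.
  rewrite (pshift_factor _ _ (size_cofactor om) (cofactorE omO)) /pshift.
  rewrite mulr_sumr -sumrB mulr_sumr; apply: eq_bigr => i _.
  rewrite coefZ -mulrA; congr (_ * _).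
  rewrite -(mode_step (S := S) (om := om)); last exact: HS.
  by rewrite mulrBr mulrCA -[k + i%:Z + 1]addrA [i%:Z + 1]addrC addrA.
rewrite exchange_big/=; under eq_bigr do rewrite -mulr_suml -coef_sum sum_cofactor.
case: (size f) size_f_gt0 => // n _; rewrite big_ord_recl coef1/= mul1r addr0.
by rewrite big1 ?addr0// => i _; rewrite coef1 mul0r.
Qed.

Lemma f_shift_Re (w : int -> R[i]) k :
  f_shift f (fun n => complex.Re (w n)) k = complex.Re (pshift (size f) fC w k).
Proof.
rewrite /f_shift /pshift raddf_sum; apply: eq_bigr => j _.
rewrite coef_polyC_of /zshift -(rmorph_int (real_complex R)).
by case: (w _) => x y; rewrite /= mul0r subr0.
Qed.

Let om0_of (z : R[i]) : 1 <= `|z| -> z != 0.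
Proof. by rewrite -normr_gt0; exact: lt_le_trans. Qed.

Let norm_cases (z : R[i]) : [\/ `|z| < 1, `|z| = 1 | 1 < `|z|].
Proof.
rewrite cnormE -(rmorph1 (real_complex R)) !ltcR.
by have [h|h|h] := ltgtP (cnorm z) 1; [apply: Or31|apply: Or33|rewrite h; apply: Or32].
Qed.

Let in_minus om : om \in Omega_seq -> (om \in Omega_minus f) = (`|om| < 1).
Proof.
by move=> /Omega_seqP O; apply/idP/idP; [move=> /set_mem[]|move=> ?; apply/mem_set].
Qed.

Let in_minus_zero om : om \in Omega_seq ->
  (om \in Omega_minus f `|` Omega_zero f) = (`|om| <= 1).
Proof.
move=> /Omega_seqP O; apply/idP/idP.
  by move=> /set_mem[[_ /ltW]|[_ ->]].
by rewrite le_eqVlt => /orP[/eqP h|h]; apply/mem_set; [right|left].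
Qed.

Lemma w_Delta_plusE n : w_Delta_plus f b n = complex.Re (fundamental (Omega_minus f) n).
Proof.
rewrite /w_Delta_plus /fundamental /exp_sum lead_coef_f invr1 !mul1r.
have sm : @Omega_minus R f `<=` Omega f by move=> z [].
have sp : @Omega_zero R f `|` Omega_plus f `<=` Omega f by move=> z [[]|[]].
rewrite (fsum_Omega _ sm) (fsum_Omega _ sp); congr complex.Re.
case: ifP => // _; congr (- _); rewrite big_seq_cond [RHS]big_seq_cond.
apply: eq_bigl => om; case: (boolP (om \in Omega_seq)) => //= omO.
rewrite (in_minus omO); apply/idP/idP.
  by move=> /set_mem[[_ ->]|[_ h]]; rewrite ?ltxx// lt_gtF.
by case: (norm_cases om) => h; rewrite ?h// => _; apply/mem_set; [left|right]; split=> //; exact/Omega_seqP.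
Qed.

Lemma w_Delta_minusE n : w_Delta_minus f b n =
  complex.Re (fundamental (Omega_minus f `|` Omega_zero f) n).
Proof.
rewrite /w_Delta_minus /fundamental /exp_sum lead_coef_f invr1 !mul1r.
have sm : @Omega_minus R f `|` Omega_zero f `<=` Omega f by move=> z [[]|[]].
have sp : @Omega_plus R f `<=` Omega f by move=> z [].
rewrite (fsum_Omega _ sm) (fsum_Omega _ sp); congr complex.Re.
case: ifP => // _; congr (- _); rewrite big_seq_cond [RHS]big_seq_cond.
apply: eq_bigl => om; case: (boolP (om \in Omega_seq)) => //= omO.
rewrite (in_minus_zero omO); apply/idP/idP.
  by move=> /set_mem[_ h]; rewrite lt_geF.
case: (norm_cases om) => h; rewrite ?(ltW h) ?h ?lexx// => _.
by apply/mem_set; split=> //; exact/Omega_seqP.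
Qed.

Lemma f_shift_w_Delta_plus k : f_shift f (w_Delta_plus f b) k = (k == 0)%:R.
Proof.
rewrite (_ : w_Delta_plus f b = fun n => complex.Re (fundamental (Omega_minus f) n)); last first.
  by apply/funext => n; exact: w_Delta_plusE.
rewrite f_shift_Re pshift_fundamental; first by case: eqP.
move=> om omO; rewrite (in_minus omO) => h; apply: om0_of.
by case: (norm_cases om) h => [->|->|/ltW].
Qed.

Lemma f_shift_w_Delta_minus k : f_shift f (w_Delta_minus f b) k = (k == 0)%:R.
Proof.
rewrite (_ : w_Delta_minus f b =
    fun n => complex.Re (fundamental (Omega_minus f `|` Omega_zero f) n)); last first.
  by apply/funext => n; exact: w_Delta_minusE.
rewrite f_shift_Re pshift_fundamental; first by case: eqP.
move=> om omO; rewrite (in_minus_zero omO) => h; apply: om0_of.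
by case: (norm_cases om) h => [/ltW->|->|/ltW]; rewrite ?lexx.
Qed.

End Roots.

(** * The map [xi_bar]: convergence, equation, growth *)

Lemma cvg_sumr (R : realType) (I : Type) (r : seq I) (F : I -> nat -> R) (L : I -> R) :
  (forall i, F i @ \oo --> L i) ->
  (fun N => \sum_(i <- r) F i N) @ \oo --> \sum_(i <- r) L i.
Proof.
move=> FL; elim: r => [|i r IH].
  by rewrite big_nil; under eq_fun do rewrite big_nil; exact: cvg_cst.
by rewrite big_cons; under eq_fun do rewrite big_cons; exact: cvgD.
Qed.

Section XiBar.
Context {R : realType}.
Variables (f : {poly int}) (b : R[i] -> R[i]).
Hypotheses (fmonic : f \is monic) (hb : partial_fraction f b).
Variable beta : R.
Hypothesis beta1 : 1 < beta.

Let norm_lt1 (z : R[i]) : (`|z| < 1) = (cnorm z < 1).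
Proof. by rewrite cnormE -(rmorph1 (real_complex R)) ltcR. Qed.

(** There are finitely many roots, so those off the unit circle stay away from
    it; the gap may be taken as small as wanted. *)
Lemma spectral_gap : exists gam : R, [/\ 1 < gam, gam < beta &
  forall om, om \in Omega_seq f -> (cnorm om < 1 -> cnorm om <= gam^-1) /\
    (1 < cnorm om -> gam <= cnorm om)].
Proof.
elim: (Omega_seq f) => [|om s [g [g1 gb Hg]]].
  by exists ((1 + beta) / 2); split=> [||om]; rewrite ?in_nil ?midf_lt.
have [g' [g'1 Hg']] : exists g', 1 < g' /\
    ((cnorm om < 1 -> cnorm om <= g'^-1) /\ (1 < cnorm om -> g' <= cnorm om)).
  have [h|h|h] := ltgtP (cnorm om) 1.
  - have [->|n0] := eqVneq (cnorm om) 0; first by exists 2; split; [by rewrite ltr1n|split => //; rewrite invr_ge0 ler0n].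
    exists (cnorm om)^-1; rewrite invf_gt1 ?invrK//.
    by rewrite lt0r n0 cnorm_ge0.
  - by exists (cnorm om); split.
  - by exists 2; split; [by rewrite ltr1n|split].
exists (Num.min g g'); rewrite lt_min g1 g'1 gt_min gb; split => // om'.
have m0 : 0 < Num.min g g' by rewrite lt_min !(lt_trans ltr01).
rewrite inE => /orP[/eqP ->|/Hg[h1 h2]].
  split=> h; last by rewrite ge_min (Hg'.2 h) orbT.
  apply: le_trans (Hg'.1 h) _; rewrite lef_pV2 ?posrE ?ge_min ?lexx ?orbT//.
  exact: lt_trans g'1.
split=> h; last by rewrite ge_min (h2 h).
apply: le_trans (h1 h) _; rewrite lef_pV2 ?posrE ?ge_min ?lexx//.
exact: lt_trans g1.
Qed.

Let cnormXz (z : R[i]) (n : int) : cnorm (z ^ n) = cnorm z ^ n.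
Proof. by case: n => n; rewrite /exprz ?cnormV cnormX. Qed.

(** The neutral modes, bounded on one half-line, count as growing by [gam]
    there; on the other half-line, the one over which [xi_bar] sums, each of the
    two sequences decays. *)
Lemma w_Delta_bounds (gam : R) : 1 < gam ->
  (forall om, om \in Omega_seq f -> (cnorm om < 1 -> cnorm om <= gam^-1) /\
    (1 < cnorm om -> gam <= cnorm om)) ->
  exists2 C : R, 0 <= C & forall n,
    `|w_Delta_minus f b n| <= C * gam ^ n /\ `|w_Delta_plus f b n| <= C * gam ^ (- n).
Proof.
move=> g1 Hg; have g0 : 0 < gam by exact: lt_trans g1.
have gN0 : gam != 0 by rewrite gt_eqF.
pose B := \sum_(om <- Omega_seq f) cnorm (b om).
have B0 : 0 <= B by apply: sumr_ge0 => om _; exact: cnorm_ge0.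
exists (B * gam); first by rewrite mulr_ge0// ltW.
have sumB (P : pred R[i]) n (c : R) : 0 <= c ->
    (forall om, om \in Omega_seq f -> P om -> cnorm om ^ (n - 1) <= c) ->
    cnorm (\sum_(om <- Omega_seq f | P om) b om * om ^ (n - 1)) <= B * c.
  move=> c0 Hc; apply: le_trans (cnorm_sum _ _ _) _.
  rewrite /B mulr_suml big_seq_cond [leRHS]big_seq_cond [leRHS](bigID P)/=.
  apply: ler_wpDr.
    by apply: sumr_ge0 => om _; rewrite mulr_ge0 ?cnorm_ge0.
  rewrite [leRHS](eq_bigl (fun om => (om \in Omega_seq f) && P om)); last first.
    by move=> om; rewrite andbT.
  apply: ler_sum => om /andP[omO Pom].
  by rewrite cnormM cnormXz ler_wpM2l ?cnorm_ge0 ?Hc.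
have gz n : 0 <= gam ^ n by exact/ltW/exprz_gt0.
have g1z n : 0 <= n -> 1 <= gam ^ n.
  by move=> n0; rewrite -[leLHS](expr0z gam) ler_weXz2l// ltW.
have inO (om : R[i]) (S : set R[i]) : om \in S -> S om by move/set_mem.
have mi (om : R[i]) : om \in Omega_seq f -> om \notin Omega_minus f -> 1 <= cnorm om.
  move=> /(Omega_seqP fmonic) O nm; rewrite leNgt; apply/negP => h.
  by move/negP: nm; apply; apply/mem_set; split => //; rewrite norm_lt1.
have mz (om : R[i]) : om \in Omega_seq f -> om \notin Omega_minus f `|` Omega_zero f -> 1 < cnorm om.
  move=> /(Omega_seqP fmonic) O nm; rewrite ltNge le_eqVlt; apply/negP => /orP[/eqP h|h].
    move/negP: nm; apply; apply/mem_set; right; split => //.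
    by rewrite cnormE h.
  by move/negP: nm; apply; apply/mem_set; left; split => //; rewrite norm_lt1.
move=> n; split.
  rewrite w_Delta_minusE//; apply: le_trans (Re_le_cnorm _) _.
  rewrite /fundamental -mulrA -[X in X * gam ^ n]expr1z -expfzDr//; case: ifPn => n1.
    apply: sumB => // om omO /inO omS.
    have om1 : cnorm om <= 1.
      case: omS => -[_]; first by rewrite norm_lt1 => /ltW.
      by rewrite cnormE -(rmorph1 (real_complex R)) => /complexI ->.
    apply: le_trans (g1z _ _); last by lia.
    by rewrite -[leRHS](exp1rz _ (n - 1)) ler_wpXz2r ?nnegrE ?cnorm_ge0//; lia.
  rewrite cnormN; apply: sumB => // om omO /(mz om omO) om1.
  have := (Hg om omO).2 om1 => gom.
  apply: (@le_trans _ _ (gam ^ (n - 1))).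
    by apply: ler_wnXz2r => //; [lia|rewrite posrE (lt_trans _ om1)].
  by apply: ler_weXz2l; [exact: ltW|lia].
rewrite w_Delta_plusE//; apply: le_trans (Re_le_cnorm _) _.
rewrite /fundamental -mulrA -[X in X * gam ^ (- n)]expr1z -expfzDr//; case: ifPn => n1.
  apply: sumB => // om omO /inO[_]; rewrite norm_lt1 => om1.
  have := (Hg om omO).1 om1 => gom.
  have -> : 1 - n = - (n - 1) by lia.
  rewrite -exprz_inv; apply: ler_wpXz2r => //; first by lia.
    by rewrite nnegrE cnorm_ge0.
  by rewrite nnegrE invr_ge0 ltW.
rewrite cnormN; apply: sumB => // om omO /(mi om omO) om1.
apply: le_trans (g1z _ _); last by lia.
rewrite -[leRHS](exp1rz _ (n - 1)); by apply: ler_wnXz2r => //; [lia|rewrite posrE (lt_le_trans _ om1)|rewrite posrE].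
Qed.

Lemma dominated_series (u : nat -> R) (A g : R) : 0 <= g < 1 ->
  (forall n, `|u n| <= A * g ^+ n) ->
  cvgn (series u) /\ `|limn (series u)| <= A / (1 - g).
Proof.
move=> /andP[g0 g1] Hu.
have ng : `|g| < 1 by rewrite ger0_norm.
have cg := @cvg_geometric_series R A g ng.
have dom n : [normed series u] n <= series (geometric A g) n.
  by rewrite /series/=; apply: ler_sum => i _.
have cn : cvgn [normed series u].
  apply: (@series_le_cvg _ (fun n => `|u n|) (geometric A g)) => //.
  - by move=> n; exact: le_trans (Hu n).
  - by apply/cvg_ex; exists (A / (1 - g)).
have cu := normed_cvg cn; split => //.
apply: le_trans (lim_series_norm cn) _.
by rewrite -(cvg_lim _ cg)//; apply: ler_lim => //; [apply/cvg_ex; eexists; exact: cg|exact: nearW].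
Qed.

Definition xi_left (v : linfZ) (k : int) (n : nat) : R :=
  (v n%:Z)%:~R * w_Delta_minus f b (k - n%:Z).

Definition xi_right (v : linfZ) (k : int) (n : nat) : R :=
  if n == 0%N then 0 else (v (- n%:Z))%:~R * w_Delta_plus f b (k + n%:Z).

Lemma xi_barE v k : xi_bar f b v k =
  limn (series (xi_left v k)) + limn (series (xi_right v k)).
Proof.
congr (_ + limn _); apply/funext => -[|N]; rewrite /series/=; first by rewrite !big_geq.
rewrite [in RHS]big_ltn//= add0r; apply: eq_big_nat => i /andP[i0 _].
by rewrite /xi_right gtn_eqF.
Qed.

(** Both halves of [xi_bar v k] are dominated by geometric series, uniformly
    up to a factor that grows more slowly than [beta ^ k]. *)
Lemma xi_bounds (v : linfZ) : exists K g : R, [/\ 0 <= K, 1 < g, g < beta &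
  forall k, [/\ cvgn (series (xi_left v k)), cvgn (series (xi_right v k)),
    `|limn (series (xi_left v k))| <= K * g ^ k &
    `|limn (series (xi_right v k))| <= K * g ^ (- k)]].
Proof.
have [M HM] : linfZ_set v by exact: set_valP.
have [g [g1 gb Hg]] := spectral_gap.
have [C C0 HC] := w_Delta_bounds g1 Hg.
have g0 : 0 < g by exact: lt_trans g1.
have gN0 : g != 0 by rewrite gt_eqF.
have M0 : 0 <= M by apply: le_trans (HM 0).
have Mv k : `|(v k)%:~R| <= M%:~R :> R by rewrite -intr_norm ler_int; exact: HM.
have gV : 0 <= g^-1 < 1 by rewrite invr_ge0 invf_lt1// ltW.
have gV1 : 0 < 1 - g^-1 by rewrite subr_gt0; case/andP: gV.
exists (M%:~R * C / (1 - g^-1)), g; split => //.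
  by rewrite mulr_ge0 ?invr_ge0 ?mulr_ge0 ?ler0z// ltW.
move=> k.
have dl n : `|xi_left v k n| <= (M%:~R * C * g ^ k) * g^-1 ^+ n.
  rewrite normrM -!mulrA; apply: ler_pM => //.
  apply: le_trans (HC _).1 _; rewrite expfzDr// exprVn exprnN.
  by [].
have dr n : `|xi_right v k n| <= (M%:~R * C * g ^ (- k)) * g^-1 ^+ n.
  rewrite /xi_right; case: eqP => [_|_].
    by rewrite normr0 !mulr_ge0 ?ler0z ?exprn_ge0 ?invr_ge0 ?(ltW g0)// exprz_ge0// ltW.
  rewrite normrM -!mulrA; apply: ler_pM => //.
  by apply: le_trans (HC _).2 _; rewrite opprD expfzDr// exprVn exprnN.
have [c1 l1] := dominated_series gV dl; have [c2 l2] := dominated_series gV dr.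
split => //.
  by rewrite mulrAC.
by rewrite mulrAC.
Qed.

Lemma xi_bar_growth (v : linfZ) : exists K g : R, [/\ 0 <= K, 1 < g, g < beta &
  forall k : nat, `|xi_bar f b v k%:Z| <= K * g ^+ k].
Proof.
have [K [g [K0 g1 gb H]]] := xi_bounds v.
exists (K + K), g; split => //; first exact: addr_ge0.
move=> k; have [_ _ h1 h2] := H k%:Z; rewrite xi_barE mulrDl.
apply: le_trans (ler_normD _ _) _; apply: lerD; first exact: h1.
apply: le_trans h2 _; rewrite ler_wpM2l//.
by rewrite -[X in _ <= X]/(g ^ k%:Z); apply: ler_weXz2l; [exact: ltW|lia].
Qed.

(** [f(sigma)] acts termwise on the two series and maps each translate of
    [w_Delta] to a translate of delta. *)
Lemma f_shift_xi_bar (v : linfZ) k : f_shift f (xi_bar f b v) k = (v k)%:~R.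
Proof.
have [K [g [_ _ _ H]]] := xi_bounds v.
pose S (N : nat) (k : int) := series (xi_left v k) N + series (xi_right v k) N.
have SE N : f_shift f (S N) k = (\sum_(0 <= n < N) (v n%:Z)%:~R * (k - n%:Z == 0)%:R) +
    (\sum_(0 <= n < N) (if n == 0%N then 0 else (v (- n%:Z))%:~R * (k + n%:Z == 0)%:R)).
  rewrite /f_shift /zshift /S; under eq_bigr do rewrite mulrDr.
  rewrite big_split/=; congr (_ + _).
    under eq_bigr do rewrite /series/= mulr_sumr.
    rewrite exchange_big/=; apply: eq_bigr => n _.
    rewrite -(f_shift_w_Delta_minus fmonic hb) /f_shift mulr_sumr.
    by apply: eq_bigr => j _; rewrite /xi_left /zshift mulrCA addrAC.
  under eq_bigr do rewrite /series/= mulr_sumr.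
  rewrite exchange_big/=; apply: eq_bigr => n _.
  case: eqP => [->|n0]; first by rewrite big1// => j _; rewrite /xi_right mulr0.
  rewrite -(f_shift_w_Delta_plus fmonic hb) /f_shift mulr_sumr.
  apply: eq_bigr => j _; rewrite /xi_right /zshift mulrCA addrAC.
  by case: eqP n0.
have cS : (fun N => f_shift f (S N) k) @ \oo --> f_shift f (xi_bar f b v) k.
  rewrite /f_shift; apply: cvg_sumr => j.
  apply: cvgMr; rewrite /zshift xi_barE.
  by have [c1 c2 _ _] := H (k + j%:Z); exact: cvgD.
have cS' : (fun N => f_shift f (S N) k) @ \oo --> ((v k)%:~R : R).
  apply: cvg_near_cst; near=> N.
  have Nk : (`|k| < N)%N by near: N; exact: nbhs_infty_gt.
  rewrite SE; have [k0|k0] := leP 0 k.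
    rewrite (bigD1_seq `|k|%N) ?iota_uniq ?mem_index_iota//=.
    have -> : k - `|k|%N%:Z == 0 by lia.
    rewrite mulr1 big1; last by move=> n nk; rewrite (_ : (_ == 0) = false) ?mulr0//; lia.
    rewrite addr0 big1 ?addr0; last first.
      by move=> n _; case: eqP => // n0; rewrite (_ : (_ == 0) = false) ?mulr0//; lia.
    by congr (v _)%:~R; lia.
  rewrite big1 ?add0r; last first.
    by move=> n _; rewrite (_ : (_ == 0) = false) ?mulr0//; lia.
  rewrite (bigD1_seq `|k|%N) ?iota_uniq ?mem_index_iota//=.
  have -> : (`|k|%N == 0%N) = false by lia.
  have -> : k + `|k|%N%:Z == 0 by lia.
  rewrite mulr1 big1 ?addr0.
    by congr (v _)%:~R; lia.
  by move=> n nk; case: eqP => // n0; rewrite (_ : (_ == 0) = false) ?mulr0//; lia.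
exact: (cvg_unique _ cS cS').
Unshelve. all: by end_near. Qed.

Lemma measurable_xi_bar k :
  measurable_fun [set: borel linfZ] ((fun v => xi_bar f b v k) : borel linfZ -> measurableTypeR R).
Proof.
apply: (@measurable_fun_cvg _ (borel linfZ) R setT
  (fun N v => series (xi_left v k) N + series (xi_right v k) N)).
  move=> N; apply: measurable_funD; rewrite /series/=; apply: measurable_sum => n.
    exact: (@measurable_coord R n%:Z (fun m => m%:~R * w_Delta_minus f b (k - n%:Z))).
  rewrite /xi_right; case: eqP => _; first exact: measurable_cst.
  exact: (@measurable_coord R (- n%:Z) (fun m => m%:~R * w_Delta_plus f b (k + n%:Z))).
move=> v _; have [K [g [_ _ _ H]]] := xi_bounds v.
by have [c1 c2 _ _] := H k; rewrite xi_barE; exact: cvgD.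
Qed.

End XiBar.

(** * The equivariant lift *)

Section Shift.

Lemma linfZ_ext (v v' : linfZ) : (forall k, v k = v' k) -> v = v'.
Proof. by move=> e; apply: val_inj; apply/funext => k; exact: e. Qed.

Lemma linfZ_shiftE n (v : linfZ) k : linfZ_shift n v k = v (k + n).
Proof. by []. Qed.

Lemma linfZ_shiftD m n v : linfZ_shift m (linfZ_shift n v) = linfZ_shift (m + n) v.
Proof. by apply: linfZ_ext => k; rewrite !linfZ_shiftE addrA. Qed.

Lemma linfZ_shift0 v : linfZ_shift 0 v = v.
Proof. by apply: linfZ_ext => k; rewrite linfZ_shiftE addr0. Qed.

Lemma iter_linfZ_shift m n v : iter n (linfZ_shift m) v = linfZ_shift (m *+ n) v.
Proof.
elim: n => [|n IH]; first by rewrite mulr0n linfZ_shift0.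
by rewrite iterS IH linfZ_shiftD mulrS.
Qed.

Lemma measurable_linfZ_shift n :
  measurable_fun [set: borel linfZ] (linfZ_shift n : borel linfZ -> borel linfZ).
Proof.
apply: (@measurability _ _ (borel linfZ) (borel linfZ) setT _ (@open linfZ)) => //.
move=> _ [U oU <-]; rewrite setTI; have [B [wB _ ->]] := open_bigcup_window oU.
rewrite preimage_bigcup; apply: bigcupT_measurable => L.
apply: (@measurable_window (L + `|n|)%N) => v v' vv'; apply: (wB L) => k kL.
by rewrite !linfZ_shiftE; apply: vv'; lia.
Qed.

Context {R : realType} (nu : probability (borel linfZ) R).
Hypothesis inv : invariant_measure nu (linfZ_shift 1).

Lemma invariant_linfZ_shift (n : int) : invariant_measure nu (linfZ_shift n).
Proof.
have pos (m : nat) : invariant_measure nu (linfZ_shift m).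
  rewrite (_ : linfZ_shift m = iter m (linfZ_shift 1)).
    exact: invariant_iter (measurable_linfZ_shift 1) inv.
  by apply/funext => v; rewrite iter_linfZ_shift; congr linfZ_shift; rewrite -mulr_natr mul1r natz.
case: n => // m A mA; set n := Negz m.
rewrite -(pos m.+1); last first.
  by rewrite -[X in measurable X]setTI; exact: measurable_linfZ_shift.
congr (nu _); apply/seteqP; split=> v /=;
  by rewrite linfZ_shiftD (_ : n + _ = 0) ?linfZ_shift0//; rewrite /n; lia.
Qed.

(** The shifts are countably many and preserve null sets. *)
Lemma orbit_core (A : set (borel linfZ)) : measurable A -> nu A = 1%E ->
  let A' := [set v : linfZ | forall n, A (linfZ_shift n v)] in
  measurable (A' : set (borel linfZ)) /\ nu A' = 1%E.
Proof.
move=> mA A1 A'.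
have mC : measurable (~` A) by exact: measurableC.
have C0 : nu (~` A) = 0%E by rewrite probability_setC// A1 subee.
pose e (i : nat) : int := odflt 0 (unpickle i).
have A'E : ~` A' = \bigcup_i linfZ_shift (e i) @^-1` (~` A).
  apply/seteqP; split=> v.
    move=> /existsNP[n nA]; exists (pickle n) => //=.
    by rewrite /e pickleK.
  by move=> [i _ /= nA] /(_ (e i)).
have mi i : measurable (linfZ_shift (e i) @^-1` (~` A) : set (borel linfZ)).
  by rewrite -[X in measurable X]setTI; exact: measurable_linfZ_shift.
have mA' : measurable (A' : set (borel linfZ)).
  by rewrite -[A']setCK; apply: measurableC; rewrite A'E; exact: bigcupT_measurable.
split => //.
have A'0 : nu (~` A') = 0%E.
  rewrite A'E; apply: measure_negligible; first exact: bigcupT_measurable.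
  apply: negligible_bigcup => i; exists (linfZ_shift (e i) @^-1` (~` A)); split => //.
  exact: etrans (invariant_linfZ_shift (e i) mC) C0.
have := probability_setC nu (measurableC mA'); rewrite setCK A'0 sube0.
exact.
Qed.

End Shift.

Section Lift.
Context {R : realType}.
Variables (f : {poly int}) (om : R[i] -> R[i]).
Variables (nu : probability (borel linfZ) R) (b : linfZ -> {ptws int -> R}).
Hypotheses (fmonic : f \is monic) (hom : partial_fraction f om)
  (inv : invariant_measure nu (linfZ_shift 1))
  (bW : forall v, Wf0 f (b v))
  (bborel : measurable_fun [set: borel linfZ]
     (b : borel linfZ -> borel {ptws int -> R}))
  (bcob : {ae nu, forall v : linfZ, cocycle_d f om 1 v =
     (fun n => b (linfZ_shift 1 v) n - zshift 1 (b v) n)}).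

Let one_lt2 : 1 < 2 :> R. Proof. by rewrite ltr1n. Qed.

(** The real representative of [xi_star_b v] that commutes with the shift almost
    everywhere and solves [f(sigma) y = v]. *)
Definition lift (v : linfZ) (k : int) : R := xi_bar f om v k + b v k.

Lemma xi_star_bE v : xi_star_b f om b v = rho (lift v).
Proof.
by apply/funext => k; rewrite /xi_star_b /xi_star /rho -mod1D.
Qed.

Lemma f_shift_lift v k : f_shift f (lift v) k = (v k)%:~R.
Proof.
rewrite -(f_shift_xi_bar fmonic hom one_lt2) /f_shift /zshift /lift.
under eq_bigr do rewrite mulrDr.
rewrite big_split/= -[RHS]addr0; congr (_ + _).
by have [_ /(_ k)] := bW v.
Qed.

Lemma measurable_lift k :
  measurable_fun [set: borel linfZ] ((fun v => lift v k) : borel linfZ -> measurableTypeR R).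
Proof.
have mx := measurable_xi_bar om fmonic one_lt2 k.
have mk := measurableT_comp (@measurable_proj R k) bborel.
have mb : measurable_fun [set: borel linfZ]
    ((fun v => b v k) : borel linfZ -> measurableTypeR R).
  exact: (measurableT_comp (@measurable_borel_real R) mk).
exact: (measurable_funD mx mb).
Qed.

Lemma Xset_rho_lift v : Xset f (rho (lift v)).
Proof.
move=> k; rewrite /rho (mod1_sumz _ (fun j : 'I_(size f) => lift v (k + j%:Z)) (fun j => f`_j)).
apply/mod1_eq0; have := f_shift_lift v k; rewrite /f_shift => ->.
exact: intr_int.
Qed.

Lemma lift_shift : {ae nu, forall v : linfZ,
  lift (linfZ_shift 1 v) = zshift 1 (lift v)}.
Proof.
case: bcob => N [mN N0 sub]; exists N; split => //; apply: subset_trans sub.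
move=> v nP /= e; apply: nP; apply/funext => k; have := congr1 (fun g => g k) e; rewrite /cocycle_d /lift /zshift; lra.
Qed.

Definition equivariant_set : set linfZ :=
  [set v | forall n k, lift (linfZ_shift n v) k = lift v (k + n)].

(** Equivariance at time 1 along a whole orbit gives equivariance at all times,
    and [orbit_core] provides almost every orbit. *)
Lemma equivariant_set_full (V : set (borel linfZ)) : measurable V -> nu V = 1%E ->
  exists V0 : set (borel linfZ), [/\ measurable V0, nu V0 = 1%E,
    V0 `<=` equivariant_set & V0 `<=` V].
Proof.
move=> mV V1.
have mS := measurable_linfZ_shift 1.
pose E1 : set (borel linfZ) := [set v : linfZ | lift (linfZ_shift 1 v) = zshift 1 (lift v)].
pose e (i : nat) : int := odflt 0 (unpickle i).
have mE1 : measurable E1.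
  have -> : E1 = \bigcap_i (fun v => lift (linfZ_shift 1 v) (e i) - lift v (e i + 1)) @^-1` [set 0].
    apply/seteqP; split=> v.
      by move=> Ev i _ /=; rewrite Ev /zshift subrr.
    move=> Hv; apply/funext => k; have := Hv (pickle k) I.
    by rewrite /= /e pickleK/= => /eqP; rewrite subr_eq0 => /eqP.
  apply: bigcapT_measurable => i; rewrite -[X in measurable X]setTI.
  have m1 := measurableT_comp (measurable_lift (e i)) mS.
  have m2 := measurable_funB m1 (measurable_lift (e i + 1)).
  by apply: m2 => //; exact: measurable_set1.
have E11 : nu E1 = 1%E.
  have C0 : nu (~` E1) = 0%E.
    apply: measure_negligible; first exact: measurableC.
    exact: lift_shift.
  by have := probability_setC nu (measurableC mE1); rewrite setCK C0 sube0.
have mEV : measurable (E1 `&` V) by exact: measurableI.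
have EV1 : nu (E1 `&` V) = 1%E by rewrite (measure_full_setI mV V1 mE1).
have [mC C1] := orbit_core inv mEV EV1.
exists [set v : linfZ | forall n, (E1 `&` V) (linfZ_shift n v)]; split => //.
- move=> v Hv.
  have E n : lift (linfZ_shift (1 + n) v) = zshift 1 (lift (linfZ_shift n v)).
    by have [] := Hv n; rewrite /E1/= linfZ_shiftD.
  have pos (m : nat) (w : linfZ) : (forall n, E1 (linfZ_shift n w)) ->
      forall k, lift (linfZ_shift m w) k = lift w (k + m%:Z).
    move=> Ew; elim: m => [|m IH] k; first by rewrite linfZ_shift0 addr0.
    have := Ew m; rewrite /E1/= linfZ_shiftD => e1.
    rewrite (_ : m.+1%:Z = 1 + m%:Z)// e1 /zshift IH.
    by congr lift; lia.
  move=> n k; have [m [->|->]] : exists m : nat, n = m%:Z \/ n = - m%:Z.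
    by exists `|n|%N; lia.
    by apply: pos => j; case: (Hv j).
  have := pos m (linfZ_shift (- m%:Z) v).
  rewrite linfZ_shiftD subrr linfZ_shift0 => -> //; last first.
    by move=> j; rewrite linfZ_shiftD; case: (Hv (j - m%:Z)).
  by congr lift; lia.
- by move=> v /(_ 0)[_]; rewrite linfZ_shift0.
Qed.

End Lift.

(** * The two-sided beta-shift and the expanding coordinate of the lift *)

Section BetaShift.
Context {R : realType}.
Variable beta : R.
Hypothesis beta1 : 1 < beta.
Local Notation dig := (digit beta).

Lemma near_prefix (u : {ptws nat -> R}) N :
  nbhs u [set w : nat -> R | forall j, (j < N)%N -> `|w j - u j| < 1].
Proof.
elim: N => [|N IH]; first by apply: (@filterE _ _ (nbhs_filter u)) => w j; rewrite ltn0.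
have hN : nbhs u [set w : nat -> R | `|w N - u N| < 1].
  have B1 : nbhs (u N) [set x : R | `|x - u N| < 1].
    by apply/nbhs_ballP; exists 1 => //= x; rewrite /ball/= distrC.
  exact: (@proj_continuous nat (fun=> R) N u _ B1).
apply: (@filterS _ _ (nbhs_filter u) _ _ _ (@filterI _ _ (nbhs_filter u) _ _ IH hN)) => w [h1 h2] j; rewrite ltnS leq_eqVlt.
by move=> /orP[/eqP ->|/h1].
Qed.

(** Integer sequences that are coordinatewise within distance less than 1 are
    equal, so approximation amounts to agreement on prefixes. *)
Lemma V_beta_plusP (u : nat -> int) :
  V_beta_plus beta (fun k => (u k)%:~R) <->
  forall N, exists2 x, unit_real x & forall j, (j < N)%N -> dig x j = u j.
Proof.
split=> [Vu N|H B nB].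
  have [_ [[x x01 <-] /= xu]] := Vu _ (near_prefix (fun k => (u k)%:~R) N).
  exists x; first by move: x01; rewrite /= in_itv.
  move=> j jN; have := xu j jN.
  rewrite e_betaE -intrB -intr_norm -[1 in X in X -> _]/(1%:~R) ltr_int.
  by lia.
have ch N : {x | unit_real x & forall j, (j < N)%N -> dig x j = u j}.
  by apply: cid2; exact: H.
pose x N := s2val (ch N).
have cx : (fun N => e_beta beta (x N) : {ptws nat -> R}) @ \oo --> ((fun k => (u k)%:~R) : {ptws nat -> R}).
  apply: ptws_cvg => k.
  have ck : (fun N => e_beta beta (x N) k) @ \oo --> ((u k)%:~R : R).
    apply: cvg_near_cst; near=> N.
    rewrite e_betaE (s2valP' (ch N))//.
    by near: N; exact: nbhs_infty_gt.
  exact: ck.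
have /filter_ex[N BN] : \forall N \near \oo, B (e_beta beta (x N)) by exact: (cx B nB).
exists (e_beta beta (x N)); split => //; exists (x N) => //=.
by rewrite in_itv/=; exact: (s2valP (ch N)).
Unshelve. all: by end_near. Qed.

Lemma V_betaP (v : linfZ) : V_beta beta v <->
  forall (n : int) N, exists2 x, unit_real x & forall j, (j < N)%N -> dig x j = v (n + j.+1%:Z).
Proof.
split=> H n; last by apply/(V_beta_plusP (fun k => v (n + k.+1%:Z))); exact: H.
by move=> N; have /(V_beta_plusP (fun k => v (n + k.+1%:Z))) := H n; apply.
Qed.

Lemma measurable_V_beta : measurable (V_beta beta : set (borel linfZ)).
Proof.
pose e (i : nat) : int := odflt 0 (unpickle i).
have -> : V_beta beta = \bigcap_i \bigcap_N [set v : linfZ |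
    exists2 x, unit_real x & forall j, (j < N)%N -> dig x j = v (e i + j.+1%:Z)].
  apply/seteqP; split=> v.
    by move=> /V_betaP H i _ N _; exact: H.
  move=> H; apply/V_betaP => n N; have := H (pickle n) I N I.
  by rewrite /e pickleK.
apply: bigcapT_measurable => i; apply: bigcapT_measurable => N.
apply: (@measurable_window (`|e i| + N).+2) => v v' vv' [x x01 Hx]; exists x => // j jN.
by rewrite Hx//; apply: vv'; lia.
Qed.

Lemma V_beta_shift v n : V_beta beta v -> V_beta beta (linfZ_shift n v).
Proof.
move=> /V_betaP H; apply/V_betaP => k N; have [x x01 Hx] := H (k + n) N.
by exists x => // j jN; rewrite Hx// linfZ_shiftE addrAC.
Qed.

Variable f : {poly int}.
Hypotheses (fmonic : f \is monic) (fbeta : root (map_poly intr f) beta).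

Definition expanding_poly : {poly R} := map_poly intr f %/ ('X - beta%:P).
Local Notation q := expanding_poly.

Lemma size_map_intr : size (map_poly intr f : {poly R}) = size f.
Proof. by rewrite size_map_poly_id0// (monicP fmonic) oner_eq0. Qed.

Lemma expanding_polyE : map_poly intr f = q * ('X - beta%:P).
Proof. by rewrite divpK// dvdp_XsubCl. Qed.

Lemma size_expanding_poly : (size q < size f)%N.
Proof.
rewrite size_divp ?polyXsubC_eq0// size_XsubC size_map_intr subn1 prednK//.
by rewrite lt0n size_poly_eq0 monic_neq0.
Qed.

(** The factorization [f = q * ('X - beta)] makes this coordinate expand by the
    factor [beta] at each shift, up to the digit. *)
Definition expanding (y : int -> R) (k : int) : R := pshift (size f) q y k.

Lemma expanding_step y k : expanding y (k + 1) = beta * expanding y k + f_shift f y k.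
Proof.
have -> : f_shift f y k = pshift (size f) (map_poly intr f) y k.
  by apply: eq_bigr => j _; rewrite coef_map_id0.
by rewrite (pshift_factor _ _ size_expanding_poly expanding_polyE) [RHS]addrC subrK.
Qed.

Let betaNZ : beta != 0. Proof. by rewrite gt_eqF// (lt_trans ltr01). Qed.

Lemma expanding_expval y (w : nat -> int) k n :
  (forall j, (j < n)%N -> f_shift f y (k + j%:Z) = (w j)%:~R) ->
  expanding y k = - expval beta w n + beta ^- n * expanding y (k + n%:Z).
Proof.
elim: n => [|n IH] Hw; first by rewrite expval0 oppr0 add0r expr0 invr1 mul1r addr0.
rewrite IH; last by move=> j jn; apply: Hw; rewrite ltnS ltnW.
have -> : k + n.+1%:Z = k + n%:Z + 1 by lia.
rewrite expanding_step Hw// expvalS exprSr invfM; field.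
by rewrite betaNZ expf_neq0.
Qed.

Variables (om : R[i] -> R[i]) (b : linfZ -> {ptws int -> R}).
Hypotheses (hom : partial_fraction f om) (bW : forall v, Wf0 f (b v)).
Local Notation y := (lift f om b).

Lemma expanding_growth (v : linfZ) : exists K g : R, [/\ 0 <= K, 1 < g, g < beta &
  forall n : nat, `|expanding (y v) n%:Z| <= K * g ^+ n].
Proof.
have [K [g [K0 g1 gb HK]]] := xi_bar_growth om fmonic beta1 v.
have [[M HM] _] := bW v.
have M0 : 0 <= M by apply: le_trans (HM 0).
have g0 : 0 < g by exact: lt_trans g1.
pose A := \sum_(i < size f) `|q`_i| * ((K + M) * g ^+ i).
exists A, g; split => //.
  by apply: sumr_ge0 => i _; rewrite !mulr_ge0 ?addr_ge0 ?exprn_ge0// ltW.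
move=> n; rewrite /expanding /pshift mulr_suml.
apply: le_trans (ler_norm_sum _ _ _) _; apply: ler_sum => i _.
rewrite normrM -!mulrA ler_wpM2l// -exprD addnC -PoszD /lift.
apply: le_trans (ler_normD _ _) _; rewrite mulrDl lerD//.
by apply: le_trans (HM _) _; rewrite -[leLHS]mulr1 ler_wpM2l// exprn_ege1// ltW.
Qed.

(** The expanding coordinate at time 0 is minus the number expanded by the
    nonnegative digits: solve the recursion of [expanding_step] backwards from a
    remote time, where [expanding_growth] makes the initial value negligible
    against [beta ^+ n]. *)
Lemma expanding_approx (v : linfZ) N (eta : R) : V_beta beta v -> 0 < eta ->
  exists x, [/\ unit_real x, forall j, (j < N)%N -> dig x j = v j%:Z &
    `|x + expanding (y v) 0| < eta].
Proof.
move=> /V_betaP Vv eta0; have [K [g [K0 g1 gb HK]]] := expanding_growth v.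
have g0 : 0 < g by exact: lt_trans g1.
have beta0 : 0 < beta by exact: lt_trans beta1.
have [n [Nn small]] : exists n, (N <= n)%N /\ (1 + K) * (g / beta) ^+ n < eta.
  have gb1 : `|g / beta| < 1 by rewrite ger0_norm ?divr_ge0 ?ltW// ltr_pdivrMr// mul1r.
  have K1 : 0 < 1 + K by rewrite ltr_pwDl.
  have /cvgrPdist_lt/(_ (eta / (1 + K))) := cvg_expr gb1.
  rewrite divr_gt0// => /(_ isT)[m _ Hm].
  exists (maxn N m); split; first exact: leq_maxl.
  have := Hm _ (leq_maxr N m); rewrite /= sub0r normrN.
  rewrite ger0_norm ?exprn_ge0 ?divr_ge0 ?ltW//.
  by rewrite ltr_pdivlMr// mulrC.
have [x x01 Hx] := Vv (-1) n.
have vE j : v (-1 + j.+1%:Z) = v j%:Z by congr (v _); lia.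
exists x; split => //; first by move=> j jN; rewrite Hx ?vE// (leq_trans jN).
rewrite (@expanding_expval (y v) (fun j => v j%:Z) 0 n); last first.
  by move=> j _; rewrite f_shift_lift// add0r.
rewrite {1}(expansion beta1 x n) (@eq_expval _ _ _ (fun j => v j%:Z)); last first.
  by move=> j jn; rewrite Hx// vE.
rewrite addrACA subrr add0r -mulrDr add0r normrM.
apply: le_lt_trans small.
have -> : (1 + K) * (g / beta) ^+ n = beta ^- n * ((1 + K) * g ^+ n).
  by rewrite expr_div_n mulrA mulrC.
have bn0 : 0 <= beta ^- n by rewrite invr_ge0 exprn_ge0// ltW.
rewrite (ger0_norm bn0) ler_wpM2l//.
apply: le_trans (ler_normD _ _) _; rewrite mulrDl lerD//.
have /andP[T0 T1] := iterT_unit beta n x01.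
by rewrite mul1r ger0_norm// (le_trans (ltW T1))// exprn_ege1// ltW.
Qed.

(** By [expanding_approx] this is the separation of cylinders; two points in
    adjacent cylinders may still be arbitrarily close. *)
Lemma expanding_separation N : exists2 delta : R, 0 < delta &
  forall v1 v2 v3 : linfZ, V_beta beta v1 -> V_beta beta v2 -> V_beta beta v3 ->
    (exists2 j, (j < N)%N & v1 j%:Z <> v2 j%:Z) ->
    (exists2 j, (j < N)%N & v1 j%:Z <> v3 j%:Z) ->
    (exists2 j, (j < N)%N & v2 j%:Z <> v3 j%:Z) ->
    `|expanding (y v1) 0 - expanding (y v2) 0| < delta ->
    `|expanding (y v1) 0 - expanding (y v3) 0| < delta ->
    `|expanding (y v2) 0 - expanding (y v3) 0| < delta -> False.
Proof.
have [d d0 Hd] := cylinder_separation beta1 N.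
have d4 : 0 < d / 4 by rewrite divr_gt0.
exists (d / 2); first by rewrite divr_gt0.
move=> v1 v2 v3 V1 V2 V3 [j12 j12N n12] [j13 j13N n13] [j23 j23N n23] h12 h13 h23.
have [x1 [u1 D1 a1]] := expanding_approx N V1 d4.
have [x2 [u2 D2 a2]] := expanding_approx N V2 d4.
have [x3 [u3 D3 a3]] := expanding_approx N V3 d4.
have D12 : exists2 j, (j < N)%N & dig x1 j <> dig x2 j by exists j12 => //; rewrite D1// D2.
have D13 : exists2 j, (j < N)%N & dig x1 j <> dig x3 j by exists j13 => //; rewrite D1// D3.
have D23 : exists2 j, (j < N)%N & dig x2 j <> dig x3 j by exists j23 => //; rewrite D2// D3.
have sym x x' : (exists2 j, (j < N)%N & dig x j <> dig x' j) ->
    exists2 j, (j < N)%N & dig x' j <> dig x j.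
  by move=> [j jN n]; exists j => //; apply/nesym.
have D21 := sym _ _ D12; have D31 := sym _ _ D13; have D32 := sym _ _ D23.
move: h12 h13 h23 a1 a2 a3.
set p1 := expanding _ 0; set p2 := expanding _ 0; set p3 := expanding _ 0.
rewrite !ltr_norml => /andP[h1 h2] /andP[h3 h4] /andP[h5 h6] /andP[a1 a1'] /andP[a2 a2'] /andP[a3 a3'].
have ne x x' : (exists2 j, (j < N)%N & dig x j <> dig x' j) -> x != x'.
  by move=> [j _ n]; apply/eqP => e; apply: n; rewrite e.
have := ne _ _ D12; have := ne _ _ D13; have := ne _ _ D23.
have [l23|l23|//] := ltgtP x2 x3 => _; have [l13|l13|//] := ltgtP x1 x3 => _;
  have [l12|l12|//] := ltgtP x1 x2 => _.
all: try lra.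
- by have := Hd _ _ _ u1 u2 u3 l12 l23 D12 D23; lra.
- by have := Hd _ _ _ u2 u1 u3 l12 l13 D21 D13; lra.
- by have := Hd _ _ _ u2 u3 u1 l23 l13 D23 D31; lra.
- by have := Hd _ _ _ u1 u3 u2 l13 l23 D13 D32; lra.
- by have := Hd _ _ _ u3 u1 u2 l13 l12 D31 D12; lra.
- by have := Hd _ _ _ u3 u2 u1 l23 l12 D32 D21; lra.
Qed.

End BetaShift.

(** * Fibres of the coded map *)

(** Each value of [g] is taken at most twice. *)
Lemma pigeonhole_two (T : eqType) (F : finType) (s : seq T) (g : T -> F) : uniq s ->
  (forall x y z, x \in s -> y \in s -> z \in s -> g x = g y -> g x = g z ->
     x != y -> x != z -> y != z -> False) ->
  (size s <= 2 * #|F|)%N.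
Proof.
move=> us H.
have -> : size s = (\sum_(a : F) count (fun x => g x == a) s)%N.
  elim: s {us H} => [|x s IH]; first by rewrite big1.
  rewrite /= big_split/= -IH (bigD1 (g x))//= eqxx big1 ?addn0//.
  by move=> a /negbTE; rewrite eq_sym => ->.
rewrite mulnC -sum_nat_const; apply: leq_sum => a _.
rewrite -size_filter; case E : [seq x <- s | g x == a] => [|x [|y [|z r]]]//.
have uf : uniq [seq x <- s | g x == a] by rewrite filter_uniq.
have mf w : w \in [:: x, y, z & r] -> w \in s /\ g w = a.
  by rewrite -E mem_filter => /andP[/eqP].
have [xs gx] := mf x (mem_head _ _).
have [ys gy] : y \in s /\ g y = a by apply: mf; rewrite !inE eqxx orbT.
have [zs gz] : z \in s /\ g z = a by apply: mf; rewrite !inE eqxx !orbT.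
move: uf; rewrite E /= !inE !negb_or => /andP[/and3P[xy xz _] /andP[/andP[yz _] _]].
by case: (H x y z xs ys zs); rewrite ?gx ?gy ?gz.
Qed.

Section IntegerCode.
Context {R : realType}.

(** The integer parts of a window of a real sequence bounded by [M]; together
    with the sequence mod 1 they determine the window. *)
Definition code (m M : nat) (y : int -> R) (k : int) : {ffun 'I_m -> 'I_M.*2.+1} :=
  [ffun i : 'I_m => inord (absz (Num.floor (y (k + i%:Z)) + M%:Z))].

Lemma code_floor m M (y y' : int -> R) k :
  (forall i : 'I_m, `|y (k + i%:Z)| <= M%:R) ->
  (forall i : 'I_m, `|y' (k + i%:Z)| <= M%:R) ->
  code m M y k = code m M y' k ->
  forall i : 'I_m, Num.floor (y (k + i%:Z)) = Num.floor (y' (k + i%:Z)).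
Proof.
move=> By By' e i.
have bnd (x : R) : `|x| <= M%:R -> - M%:Z <= Num.floor x <= M%:Z.
  rewrite ler_norml => /andP[h1 h2]; apply/andP; split.
    by rewrite floor_ge_int intrN.
  by rewrite -(ler_int R); exact: le_trans (floor_le _) h2.
have := congr1 (fun h : {ffun 'I_m -> 'I_M.*2.+1} => val (h i)) e.
rewrite /= !ffunE.
have := bnd _ (By i); have := bnd _ (By' i).
set a := Num.floor _; set c := Num.floor _ => /andP[c1 c2] /andP[a1 a2].
by rewrite !inordK; lia.
Qed.

Lemma floor_frac (t : R) : t = (Num.floor t)%:~R + frac (mod1 t).
Proof. by rewrite frac_mod1 addrC subrK. Qed.

End IntegerCode.

Lemma shifted_index (k : int) (j j0 : nat) : (`|k| < j0)%N -> (j0 <= j)%N ->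
  exists2 i : nat, (i < j.*2)%N & i%:Z - j%:Z = k.
Proof. by move=> kj jj; exists (absz (k + j%:Z)); lia. Qed.

Section CountableToOne.
Context {R : realType}.
Variables (beta : R) (f : {poly int}) (om : R[i] -> R[i]) (b : linfZ -> {ptws int -> R}).
Hypotheses (beta1 : 1 < beta) (fmonic : f \is monic)
  (fbeta : root (map_poly intr f) beta) (hom : partial_fraction f om)
  (bW : forall v, Wf0 f (b v))
  (bborel : measurable_fun [set: borel linfZ]
     (b : borel linfZ -> borel {ptws int -> R})).
Local Notation y := (lift f om b).
Local Notation S := (linfZ_shift (- 1) : borel linfZ -> borel linfZ).

Definition bounded_window (M : nat) : set linfZ :=
  [set v | forall i : 'I_(size f), `|y v i%:Z| <= M%:R].

Lemma measurable_bounded_window M :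
  measurable (bounded_window M : set (borel linfZ)).
Proof.
have -> : bounded_window M = \bigcap_(i in [set: 'I_(size f)])
    (fun v => `|y v i%:Z|) @^-1` `]-oo, M%:R]%classic.
  apply/seteqP; split=> v Hv i; first by move=> _; rewrite /= in_itv/=; exact: Hv.
  by have := Hv i I; rewrite /= in_itv.
apply: fin_bigcap_measurable => // i _; rewrite -[X in measurable X]setTI.
have mi := measurableT_comp (@normr_measurable R setT)
  (measurable_lift om fmonic bborel i%:Z).
by apply: mi.
Qed.

Lemma bounded_windowW M M' : (M <= M')%N -> bounded_window M `<=` bounded_window M'.
Proof. by move=> MM v Hv i; apply: le_trans (Hv i) _; rewrite ler_nat. Qed.

Lemma bounded_window_exhaust : \bigcap_M ~` bounded_window M = set0.
Proof.
apply/seteqP; split=> // v H.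
pose M := (\max_(i < size f) (Num.truncn `|y v i%:Z|).+1)%N.
apply: (H M I) => i; apply: le_trans (ltW (truncnS_gt _)) _.
by rewrite ler_nat; apply: (@leq_bigmax _ (fun i : 'I_(size f) => (Num.truncn `|y v i%:Z|).+1)).
Qed.

(** Two lifts of the same point of the torus with equal codes agree on the
    window; hence so do their expanding coordinates. *)
Lemma code_window (v v' : linfZ) (M : nat) (k : int) :
  rho (y v) = rho (y v') ->
  (forall i : 'I_(size f), `|y v (k + i%:Z)| <= M%:R) ->
  (forall i : 'I_(size f), `|y v' (k + i%:Z)| <= M%:R) ->
  code (size f) M (y v) k = code (size f) M (y v') k ->
  expanding beta f (y v) k = expanding beta f (y v') k.
Proof.
move=> xi Bv Bv' cc; apply: eq_bigr => i _; congr (_ * _).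
rewrite [LHS]floor_frac [RHS]floor_frac (code_floor Bv Bv' cc i); congr (_ + frac _).
exact: (congr1 (fun g => g (k + i%:Z)) xi).
Qed.

Variable V0 : set (borel linfZ).
Hypotheses (V0V : V0 `<=` V_beta beta) (V0eq : V0 `<=` equivariant_set f om b).

Lemma iter_backward j (v : linfZ) : iter j S v = linfZ_shift (- j%:Z) v.
Proof. by rewrite iter_linfZ_shift; congr linfZ_shift; rewrite -mulr_natr; lia. Qed.

(** Points with the same image that visit a bounded window most of the time do
    so simultaneously at some remote past time; there they have few possible
    codes, each shared by at most two of them. *)
Lemma fibre_finite (M : nat) (z : {ptws int -> circle R}) :
  finite_set [set v : linfZ | [/\ V0 v, ~ often S (~` bounded_window M) v &
    rho (y v) = z]].
Proof.
set F := [set v | _]; apply: contrapT => infF.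
pose D := #|{ffun 'I_(size f) -> 'I_M.*2.+1}|.
have D0 : (0 < D)%N.
  by apply/card_gt0P; exists [ffun=> ord0].
have [s [us ss sF]] : exists s : seq linfZ, [/\ uniq s, size s = (6 * D)%N &
    forall v, v \in s -> F v].
  have [X XF Xn] := infinite_set_fset (6 * D)%N infF.
  exists (take (6 * D) (finmap.enum_fset X)); split.
  - exact: take_uniq (finmap.fset_uniq X).
  - by rewrite size_takel.
  - by move=> v /mem_take vX; exact: XF.
(* all the points of [s] differ pairwise within the window of radius [j0] *)
have ch (v v' : linfZ) : exists k, v != v' -> v k <> v' k.
  have [->|nvv'] := eqVneq v v'; first by exists 0.
  have [k Hk] : exists k, v k <> v' k.
    apply: contrapT => /forallNP H; move/eqP: nvv'; apply; apply: linfZ_ext => k.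
    by apply: contrapT; exact: H.
  by exists k.
pose kap v v' := projT1 (cid (ch v v')).
have Hkap (v v' : linfZ) : v != v' -> v (kap v v') <> v' (kap v v') := projT2 (cid (ch v v')).
pose j0 := (\max_(v <- s) \max_(v' <- s) `|kap v v'|.+1)%N.
have kapj (v v' : linfZ) : v \in s -> v' \in s -> (`|kap v v'| < j0)%N.
  move=> vs v's; apply: leq_trans (@leq_bigmax_seq _ _ xpredT (fun v => \max_(v' <- s) `|kap v v'|.+1)%N v vs isT).
  exact: (@leq_bigmax_seq _ _ xpredT (fun v' => `|kap v v'|.+1)%N v' v's isT).
have few j : (j0 <= j)%N ->
    (size [seq v <- s | iter j S v \in bounded_window M] <= 2 * D)%N.
  move=> j0j; apply: (@pigeonhole_two _ _ _ (fun v => code (size f) M (y v) (- j%:Z))).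
    exact: filter_uniq.
  have [d d0 Hsep] := expanding_separation beta1 fmonic fbeta hom bW j.*2.
  move=> v1 v2 v3; rewrite !mem_filter.
  move=> /andP[/set_mem B1 s1] /andP[/set_mem B2 s2] /andP[/set_mem B3 s3] c12 c13 n12 n13 n23.
  have [W1 _ z1] := sF _ s1; have [W2 _ z2] := sF _ s2; have [W3 _ z3] := sF _ s3.
  rewrite !iter_backward in B1 B2 B3.
  have bw (v : linfZ) : V0 v -> bounded_window M (linfZ_shift (- j%:Z) v) ->
      forall i : 'I_(size f), `|y v (- j%:Z + i%:Z)| <= M%:R.
    by move=> Wv Bv i; have := Bv i; rewrite (V0eq Wv) addrC.
  have ex (v : linfZ) : V0 v -> expanding beta f (y (linfZ_shift (- j%:Z) v)) 0 =
      expanding beta f (y v) (- j%:Z).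
    by move=> Wv; apply: eq_bigr => i _; rewrite add0r (V0eq Wv) addrC.
  have e12 : expanding beta f (y v1) (- j%:Z) = expanding beta f (y v2) (- j%:Z).
    by apply: (code_window _ (bw _ W1 B1) (bw _ W2 B2) c12); rewrite z1 z2.
  have e13 : expanding beta f (y v1) (- j%:Z) = expanding beta f (y v3) (- j%:Z).
    by apply: (code_window _ (bw _ W1 B1) (bw _ W3 B3) c13); rewrite z1 z3.
  have df (v v' : linfZ) : v \in s -> v' \in s -> v != v' -> exists2 i, (i < j.*2)%N &
      linfZ_shift (- j%:Z) v i%:Z <> linfZ_shift (- j%:Z) v' i%:Z.
    move=> vs v's /Hkap; have := kapj _ _ vs v's; set k := kap v v' => kj nk.
    have [i ij ik] := shifted_index kj j0j.
    by exists i => //; rewrite !linfZ_shiftE ik.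
  apply: (Hsep (linfZ_shift (- j%:Z) v1) (linfZ_shift (- j%:Z) v2) (linfZ_shift (- j%:Z) v3)).
  - exact/V_beta_shift/V0V.
  - exact/V_beta_shift/V0V.
  - exact/V_beta_shift/V0V.
  - exact: df.
  - exact: df.
  - exact: df.
  - by rewrite (ex _ W1) (ex _ W2) e12 subrr normr0.
  - by rewrite (ex _ W1) (ex _ W3) e13 subrr normr0.
  - by rewrite (ex _ W2) (ex _ W3) -e12 e13 subrr normr0.
(* each point is good at two thirds of the first [n] times, while at most a third
   of the points are good at any time after [j0] *)
pose n := (3 * j0).+1.
pose goods (v : linfZ) := (\sum_(0 <= j < n) (iter j S v \in bounded_window M))%N.
have good_many (v : linfZ) : v \in s -> (2 * n <= 3 * goods v)%N.
  move=> /sF[_ /forallNP/(_ n)/negP + _]; rewrite -leqNgt => Hv.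
  have : (goods v + visits S (~` bounded_window M) n v = n)%N.
    rewrite /goods /visits -big_split/= -[RHS]subn0 -[RHS]muln1 -sum_nat_const_nat.
    by apply: eq_bigr => j _; rewrite in_setC; case: (_ \in _).
  by move: Hv; rewrite /n; lia.
have lower : (12 * D * n <= 3 * \sum_(v <- s) goods v)%N.
  rewrite big_distrr/= (_ : (12 * D * n = \sum_(v <- s) 2 * n)%N).
    rewrite big_seq [leqRHS]big_seq; exact: leq_sum.
  by rewrite big_const_seq count_predT iter_addn_0 ss; lia.
have upper : (\sum_(v <- s) goods v <= j0 * (6 * D) + n * (2 * D))%N.
  rewrite /goods exchange_big/=.
  rewrite (@big_cat_nat _ _ _ j0)//=; last by rewrite /n; clear; lia.
  have szE j : (\sum_(v <- s) (iter j S v \in bounded_window M) =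
      size [seq v <- s | iter j S v \in bounded_window M])%N.
    by rewrite size_filter -sum1_count [RHS]big_mkcond/=; apply: eq_bigr => v _; case: (_ \in _).
  apply: leq_add.
    apply: (@leq_trans (\sum_(0 <= j < j0) 6 * D)%N).
      by apply: leq_sum => j _; rewrite szE size_filter -ss; exact: count_size.
    by rewrite sum_nat_const_nat subn0.
  apply: (@leq_trans (\sum_(j0 <= j < n) 2 * D)%N).
    rewrite big_nat_cond [leqRHS]big_nat_cond; apply: leq_sum => j /andP[/andP[j0j _] _].
    by rewrite szE; exact: few.
  by rewrite sum_nat_const_nat leq_mul2r leq_subr orbT.
move: lower upper; set G := (\sum_(v <- s) goods v)%N; rewrite /n; clear -D0; nia.
Qed.

End CountableToOne.

(** * The torus and its shift *)

Section ToralSet.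
Context {R : realType}.
Variable f : {poly int}.

Lemma measurable_Xset : measurable (@Xset R f : set (borel {ptws int -> circle R})).
Proof.
pose g (k : int) (x : {ptws int -> circle R}) : R := \sum_(j < size f) (f`_j)%:~R * frac (x (k + j%:Z)).
pose e (i : nat) : int := odflt 0 (unpickle i).
have XE : @Xset R f = \bigcap_i \bigcup_n (g (e i) @^-1` [set (e n)%:~R]).
  have E k (x : {ptws int -> circle R}) : \sum_(j < size f) x (k + j%:Z) *~ f`_j = mod1 (g k x).
    by rewrite -mod1_sumz; apply: eq_bigr => j _; rewrite mod1_frac.
  apply/seteqP; split=> x Hx.
    move=> i _; have := Hx (e i); rewrite E => /mod1_eq0/intrP[n gn].
    by exists (pickle n) => //=; rewrite gn [in RHS]/e pickleK.
  move=> k; rewrite E; apply/mod1_eq0; have [n _ /=] := Hx (pickle k) I.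
  by rewrite [in g _ _]/e pickleK/= => ->; exact: intr_int.
rewrite XE; apply: bigcapT_measurable => i; apply: bigcupT_measurable => n.
apply: (@measurable_preimage _ _ (borel {ptws int -> circle R}) (measurableTypeR R)) => //.
apply: (@measurable_sum _ (borel {ptws int -> circle R}) R setT _ (index_enum 'I_(size f))
  (fun j x => (f`_j)%:~R * frac (x (e i + (nat_of_ord j)%:Z)))) => j.
apply: measurable_funM; first exact: measurable_cst.
exact: measurable_frac_coord.
Qed.

Lemma measurable_zshift (n : int) :
  measurable_fun [set: borel {ptws int -> circle R}]
    (zshift n : borel {ptws int -> circle R} -> borel {ptws int -> circle R}).
Proof.
have cont : continuous (zshift n : {ptws int -> circle R} -> {ptws int -> circle R}).
  apply: continuous_into_ptws => k.
  exact: (@proj_continuous int (fun=> circle R) (k + n)).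
apply: (@measurability _ _ (borel {ptws int -> circle R}) (borel {ptws int -> circle R})
  setT _ (@open {ptws int -> circle R})) => // _ [U oU <-]; rewrite setTI.
apply: sub_sigma_algebra.
by have /continuousP := cont; apply.
Qed.

Lemma iter_zshift1 (T : Type) n (x : int -> T) k : iter n (zshift 1) x k = x (k + n%:Z).
Proof.
elim: n k => [|n IH] k; first by rewrite addr0.
by rewrite iterS /zshift IH; congr x; lia.
Qed.

End ToralSet.

(** * Entropy and multiplicity of the coded map *)

Section Arcs.
Context {R : realType}.

Definition arc (K : nat) (c : circle R) : 'I_K.+1 := inord (Num.truncn (K.+1%:R * frac c)).

Lemma arcP K c (a : 'I_K.+1) : arc K c = a <-> a%:R <= K.+1%:R * frac c < a.+1%:R.
Proof.
have K0 : 0 < K.+1%:R :> R by rewrite ltr0n.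
have p0 : 0 <= K.+1%:R * frac c by rewrite mulr_ge0 ?frac_ge0// ltW.
have lK : (Num.truncn (K.+1%:R * frac c) < K.+1)%N.
  by rewrite truncn_lt_nat// -[ltRHS]mulr1 ltr_pM2l// frac_lt1.
split=> [<-|ac]; first by rewrite /arc inordK// truncn_itv.
by apply: val_inj; rewrite /= inordK//; exact: truncn_def.
Qed.

Lemma arc_close K (c c' : circle R) : arc K c = arc K c' ->
  `|frac c - frac c'| < K.+1%:R^-1.
Proof.
move=> e; have /arcP := e; have /arcP := erefl (arc K c').
move=> /andP[a1 a2] /andP[b1 b2].
have K0 : 0 < K.+1%:R :> R by rewrite ltr0n.
rewrite -(ltr_pM2l K0) divff ?gt_eqF// -[X in X * _](gtr0_norm K0) -normrM.
by rewrite mulrBr ltr_norml; rewrite -natr1 in a2 b2; apply/andP; split; lra.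
Qed.

Lemma fin_rv_arc K (k : int) :
  fin_rv ((fun x => arc K (x k)) : borel {ptws int -> circle R} -> 'I_K.+1).
Proof.
move=> a.
rewrite (_ : _ @^-1` _ = (fun x => frac (x k)) @^-1`
  `[a%:R / K.+1%:R, a.+1%:R / K.+1%:R[%classic).
  by rewrite -[X in measurable X]setTI; apply: (measurable_frac_coord k).
have K0 : 0 < K.+1%:R :> R by rewrite ltr0n.
apply/seteqP; split=> x.
  by move=> /arcP; rewrite /= in_itv/= ler_pdivrMr// ltr_pdivlMr// !(mulrC (frac _)).
by rewrite /= in_itv/= ler_pdivrMr// ltr_pdivlMr// !(mulrC (frac _)) => /arcP.
Qed.

Definition arcs (m K : nat) (k : int) (x : borel {ptws int -> circle R}) :
  {ffun 'I_m -> 'I_K.+1} := [ffun i : 'I_m => arc K (x (k + i%:Z))].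

Lemma fin_rv_arcs m K k : fin_rv (arcs m K k).
Proof.
move=> s; have -> : arcs m K k @^-1` [set s] =
    \bigcap_(i in [set: 'I_m]) (fun x => arc K (x (k + i%:Z))) @^-1` [set s i].
  apply/seteqP; split=> [x /= <- i _ /=|x st]; first by rewrite ffunE.
  by apply/ffunP => i; rewrite ffunE; exact: st.
by apply: fin_bigcap_measurable => // i _; exact: fin_rv_arc.
Qed.

End Arcs.

Section CodedMap.
Context {R : realType}.
Variables (beta : R) (f : {poly int}) (om : R[i] -> R[i]) (b : linfZ -> {ptws int -> R}).
Hypotheses (beta1 : 1 < beta) (fmonic : f \is monic)
  (fbeta : root (map_poly intr f) beta) (hom : partial_fraction f om)
  (bW : forall v, Wf0 f (b v))
  (bborel : measurable_fun [set: borel linfZ]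
     (b : borel linfZ -> borel {ptws int -> R})).
Local Notation y := (lift f om b).
Local Notation q := (expanding_poly beta f).

Variable V0 : set (borel linfZ).
Hypotheses (V0V : V0 `<=` V_beta beta) (V0eq : V0 `<=` equivariant_set f om b).

Lemma expanding_close (v v' : linfZ) (M : nat) (k : int) (e : R) :
  (forall i : 'I_(size f), `|frac (rho (y v) (k + i%:Z)) - frac (rho (y v') (k + i%:Z))| <= e) ->
  (forall i : 'I_(size f), `|y v (k + i%:Z)| <= M%:R) ->
  (forall i : 'I_(size f), `|y v' (k + i%:Z)| <= M%:R) ->
  code (size f) M (y v) k = code (size f) M (y v') k ->
  `|expanding beta f (y v) k - expanding beta f (y v') k| <=
    (\sum_(i < size f) `|q`_i|) * e.
Proof.
move=> He Bv Bv' cc; rewrite /expanding /pshift -sumrB mulr_suml.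
apply: le_trans (ler_norm_sum _ _ _) _; apply: ler_sum => i _.
rewrite -mulrBr normrM ler_wpM2l//.
rewrite (floor_frac (y v _)) [y v' _]floor_frac (code_floor Bv Bv' cc i).
by rewrite opprD addrACA subrr add0r; exact: He.
Qed.

Variable nu : probability (borel linfZ) R.
Hypotheses (mV0 : measurable V0) (nuV0 : nu V0 = 1%E)
  (inv : invariant_measure nu (linfZ_shift 1)).

(** Points with the same arcs and the same integer parts at time [- L] have
    nearly equal expanding coordinates there, so by [expanding_separation] at
    most two windows of digits share these data. *)
Lemma words_per_code (M L K : nat) (I : finType) (X : linfZ -> I) (Dx : set linfZ) delta :
  (forall v v' : linfZ, ~ Dx v -> ~ Dx v' -> agree L v v' -> X v = X v') ->
  (forall v1 v2 v3 : linfZ, V_beta beta v1 -> V_beta beta v2 -> V_beta beta v3 ->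
    (exists2 j : nat, (j < L.*2)%N & v1 j <> v2 j) ->
    (exists2 j : nat, (j < L.*2)%N & v1 j <> v3 j) ->
    (exists2 j : nat, (j < L.*2)%N & v2 j <> v3 j) ->
    `|expanding beta f (y v1) 0 - expanding beta f (y v2) 0| < delta ->
    `|expanding beta f (y v1) 0 - expanding beta f (y v3) 0| < delta ->
    `|expanding beta f (y v2) 0 - expanding beta f (y v3) 0| < delta -> False) ->
  (\sum_(i < size f) `|q`_i|) / K.+1%:R < delta ->
  forall j, (#|[pred i | `[< exists v : linfZ, [/\ [/\ V0 v,
      bounded_window f om b M (linfZ_shift (- L%:Z) v) & ~ Dx v],
      X v = i & arcs (size f) K (- L%:Z) (rho (y v)) = j] >]]| <=
    2 * #|{ffun 'I_(size f) -> 'I_M.*2.+1}|)%N.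
Proof.
move=> XD sep dK j; set P := [pred i | _].
have /choice[g Hg] : forall i, exists v : linfZ, i \in P -> [/\ [/\ V0 v,
      bounded_window f om b M (linfZ_shift (- L%:Z) v) & ~ Dx v],
      X v = i & arcs (size f) K (- L%:Z) (rho (y v)) = j].
  move=> i; have [/asboolP[v Hv]|_] := boolP (i \in P); first by exists v.
  by exists point.
rewrite cardE.
apply: (@pigeonhole_two _ _ _ (fun i => code (size f) M (y (g i)) (- L%:Z))).
  exact: enum_uniq.
move=> i1 i2 i3; rewrite !mem_enum => P1 P2 P3 c12 c13 n12 n13 n23.
have [[W1 B1 D1] X1 A1] := Hg _ P1.
have [[W2 B2 D2] X2 A2] := Hg _ P2.
have [[W3 B3 D3] X3 A3] := Hg _ P3.
have bw (v : linfZ) : V0 v -> bounded_window f om b M (linfZ_shift (- L%:Z) v) ->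
    forall i : 'I_(size f), `|y v (- L%:Z + i%:Z)| <= M%:R.
  by move=> Wv Bv i; have := Bv i; rewrite (V0eq Wv) addrC.
have ex (v : linfZ) : V0 v -> expanding beta f (y (linfZ_shift (- L%:Z) v)) 0 =
    expanding beta f (y v) (- L%:Z).
  by move=> Wv; apply: eq_bigr => i _; rewrite add0r (V0eq Wv) addrC.
have cl i i' : i \in P -> i' \in P ->
    code (size f) M (y (g i)) (- L%:Z) = code (size f) M (y (g i')) (- L%:Z) ->
    `|expanding beta f (y (linfZ_shift (- L%:Z) (g i))) 0 -
      expanding beta f (y (linfZ_shift (- L%:Z) (g i'))) 0| < delta.
  move=> /Hg[[W B D] Xi A] /Hg[[W' B' D'] Xi' A'] cc; rewrite (ex _ W) (ex _ W').
  apply: le_lt_trans dK; apply: expanding_close (bw _ W B) (bw _ W' B') cc => a.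
  apply/ltW/arc_close; have := congr1 (fun h : {ffun _} => h a) (etrans A (esym A')).
  by rewrite /= !ffunE.
have df i i' : i \in P -> i' \in P -> i != i' -> exists2 a : nat, (a < L.*2)%N &
    linfZ_shift (- L%:Z) (g i) a%:Z <> linfZ_shift (- L%:Z) (g i') a%:Z.
  move=> /Hg[[W B D] Xi A] /Hg[[W' B' D'] Xi' A'] /eqP ii'.
  apply: contrapT => Hn; apply: ii'; rewrite -Xi -Xi'; apply: XD => // k kL.
  apply: contrapT => nk; apply: Hn; exists (absz (k + L%:Z)); first by clear -kL; lia.
  by rewrite !linfZ_shiftE (_ : (absz (k + L%:Z))%:Z - L%:Z = k)//; clear -kL; lia.
apply: (sep (linfZ_shift (- L%:Z) (g i1)) (linfZ_shift (- L%:Z) (g i2))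
  (linfZ_shift (- L%:Z) (g i3))).
- exact/V_beta_shift/V0V.
- exact/V_beta_shift/V0V.
- exact/V_beta_shift/V0V.
- exact: df.
- exact: df.
- exact: df.
- exact: cl.
- exact: cl.
- by apply: cl => //; rewrite -c12 -c13.
Qed.

(** The digits in a long time window are, up to a bounded ambiguity and an
    exceptional set, functions of one sufficiently fine coordinate window
    taken far in the past. *)
Lemma words_from_arcs (k : nat) (Q : borel linfZ -> 'I_k) : fin_rv Q ->
  forall eps : R, 0 < eps ->
  exists n (J : finType) (B : borel {ptws int -> circle R} -> J),
    [/\ (0 < n)%N, fin_rv B &
      Hent nu (fun v : borel linfZ => (word_of Q (linfZ_shift 1) n v, B (rho (y v)))) <=
      Hent nu (B \o (fun v => rho (y v))) + n%:R * eps].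
Proof.
move=> mQ eps eps0.
have k0 : (0 < k)%N by case: (Q point) => [a ak]; exact: leq_ltn_trans ak.
have lk0 : 0 <= ln k%:R :> R by rewrite ln_ge0// ler1n.
(* [e1] pays for the two exceptional sets, each of which may cost
   [n * ln k]; [n] makes the constant ambiguity [2 * D] negligible *)
pose e1 : R := eps / (4 * (ln k%:R + 1)).
have e10 : 0 < e1 by rewrite divr_gt0// mulr_gt0// ltr_wpDl.
have mW M : measurable (~` bounded_window f om b M : set (borel linfZ)).
  by apply: measurableC; exact: measurable_bounded_window.
have [M nuM] : exists M, (nu (~` bounded_window f om b M) <= e1%:E)%E.
  apply: small_tail => //; last exact: bounded_window_exhaust.
  by move=> M N MN; apply: subsetC; exact: bounded_windowW.
pose D := (2 * #|{ffun 'I_(size f) -> 'I_M.*2.+1}|)%N.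
have D0 : (0 < D)%N by rewrite muln_gt0/=; apply/card_gt0P; exists [ffun=> ord0].
pose n := (Num.truncn ((ln 2 + ln D%:R) / (eps / 2))).+1.
have nE : ln 2 + ln D%:R <= n%:R * (eps / 2).
  rewrite -ler_pdivrMr ?divr_gt0//; apply/ltW; exact: truncnS_gt.
pose X := word_of Q (linfZ_shift 1) n.
have mX : fin_rv X by apply: fin_rv_word => //; exact: measurable_linfZ_shift.
have [L [Dx [mDx nuDx XD]]] := window_approximation_rv nu mX e10.
have [delta d0 sep] := expanding_separation beta1 fmonic fbeta hom bW L.*2.
pose K := Num.truncn ((\sum_(i < size f) `|q`_i|) / delta).
have dK : (\sum_(i < size f) `|q`_i|) / K.+1%:R < delta.
  by rewrite ltr_pdivrMr ?ltr0n// mulrC -ltr_pdivrMr//; exact: truncnS_gt.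
pose B := arcs (R := R) (size f) K (- L%:Z).
have mB : fin_rv B by exact: fin_rv_arcs.
have mr : measurable_fun [set: borel linfZ]
    ((fun v => rho (y v)) : borel linfZ -> borel {ptws int -> circle R}).
  by apply: (@measurable_rho R _ (borel linfZ)) => j; exact: measurable_lift.
exists n, _, B; split => //.
pose W : set (borel linfZ) := linfZ_shift (- L%:Z) @^-1` bounded_window f om b M.
have mWL : measurable W.
  apply: (@measurable_preimage _ _ (borel linfZ) (borel linfZ)).
    exact: measurable_linfZ_shift.
  exact: measurable_bounded_window.
pose Gam : set (borel linfZ) := [set v : linfZ | [/\ V0 v, W v & ~ Dx v]].
have GE : Gam = V0 `&` W `&` ~` Dx.
  by apply/seteqP; split=> v; [case=> ? ? ?; split=> //; split|case=> [[]]].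
have mG : measurable Gam by rewrite GE; apply: measurableI; [exact: measurableI|exact: measurableC].
have nuG : fine (nu (~` Gam)) <= e1 *+ 2.
  have nuWc : (nu (~` W) <= e1%:E)%E.
    by apply: le_trans nuM; rewrite le_eqVlt; apply/orP; left; apply/eqP;
      exact: (invariant_linfZ_shift inv (- L%:Z) (mW M)).
  have nuV0c : nu (~` V0) = 0%E by rewrite probability_setC// nuV0 subee.
  have le2 : (nu (~` Gam) <= (e1 *+ 2)%:E)%E.
    rewrite GE !setCI setCK.
    apply: le_trans (measureU2 _ _ _) _ => //.
      by apply: measurableU; exact: measurableC.
    rewrite mulr2n EFinD; apply: leeD => //.
    apply: le_trans (measureU2 _ _ _) _; [exact: measurableC|exact: measurableC|].
    rewrite -[leRHS]add0e; apply: leeD; last exact: nuWc.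
    by rewrite le_eqVlt; apply/orP; left; apply/eqP; exact: nuV0c.
  by rewrite -lee_fin fineK// fin_num_measure//; exact: measurableC.
have cnt : forall j, (#|[pred i | `[< exists v : linfZ, [/\ Gam v, X v = i & (B \o (fun v => rho (y v))) v = j] >]]| <= D)%N.
  by move=> j; exact: (@words_per_code M L K _ X Dx delta XD sep dK j).
have mBr : fin_rv (B \o ((fun v => rho (y v)) : borel linfZ -> _)).
  by move=> j; rewrite comp_preimage; apply: measurable_preimage => //; exact: mB.
apply: le_trans (Hent_count nu mX mBr mG D0 cnt) _.
rewrite -!addrA lerD2l card_ffun !card_ord natrX lnXn ?ltr0n//.
have -> : n%:R * eps = n%:R * (eps / 2) + n%:R * (eps / 2) by field.
rewrite addrA; apply: lerD => //.
rewrite -(mulr_natl (ln _)) mulrCA ler_wpM2l//.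
apply: (@le_trans _ _ (e1 *+ 2 * (ln k%:R + 1))).
  by apply: ler_pM; rewrite ?fine_ge0// lerDl.
rewrite le_eqVlt /e1 -(mulr_natl _ 2); apply/orP; left; apply/eqP; field.
by rewrite gt_eqF// ltr_wpDl.
Qed.

Lemma lift_iter (v : linfZ) n : V0 v ->
  rho (y (iter n (linfZ_shift 1) v)) = iter n (zshift 1) (rho (y v)).
Proof.
move=> Vv; apply/funext => k; rewrite iter_zshift1 iter_linfZ_shift /rho.
by rewrite (V0eq Vv); congr (mod1 (y v _)); rewrite -mulr_natr mul1r natz.
Qed.

Theorem entropy_coded :
  entropy nu (linfZ_shift 1 : borel linfZ -> borel linfZ) =
  entropy (pushforward nu ((fun v => rho (y v)) : borel linfZ -> borel {ptws int -> circle R}))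
    (zshift 1 : borel {ptws int -> circle R} -> _).
Proof.
have mr : measurable_fun [set: borel linfZ]
    ((fun v => rho (y v)) : borel linfZ -> borel {ptws int -> circle R}).
  by apply: (@measurable_rho R _ (borel linfZ)) => j; exact: measurable_lift.
apply: (entropy_factor_eq (measurable_linfZ_shift 1) inv (measurable_zshift 1) mr mV0 nuV0).
  by move=> v n; exact: lift_iter.
exact: words_from_arcs.
Qed.

(** Almost every backward orbit spends most of its time in some bounded window,
    so a fibre is a countable union of the finite sets of [fibre_finite]. *)
Theorem countable_to_one_coded : measurable (V_beta beta : set (borel linfZ)) ->
  countable_to_one_ae nu (V_beta beta) (@Xset R f : set (borel {ptws int -> circle R}))
    ((fun v => rho (y v)) : borel linfZ -> borel {ptws int -> circle R}).
Proof.
move=> mV.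
pose S : borel linfZ -> borel linfZ := linfZ_shift (- 1).
have mS : measurable_fun [set: borel linfZ] S by exact: measurable_linfZ_shift.
have mW M : measurable (~` bounded_window f om b M : set (borel linfZ)).
  by apply: measurableC; exact: measurable_bounded_window.
pose A := \bigcup_M ~` often S (~` bounded_window f om b M).
have A1 : nu A = 1%E.
  apply: eventually_rarely_visited => //; first exact: invariant_linfZ_shift.
    by move=> M N MN; apply: subsetC; exact: bounded_windowW.
  exact: bounded_window_exhaust.
have mA : measurable A.
  by apply: bigcupT_measurable => M; apply: measurableC; exact: measurable_often.
exists (A `&` V0), (@Xset R f); split.
- by split; [exact: measurableI|move=> v [_ /V0V]].
- by split => //; exact: measurable_Xset.
- by rewrite (measure_full_setI mV0 nuV0 mA).
- rewrite /pushforward -(@probability_setT _ _ _ nu); congr (nu _).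
  by apply/seteqP; split=> // v _; exact: Xset_rho_lift.
- move=> z _; pose F M := [set v : linfZ | [/\ V0 v, ~ often S (~` bounded_window f om b M) v & rho (y v) = z]].
  apply: (@sub_countable _ _ _ (\bigcup_M F M)).
    by apply: subset_card_le => v [/= vz [[M _ Mv] Vv]]; exists M.
  apply: bigcup_countable; first exact: countableP.
  move=> M _; apply: finite_set_countable.
  exact: (fibre_finite beta1 fmonic fbeta hom bW V0V V0eq).
Qed.

End CodedMap.

(** * Singularity *)

Section ExpandingDigits.
Context {R : realType}.
Variables (beta : R) (f : {poly int}) (om : R[i] -> R[i]) (b : linfZ -> {ptws int -> R}).
Hypotheses (beta1 : 1 < beta) (fmonic : f \is monic)
  (fbeta : root (map_poly intr f) beta) (hom : partial_fraction f om)
  (bW : forall v, Wf0 f (b v)).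
Local Notation y := (lift f om b).
Local Notation T := (T_beta beta).
Local Notation dig := (digit beta).

(** Numbers whose digits are those of [v] up to a given rank approach [s].  If
    [s] has other digits, the left endpoint of a cylinder lies between, so that
    [s] is such an endpoint. *)
Lemma expanding_digits (v : linfZ) : V_beta beta v ->
  let s := - expanding beta f (y v) 0 in
  [\/ unit_real s /\ (forall j : nat, dig s j = v j), finite_expansion beta s | s = 1].
Proof.
move=> Vv s.
have near N eta : 0 < eta -> exists x, [/\ unit_real x,
    forall j, (j < N)%N -> dig x j = v j & `|x - s| < eta].
  by move=> eta0; have := expanding_approx beta1 fmonic fbeta hom bW N Vv eta0; rewrite /s opprK.
have s0 : 0 <= s.
  apply/ler_addgt0Pr => e e0; have [x [/andP[x0 _] _]] := near 0%N e e0.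
  by rewrite ltr_norml => /andP[_]; rewrite ltrBlDl => h; exact: le_trans x0 (ltW h).
have s1 : s <= 1.
  apply/ler_addgt0Pr => e e0; have [x [/andP[_ x1] _]] := near 0%N e e0.
  by rewrite ltr_norml => /andP[h _]; lra.
have [->|sN1] := eqVneq s 1; first exact: Or33.
have s01 : unit_real s by rewrite /unit_real s0 lt_neqAle sN1.
have [Hd|/existsNP[j dj]] := pselect (forall j : nat, dig s j = v j); first exact: Or31.
apply: Or32; pose N := j.+1; exists N.
pose a := expval beta (dig s) N; pose c := expval beta (fun j : nat => v j) N.
have aE : s = a + beta ^- N * iter N T s := expansion beta1 s N.
have as_ : a <= s := left_endpoint_le beta1 N s01.
have [as1|as1] := eqVneq a s.
  have : beta ^- N * iter N T s = 0 by move: aE; rewrite -/a as1; lra.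
  move=> /eqP; rewrite mulf_eq0 invr_eq0 expf_eq0/= gt_eqF ?(lt_trans ltr01)//.
  by move=> /eqP.
exfalso; have {as1} as1 : 0 < s - a by rewrite subr_gt0 lt_neqAle as1.
(* an approximation of [s] within [eta] can cross neither [a] nor [c] *)
pose eta := Num.min (s - a) (if s < c then c - s else 1).
have eta0 : 0 < eta by rewrite lt_min as1/=; case: ifP => // h; rewrite subr_gt0.
have [x [x01 xv]] := near N eta eta0.
rewrite lt_min => /andP[h1 h2].
have dx : exists2 i, (i < N)%N & dig x i <> dig s i.
  by exists j => //; rewrite xv//; exact/nesym.
have [xs|xs|xs] := ltgtP x s.
- have := lt_left_endpoint beta1 x01 s01 xs dx; rewrite -/a => xa.
  by move: h1; rewrite ltr0_norm ?subr_lt0//; lra.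
- have dx' : exists2 i, (i < N)%N & dig s i <> dig x i.
    by have [i iN ni] := dx; exists i => //; exact/nesym.
  have := lt_left_endpoint beta1 s01 x01 xs dx'.
  have := left_endpoint_le beta1 N x01.
  rewrite (@eq_expval _ beta (dig x) (fun j : nat => v j) N) // -/c => cx sc.
  by move: h2; rewrite sc gtr0_norm ?subr_gt0//; lra.
- by have [i _] := dx; rewrite xs.
Qed.

Variable theta : R[i].
Hypotheses (thetaO : Omega f theta) (theta1 : cnorm theta = 1).
Local Notation qt := (cofactor_poly f theta).

(** The coordinate along the eigendirection of [theta]: the shift rotates it, up
    to the digit. *)
Definition neutral (w : int -> R) (k : int) : R[i] :=
  pshift (size f) qt (fun j => (w j)%:C)%C k.

Lemma neutral_step w k : neutral w (k + 1) = theta * neutral w k + (f_shift f w k)%:C%C.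
Proof.
have -> : (f_shift f w k)%:C%C = pshift (size f) (polyC_of R f) (fun j => (w j)%:C)%C k.
  rewrite /f_shift raddf_sum; apply: eq_bigr => j _.
  rewrite coef_polyC_of /zshift -(rmorph_int (real_complex R)).
  exact: (rmorphM (real_complex R)).
have thS : theta \in Omega_seq (R := R) f by apply/(Omega_seqP fmonic).
rewrite (pshift_factor _ _ (size_cofactor fmonic theta) (cofactorE fmonic thS)).
by rewrite /neutral [RHS]addrC subrK.
Qed.

Lemma neutral_rsum (v : linfZ) (n : nat) :
  neutral (y v) n = theta ^+ n * (neutral (y v) 0 + rsum theta (fun j : nat => v j) n).
Proof.
have th0 : theta != 0 by rewrite -cnorm_eq0 theta1 oner_eq0.
elim: n => [|n IH]; first by rewrite expr0 mul1r /rsum big_ord0 addr0.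
have -> : n.+1%:Z = n%:Z + 1 by lia.
rewrite neutral_step IH rsumS f_shift_lift// rmorph_int.
rewrite addrA [in RHS]mulrDr exprS mulrA; congr (_ + _).
by rewrite mulrC -mulrA -exprS mulVf ?mulr1// expf_neq0.
Qed.

(** In a bounded window the neutral coordinate is bounded, and in the rotating
    frame it differs from the rotated digit sum by a constant. *)
Lemma tight_expanding (v : linfZ) (M : nat) :
  equivariant_set f om b v ->
  ~ often (linfZ_shift 1 : borel linfZ -> borel linfZ) (~` bounded_window f om b M) v ->
  let s := - expanding beta f (y v) 0 in
  unit_real s -> (forall j : nat, dig s j = v j) ->
  exists M' : nat, tight beta theta M'%:R s.
Proof.
move=> Ev /forallNP rare s s01 ds.
pose C := \sum_(i < size f) cnorm qt`_i * M%:R + cnorm (neutral (y v) 0).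
exists (Num.truncn C).+1; split => //; exists 0%N => n; rewrite addn0.
have {rare} := rare n; move=> /negP; rewrite -leqNgt; apply: leq_trans.
rewrite leq_mul2l/= /excess /visits; apply: leq_sum => k _.
case: ltP => // lt1; rewrite lt0b in_setC; apply/negP => /set_mem Bk.
move: lt1; apply/negP; rewrite -leNgt.
apply: (@le_trans _ _ C); last by apply/ltW; exact: truncnS_gt.
rewrite (@eq_rsum _ theta _ (fun j : nat => v j)); last by move=> j _; exact: ds.
have -> : rsum theta (fun j : nat => v j) k =
    theta ^- k * neutral (y v) k - neutral (y v) 0.
  rewrite (neutral_rsum v k) mulKf; first by rewrite addrC addKr.
  by rewrite expf_neq0// -cnorm_eq0 theta1 oner_eq0.
apply: le_trans (cnormB _ _) _; rewrite lerD2r cnormM cnormV cnormX theta1 expr1n invr1 mul1r.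
apply: le_trans (cnorm_sum _ _ _) _; apply: ler_sum => i _.
rewrite cnormM ler_wpM2l ?cnorm_ge0// cnorm_real.
have := Bk i; rewrite iter_linfZ_shift Ev.
by rewrite (_ : i%:Z + 1 *+ k = k%:Z + i%:Z)// addrC; congr (_ + _); rewrite -mulr_natr mul1r natz.
Qed.

End ExpandingDigits.

Section HaarNull.
Context {R : realType}.
Variables (beta : R) (f : {poly int}).
Hypotheses (beta1 : 1 < beta) (fmonic : f \is monic)
  (fbeta : root (map_poly intr f) beta).
Local Notation q := (expanding_poly beta f).
Local Notation m := (size f).
Local Notation mu := (@lebesgue_measure R).
Local Notation RR := (measurableTypeR R).
Local Notation torus := (borel {ptws int -> circle R}).

(** The ambiguity in the expanding coordinate of a lift of a point mod 1. *)
Definition lattice_value (z : {ffun 'I_m -> int}) : R := \sum_(i < m) q`_i * (z i)%:~R.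

Lemma lattice_valueD z z' : lattice_value (z + z') = lattice_value z + lattice_value z'.
Proof. by rewrite -big_split; apply: eq_bigr => i _; rewrite ffunE intrD mulrDr. Qed.

Definition saturation (G : set R) : set R := [set t | exists z, G (t + lattice_value z)].

Lemma saturation_lattice G t z : saturation G (t + lattice_value z) <-> saturation G t.
Proof.
split=> -[z' Hz']; first by exists (z + z'); rewrite lattice_valueD addrA.
exists (z' - z); rewrite -addrA -lattice_valueD addrCA subrr addr0.
exact: Hz'.
Qed.

Let e (n : nat) : {ffun 'I_m -> int} := odflt [ffun=> 0] (unpickle n).

Let saturationE G : saturation G = \bigcup_n (fun t : R => lattice_value (e n) + 1 * t) @^-1` G.
Proof.
apply/seteqP; split=> t.
  by move=> [z Hz]; exists (pickle z) => //=; rewrite /e pickleK/= mul1r addrC.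
by move=> [n _ /= Hn]; exists (e n); rewrite addrC -[X in _ + X]mul1r.
Qed.

Lemma measurable_saturation G : measurable (G : set RR) -> measurable (saturation G : set RR).
Proof.
move=> mG; rewrite saturationE; apply: bigcupT_measurable => n.
by apply: measurable_preimage => //; exact: measurable_affine.
Qed.

Lemma saturation_null G : measurable (G : set RR) -> mu G = 0%E -> mu (saturation G) = 0%E.
Proof.
move=> mG G0; rewrite saturationE; apply: measure_negligible.
  apply: bigcupT_measurable => n.
  by apply: measurable_preimage => //; exact: measurable_affine.
apply: negligible_bigcup => n; exists ((fun t : R => lattice_value (e n) + 1 * t) @^-1` G).
split => //; last exact: lebesgue_affine0.
by apply: measurable_preimage => //; exact: measurable_affine.
Qed.

Definition frac_value (x : {ptws int -> circle R}) : R := \sum_(i < m) q`_i * frac (x i%:Z).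

Lemma measurable_frac_value : measurable_fun setT (frac_value : torus -> RR).
Proof.
apply: (@measurable_sum _ torus R setT _ (index_enum 'I_m)
  (fun i x => q`_i * frac (x (nat_of_ord i)%:Z))) => i.
apply: measurable_funM; first exact: measurable_cst.
exact: measurable_frac_coord.
Qed.

Lemma expanding_frac_value (y : int -> R) :
  exists z, expanding beta f y 0 = frac_value (rho y) + lattice_value z.
Proof.
exists [ffun i : 'I_m => Num.floor (y i%:Z)].
rewrite -big_split; apply: eq_bigr => i _.
by rewrite /= add0r ffunE -mulrDr addrC -floor_frac.
Qed.

Hypothesis simple : q.[beta] != 0.

(** The expanding eigenline of the torus, parametrized so that the expanding
    coordinate decreases at unit speed. *)
Definition flow (t : R) : {ptws int -> circle R} :=
  rho (fun k => - (t / q.[beta]) * beta ^ k).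

Lemma Xset_flow t : Xset f (flow t).
Proof.
move=> k; rewrite /flow /rho mod1_sumz; apply/mod1_eq0.
suff -> : \sum_(i < m) (f`_i)%:~R * (- (t / q.[beta]) * beta ^ (k + i%:Z)) = 0 :> R.
  exact: int_num0.
have b0 : beta != 0 by rewrite gt_eqF// (lt_trans ltr01).
rewrite (eq_bigr (fun i : 'I_m => - (t / q.[beta]) * beta ^ k * ((f`_i)%:~R * beta ^+ i))).
  rewrite -mulr_sumr; have /rootP := fbeta; rewrite /horner_eval horner_coef size_map_intr//.
  by under eq_bigr do rewrite coef_map_id0//; move=> ->; rewrite mulr0.
by move=> i _; rewrite expfzDr// -exprnP; ring.
Qed.

Lemma frac_value_flow t (x : {ptws int -> circle R}) : exists z,
  frac_value (fun n => flow t n + x n) = frac_value x - t + lattice_value z.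
Proof.
pose w (i : int) : R := frac (x i) - t / q.[beta] * beta ^ i.
exists [ffun i : 'I_m => - Num.floor (w i%:Z)].
have qb : \sum_(i < m) q`_i * beta ^ i%:Z = q.[beta].
  by rewrite (horner_coef_wide _ (ltnW (size_expanding_poly beta fmonic))).
have -> : - t = \sum_(i < m) q`_i * (- (t / q.[beta]) * beta ^ i%:Z).
  rewrite (eq_bigr (fun i : 'I_m => - (t / q.[beta]) * (q`_i * beta ^ i%:Z))); last by move=> i _; rewrite mulrCA.
  by rewrite -mulr_sumr qb mulNr divfK.
rewrite -!big_split; apply: eq_bigr => i _ /=.
have -> : flow t i%:Z + x i%:Z = mod1 (w i%:Z).
  by rewrite addrC /w mod1D mod1_frac -mulNr.
rewrite frac_mod1 ffunE -!mulrDr; congr (_ * _).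
by rewrite /w intrN mulNr.
Qed.

(** A Haar measure is invariant along the expanding flow, which moves the
    expanding coordinate by translations of the line; so preimages of null sets
    are null, by Fubini. *)
Lemma haar_null (lambda : probability torus R) (G : set R) :
  is_haar_measure f lambda -> measurable (G : set RR) -> mu G = 0%E ->
  lambda [set x : torus | saturation G (- frac_value x)] = 0%E.
Proof.
move=> [_ haar] mG G0; pose H := saturation G.
have mH : measurable (H : set RR) by exact: measurable_saturation.
have H0 : mu H = 0%E by exact: saturation_null.
pose E : set torus := [set x | H (- frac_value x)].
have mphi := measurable_frac_value.
have mE : measurable E.
  apply: (@measurable_preimage _ _ torus RR (fun x => - frac_value x)) => //.
  exact: measurable_funN.
pose P : set (torus * RR) := [set p | H (p.2 - frac_value p.1)].
have mP : measurable P.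
  apply: (@measurable_preimage _ _ _ RR (fun p : torus * RR => p.2 - frac_value p.1)) => //.
  apply: measurable_funB; first exact: measurable_snd.
  exact: (measurableT_comp mphi measurable_fst).
pose mu' : {sigma_finite_measure set RR -> \bar R} := mu.
have := indic_fubini_tonelli lambda mu' mP.
have -> : (\int[lambda]_x fubini_F mu' (EFin \o \1_P) x = 0)%E.
  rewrite indic_fubini_tonelli_FE//; apply: integral0_eq => x _ /=.
  rewrite (_ : xsection P x = (fun t : R => - frac_value x + 1 * t) @^-1` H).
    exact: lebesgue_affine0.
  by apply/seteqP; split=> t; rewrite /xsection/= in_setE /P/= mul1r addrC.
have -> : (\int[mu']_t fubini_G lambda (EFin \o \1_P) t = \int[mu']_t (lambda E))%E.
  rewrite indic_fubini_tonelli_GE//; apply: eq_integral => t _ /=.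
  rewrite -(haar _ (Xset_flow t) _ mE); congr (lambda _).
  have sat x : saturation G (- frac_value (fun n => flow t n + x n)) <->
      saturation G (t - frac_value x).
    have [z ->] := frac_value_flow t x; rewrite -(saturation_lattice G _ z).
    by rewrite (_ : _ + lattice_value z = t - frac_value x)//; ring.
  by apply/seteqP; split=> x; rewrite /ysection/= in_setE /P/E/H/= => /sat.
rewrite integral_cst// => /esym/eqP; rewrite mule_eq0 => /orP[/eqP//|/eqP].
move=> mu0; exfalso; have mI : measurable (`[0, 1]%classic : set RR) by exact: measurable_itv.
have : (mu' `[0%R, 1%R]%classic <= mu' setT)%E by apply: le_measure; rewrite ?inE.
rewrite mu0 [mu' _]lebesgue_measure_itv/= lte_fin ltr01 oppr0 adde0 lee_fin.
by rewrite leNgt ltr01.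
Qed.

End HaarNull.

Section CodedSingular.
Context {R : realType}.
Variables (beta : R) (f : {poly int}) (om : R[i] -> R[i]) (b : linfZ -> {ptws int -> R}).
Hypotheses (beta1 : 1 < beta) (fmonic : f \is monic)
  (fbeta : root (map_poly intr f) beta) (simple : (expanding_poly beta f).[beta] != 0)
  (hom : partial_fraction f om) (bW : forall v, Wf0 f (b v))
  (bborel : measurable_fun [set: borel linfZ]
     (b : borel linfZ -> borel {ptws int -> R})).
Local Notation y := (lift f om b).
Local Notation mu := (@lebesgue_measure R).
Local Notation RR := (measurableTypeR R).
Variable theta : R[i].
Hypotheses (thetaO : Omega f theta) (theta1 : cnorm theta = 1) (thetaN1 : theta != 1).
Variable nu : probability (borel linfZ) R.
Hypothesis inv : invariant_measure nu (linfZ_shift 1).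
Variable V0 : set (borel linfZ).
Hypotheses (mV0 : measurable V0) (nuV0 : nu V0 = 1%E)
  (V0V : V0 `<=` V_beta beta) (V0eq : V0 `<=` equivariant_set f om b).

(** The possible values of minus the expanding coordinate. *)
Definition exceptional : set R :=
  (\bigcup_(M : nat) tight beta theta M%:R) `|` finite_expansion beta `|` [set 1].

Lemma measurable_exceptional : measurable (exceptional : set RR).
Proof.
apply: measurableU; last exact: measurable_set1.
apply: measurableU; first by apply: bigcupT_measurable => M; exact: measurable_tight.
apply: countable_measurable; last exact: countable_finite_expansion.
exact: measurable_set1.
Qed.

Lemma exceptional_null : mu exceptional = 0%E.
Proof.
apply: measure_negligible; first exact: measurable_exceptional.
have mT M : measurable (tight beta theta M%:R : set RR) by exact: measurable_tight.
have mF : measurable (finite_expansion beta : set RR).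
  by apply: countable_measurable; [exact: measurable_set1|exact: countable_finite_expansion].
apply: negligibleU; last first.
  by exists [set 1]; split => //; exact: lebesgue_measure_set1.
apply: negligibleU; last first.
  exists (finite_expansion beta); split => //.
  exact/countable_lebesgue_measure0/countable_finite_expansion.
apply: negligible_bigcup => M; exists (tight beta theta M%:R); split => //.
exact: tight_null.
Qed.

(** The coded measure is carried by the points whose expanding coordinate is, up
    to the lattice ambiguity, minus an exceptional number; Haar measure does not
    charge this set. *)
Theorem singular_coded (lambda : probability (borel {ptws int -> circle R}) R) :
  is_haar_measure f lambda ->
  mutually_singular
    (pushforward nu ((fun v => rho (y v)) : borel linfZ -> borel {ptws int -> circle R}))
    lambda.
Proof.
move=> haar.
pose E : set (borel {ptws int -> circle R}) :=
  [set x | saturation beta f exceptional (- frac_value beta f x)].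
have mE : measurable E.
  apply: (@measurable_preimage _ _ (borel {ptws int -> circle R}) RR (fun x => - frac_value beta f x)).
    exact: measurable_funN (measurable_frac_value beta f).
  exact: measurable_saturation measurable_exceptional.
have mr : measurable_fun [set: borel linfZ]
    ((fun v => rho (y v)) : borel linfZ -> borel {ptws int -> circle R}).
  by apply: (@measurable_rho R _ (borel linfZ)) => j; exact: measurable_lift.
exists (~` E); split; first exact: measurableC; last first.
  rewrite setCK; apply: haar_null => //; first exact: measurable_exceptional.
  exact: exceptional_null.
pose S : borel linfZ -> borel linfZ := linfZ_shift 1.
have mS : measurable_fun [set: borel linfZ] S by exact: measurable_linfZ_shift.
have mW M : measurable (~` bounded_window f om b M : set (borel linfZ)).
  by apply: measurableC; exact: measurable_bounded_window.
pose A := \bigcup_M ~` often S (~` bounded_window f om b M).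
have A1 : nu A = 1%E.
  apply: eventually_rarely_visited => //.
    by move=> M N MN; apply: subsetC; exact: bounded_windowW.
  exact: bounded_window_exhaust.
have mA : measurable A.
  by apply: bigcupT_measurable => M; apply: measurableC; exact: measurable_often.
have mAV : measurable (A `&` V0) by exact: measurableI.
have AV1 : nu (A `&` V0) = 1%E by rewrite (measure_full_setI mV0 nuV0 mA).
have mN : measurable ((fun v => rho (y v)) @^-1` (~` E) : set (borel linfZ)).
  apply: (@measurable_preimage _ _ (borel linfZ) (borel {ptws int -> circle R})) => //.
  exact: measurableC.
rewrite /pushforward -(@measure0 _ _ _ nu).
apply: (measure_eq_on_full mAV AV1 mN measurable0) => v [[M _ rare] Vv].
split=> // nE; apply: nE.
have [z hz] := expanding_frac_value beta f (y v).
have sat : saturation beta f exceptional (- expanding beta f (y v) 0).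
  exists 0; rewrite (_ : lattice_value beta 0 = 0) ?addr0; last first.
    by rewrite /lattice_value big1// => i _; rewrite ffunE mulr0.
  have [[s01 ds]|fe|s1] := expanding_digits beta1 fmonic fbeta hom bW (V0V Vv).
  - have [M' HM'] := tight_expanding beta1 fmonic fbeta hom bW thetaO theta1 (V0eq Vv) rare s01 ds.
    by left; left; exists M'.
  - by left; right.
  - by right.
rewrite /E/= -(@saturation_lattice R beta f exceptional _ (- z)).
have -> // : - frac_value beta f (rho (y v)) + lattice_value beta (- z) = - expanding beta f (y v) 0.
rewrite hz opprD; congr (_ + _); rewrite /lattice_value -sumrN.
by apply: eq_bigr => i _; rewrite ffunE intrN mulrN.
Qed.

End CodedSingular.

(** * Minimality, and the assembly *)

Section Minimality.
Context {R : realType}.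
Variables (beta : R) (f : {poly int}).
Hypothesis min : is_minimal_polynomial f beta.

Let fQ : {poly rat} := map_poly intr f.

Let fQE : map_poly (ratr : rat -> R) fQ = map_poly intr f.
Proof.
by rewrite -map_poly_comp_id0 ?rmorph0//; apply: eq_map_poly => m /=; rewrite ratr_int.
Qed.

Let fQroot : root (map_poly (ratr : rat -> R) fQ) beta.
Proof. by rewrite fQE; case: min. Qed.

Let size_fQ : size fQ = size f.
Proof. by case: min => fm _ _; rewrite size_map_poly_id0// (monicP fm) oner_eq0. Qed.

Let fQ0 : fQ != 0.
Proof. by case: min => fm _ _; rewrite -size_poly_eq0 size_fQ size_poly_eq0 monic_neq0. Qed.

Let size_fQ_gt1 : (1 < size fQ)%N.
Proof.
have := root_size_gt1 _ fQroot; rewrite size_map_poly; apply.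
by rewrite map_poly_eq0.
Qed.

(** The value is [f'(beta)], and [f'] has smaller degree than [f]. *)
Lemma minimal_simple_root : (expanding_poly beta f).[beta] != 0.
Proof.
have [fm fb Hmin] := min; apply/negP => q0.
have dE : (map_poly intr f : {poly R})^`().[beta] = (expanding_poly beta f).[beta].
  rewrite (expanding_polyE fb) derivM derivXsubC mulr1 hornerD hornerM hornerXsubC.
  by rewrite subrr mulr0 add0r.
have dQ0 : fQ^`() != 0.
  apply/eqP => /polyP/(_ (size fQ).-2); rewrite coef_deriv coef0 -subn2 -subSn//.
  rewrite subSS subn1 -lead_coefE => /eqP; rewrite mulrn_eq0 lead_coef_eq0 (negbTE fQ0) orbF.
  by case: (size fQ) size_fQ_gt1 => [|[]].
have := Hmin _ dQ0; rewrite -deriv_map fQE rootE dE => /(_ q0).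
by rewrite -size_fQ leqNgt lt_size_deriv.
Qed.

(** If 1 were a root, [beta] would be a root of the quotient by ['X - 1]. *)
Lemma minimal_root_neq1 (theta : R[i]) : 1 < beta -> Omega f theta -> theta != 1.
Proof.
move=> beta1 Ot; apply/eqP => t1; have [fm fb Hmin] := min.
have f1 : root fQ 1.
  have h1 (K : nzRingType) : (map_poly intr f : {poly K}).[1] = (f.[1])%:~R.
    by rewrite -(horner_map (intr : int -> K)) rmorph1.
  move: Ot; rewrite /Omega/= t1 /polyC_of => /rootP; rewrite h1 => /eqP.
  by rewrite intr_eq0 => /eqP f1; apply/rootP; rewrite h1 f1.
have fE : fQ = fQ %/ ('X - 1%:P) * ('X - 1%:P) by rewrite divpK// dvdp_XsubCl.
set g := fQ %/ _ in fE.
have g0 : g != 0 by apply: contraNneq fQ0 => g0; rewrite fE g0 mul0r.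
have : root (map_poly (ratr : rat -> R) g) beta.
  have := fQroot; rewrite fE rmorphM rootM /= => /orP[//|].
  by rewrite rmorphB/= map_polyX map_polyC/= rmorph1 root_XsubC gt_eqF.
move=> /(Hmin _ g0); rewrite -size_fQ fE size_Mmonic ?monicXsubC// size_XsubC.
by rewrite addn2/= ltnn.
Qed.

End Minimality.

Theorem theorem6p3 (R : realType) (beta : R) (f : {poly int})
    (hbeta : is_salem beta f)
    (bomega : R[i] -> R[i]) (hbomega : partial_fraction f bomega)
    (nu : probability (borel linfZ) R)
    (hnuV : nu (V_beta beta) = 1%E)
    (hnu_inv : invariant_measure nu (linfZ_shift 1))
    (hnu_bounded : weakly_d_bounded f bomega nu)
    (b : linfZ -> {ptws int -> R})
    (hbW : forall v : linfZ, Wf0 f (b v))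
    (hbborel : measurable_fun [set: borel linfZ]
                 (b : borel linfZ -> borel {ptws int -> R}))
    (hbcob : {ae nu, forall v : linfZ,
       cocycle_d f bomega 1 v =
       (fun n => b (linfZ_shift 1 v) n - zshift 1 (b v) n)}) :
  let X : set (borel {ptws int -> circle R}) := @Xset R f in
  let alpha : borel {ptws int -> circle R} -> borel {ptws int -> circle R} :=
    zshift 1 in
  let xi : borel linfZ -> borel {ptws int -> circle R} :=
    xi_star_b f bomega b in
  let mu := pushforward nu xi in
  (* xi is a nu-a.e. equivariant Borel map into X, so mu is an alpha-invariant
     probability measure on X *)
  [/\ measurable_fun [set: borel linfZ] xi,
      forall v, X (xi v),
      {ae nu, forall v : linfZ, xi (linfZ_shift 1 v) = alpha (xi v)},
      mu X = 1%E &
      invariant_measure mu alpha] /\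
  [/\ countable_to_one_ae nu (V_beta beta) X xi,
      forall lambda : probability (borel {ptws int -> circle R}) R,
        is_haar_measure f lambda -> mutually_singular mu lambda &
      entropy nu (linfZ_shift 1) = entropy mu alpha].
Proof.
move=> X alpha xi mu.
have [beta1 _ fmin _ [theta [thetaO thetaN]]] := hbeta.
have [fmonic fbeta _] := fmin.
have theta1 : cnorm theta = 1 by exact: cnorm_eq.
have thetaN1 : theta != 1 by exact: minimal_root_neq1 fmin _ beta1 thetaO.
have xiE : xi = (fun v => rho (lift f bomega b v)) :> (borel linfZ -> borel {ptws int -> circle R}).
  by apply/funext => v; exact: xi_star_bE.
have mV : measurable (V_beta beta : set (borel linfZ)) by exact: measurable_V_beta.
have [V0 [mV0 nuV0 V0eq V0V]] :=
  equivariant_set_full fmonic hnu_inv hbborel hbcob mV hnuV.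
have mxi : measurable_fun [set: borel linfZ] xi.
  by rewrite xiE; apply: (@measurable_rho R _ (borel linfZ)) => j; exact: measurable_lift.
have xiX v : X (xi v) by rewrite xiE; exact: Xset_rho_lift.
have xi_shift : {ae nu, forall v : linfZ, xi (linfZ_shift 1 v) = alpha (xi v)}.
  case: (lift_shift hbcob) => N [mN N0 sub]; exists N; split => //.
  apply: subset_trans sub => v nP e; apply: nP.
  by rewrite xiE/= e.
split; split => //.
- rewrite /mu /pushforward -(@probability_setT _ _ _ nu); congr (nu _).
  by apply/seteqP; split=> // v _; exact: xiX.
- move=> A mA; rewrite /mu /pushforward -comp_preimage.
  have mxiA : measurable (xi @^-1` A) by exact: measurable_preimage.
  rewrite -(hnu_inv _ mxiA); apply: (measure_eq_on_full mV0 nuV0).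
  + apply: measurable_preimage => //.
    exact: (measurableT_comp (measurable_zshift 1) mxi).
  + by apply: measurable_preimage => //; exact: measurable_linfZ_shift.
  + move=> v Vv; have e : xi (linfZ_shift 1 v) = alpha (xi v).
      by rewrite xiE; exact: (lift_iter V0eq 1%N Vv).
    by rewrite /preimage /= e.
- by rewrite xiE; exact: (countable_to_one_coded beta1 fmonic fbeta hbomega hbW hbborel
    V0V V0eq mV0 nuV0 hnu_inv mV).
- move=> lambda haar; rewrite /mu xiE.
  exact: (singular_coded beta1 fmonic fbeta (minimal_simple_root fmin) hbomega hbW hbborel
    thetaO theta1 thetaN1 hnu_inv mV0 nuV0 V0V V0eq haar).
- by rewrite /mu xiE; exact: (entropy_coded beta1 fmonic fbeta hbomega hbW hbborel
    V0V V0eq mV0 nuV0 hnu_inv).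
Qed.
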